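(* Let $n\ge 2$ be a squarefree integer, $K=\mathbb{Q}(\sqrt n)$, and let $\Delta$ be the cusp group of the Hilbert-Blumenthal surface $(\mathcal{H}^2\times\mathcal{H}^2)/\mathrm{PSL}_2(\mathbb{Z}_K)$ at $(\infty,\infty)$. Then $\Delta$ admits the fundamental domain $\mathscr{R}_n=\bigsqcup_{h\in\mathbb{R}^+}\mathcal{T}_n(h)$, in which each cusp section $\mathcal{T}_n=\mathcal{T}_n(h)$ is described as follows. (The image $\Psi(\mathcal{T}_n)\subset\mathbb{R}^3$ does not depend on $h$.) **Sides.** The region $\Psi(\mathcal{T}_n)$ lies between the planes $k=1$ and $k=\varepsilon^4$. The rest of the sides of $\Psi(\mathcal{T}_n)$ are (portions of) the surfaces defined by $$2zx_1+z^2+k^2\big(2\sigma(z)x_2+\sigma(z)^2\big)=0,$$ contributed over exactly those $z\in\mathbb{Z}_K$ that occur in the list $L$ constructed as follows. 1. Let $z_1=1$; let $z_1'=\sqrt n$ if $n\not\equiv 1\pmod 4$, and $z_1'=\frac{1+\sqrt n}{2}$ if $n\equiv 1\pmod 4$. 2. The terminal pair is $\{\varepsilon^2z_1,\varepsilon^2z_1'\}$. 3. Starting with $i=1$, and as long as $\{z_i,z_i'\}\ne\{\varepsilon^2z_1,\varepsilon^2z_1'\}$, let $z_{i+1}=z_i+z_i'$ and let $z_{i+1}'$ be the element of $\{z_i,z_i'\}$ on which $|\sigma(\cdot)|$ is smaller. This procedure stops; let $m$ be the index at which it stops, i.e. the first index with $\{z_m,z_m'\}=\{\varepsilon^2z_1,\varepsilon^2z_1'\}$.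 4. Let $L=\{\pm z_1,\pm z_1',\dots,\pm z_m,\pm z_m'\}$, and if $n\equiv 1\pmod 4$ also include $\pm\sigma(z_1')$ in $L$. **Torus shapes.** The slices of $\overline{\Psi(\mathcal{T}_n)}$ orthogonal to the $k$-axis, $1\le k\le\varepsilon^4$, are flat tori (after the identification of their sides by $\mathrm{U}$). As polygons they are all hexagons, with exactly the following exceptions. For $1\le i<m$, the sides contributed by $\pm z_i$ and $\pm z_i'$ bound a parallelogram, which is the slice at $$k=\sqrt{\frac{-z_iz_i'}{\sigma(z_iz_i')}}.$$ If $n\not\equiv 1\pmod 4$, this also holds for $i=m$, at $k=\varepsilon^4$. (If $n\equiv1\pmod 4$, the parallelogram bounded by the surfaces defined by $\pm z_m$ and $\pm z_m'$ crosses the $k$-axis above $\Psi(\mathcal{T}_n)$, i.e. at a level $k>\varepsilon^4$.) **Gluing maps.** For each pair $\pm z$ of elements of $L$, the pair of sides contributed by $z$ and $-z$ is attached by $\tau_z\in\mathrm{U}$ (which carries the side contributed by $z$ onto the side contributed by $-z$). Finally, the slices of $\overline{\mathcal{T}_n}$ at $k=1$ and $k=\varepsilon^4$ are attached by $\eta_1=\begin{pmatrix}\varepsilon&0\\0&\varepsilon^{-1}\end{pmatrix}\in\mathrm{D}$, i.e. $\eta_1$ maps the slice at level $1$ onto the slice at level $\varepsilon^4$.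
   Context: $\mathcal{H}^2$ is the upper half-plane. Points of $\mathcal{H}^2\times\mathcal{H}^2$ are written $(x_1+y_1i,x_2+y_2i)$ with $x_1,x_2\in\mathbb{R}$, $y_1,y_2\in\mathbb{R}^+=(0,\infty)$. $\mathbb{Z}_K$ is the ring of integers of $K=\mathbb{Q}(\sqrt n)\subset\mathbb{R}$ (with $\sqrt n>0$), $\sigma$ is the non-trivial element of $\mathrm{Gal}(K/\mathbb{Q})$, and $\varepsilon=\min\{z\in\mathbb{Z}_K^\times: z>1\}$ is the fundamental unit. The group $\mathrm{PSL}_2(\mathbb{Z}_K)$ acts on $\mathcal{H}^2\times\mathcal{H}^2$ by $\gamma(p_1,p_2)=(\gamma(p_1),\sigma(\gamma)(p_2))$, with Möbius action in each factor and $\sigma$ applied entrywise. The cusp group $\Delta$ is the stabilizer of $(\infty,\infty)$; it consists of the matrices $\begin{pmatrix}\varepsilon^\ell&z\\0&\varepsilon^{-\ell}\end{pmatrix}$ ($\ell\in\mathbb{Z}$, $z\in\mathbb{Z}_K$) up to sign. Put $\tau_z=\begin{pmatrix}1&z\\0&1\end{pmatrix}$, $\eta_\ell=\begin{pmatrix}\varepsilon^\ell&0\\0&\varepsilon^{-\ell}\end{pmatrix}$, $\mathrm{U}=\{\tau_z: z\in\mathbb{Z}_K\}$ (the maximal unipotent subgroup of $\Delta$), $\mathrm{D}=\{\eta_\ell:\ell\in\mathbb{Z}\}$. They act by $\tau_z(x_1+y_1i,x_2+y_2i)=(x_1+z+y_1i,\,x_2+\sigma(z)+y_2i)$ and $\eta_\ell(p_1,p_2)=(\varepsilon^{2\ell}p_1,\varepsilon^{-2\ell}p_2)$.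 A fundamental domain for a group $G$ acting on a space $X$ is a subspace $R\subset X$ with $\bigcup_{g\in G}g(R)=X$ and such that $g(R)\cap g'(R)$ has empty interior for all distinct $g,g'\in G$. Leaves: $\mathcal{F}(y_1,y_2)=\{(x_1+y_1i,x_2+y_2i): x_1,x_2\in\mathbb{R}\}$. On the leaf $\mathcal{F}(y_1,y_2)$ put $\delta_{y_1,y_2}\big((x_1+y_1i,x_2+y_2i),(x_3+y_1i,x_4+y_2i)\big)=\frac{|x_1-x_3|^2}{y_1^2}+\frac{|x_2-x_4|^2}{y_2^2}$. Let $c=(y_1i,y_2i)$ and let $$\mathrm{T}(y_1,y_2)=\{x\in\mathcal{F}(y_1,y_2): \delta_{y_1,y_2}(c,x)\le\delta_{y_1,y_2}(c,\tau_z(x))\ \text{for all } z\in\mathbb{Z}_K\},$$ the Dirichlet domain for $\mathrm{U}$ on the leaf, centered at $c$. For $z\in\mathbb{Z}_K\setminus\{0\}$ the mediatriz is $m_{y_1,y_2}(\tau_z)=\{x\in\mathcal{F}(y_1,y_2):\delta_{y_1,y_2}(c,x)=\delta_{y_1,y_2}(c,\tau_z(x))\}$. One says that $z$ (or $\tau_z$) contributes a side to $\mathrm{T}(y_1,y_2)$ if $m_{y_1,y_2}(\tau_z)\cap\mathrm{T}(y_1,y_2)$ is a side (an edge of positive length) of this polygon. For $h\in\mathbb{R}^+$ let $\mathcal{T}_n(h)=\bigsqcup_{1\le k<\varepsilon^4}\mathrm{T}(h\sqrt k,\,h/\sqrt k)$, a hypersurface on which $y_1y_2=h^2$ is constant,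 and let $\overline{\mathcal{T}_n(h)}$ be the same union over $1\le k\le\varepsilon^4$. The level of a point is $k=y_1/y_2$, and $\Psi:\mathcal{H}^2\times\mathcal{H}^2\to\mathbb{R}^3$ is $\Psi(x_1+y_1i,x_2+y_2i)=(x_1,x_2,y_1/y_2)$, with third coordinate denoted $k$. The element $z$ contributes a side to $\Psi(\mathcal{T}_n)$ if the part of $\Psi(\mathcal{T}_n)$ lying in the surface $2zx_1+z^2+k^2(2\sigma(z)x_2+\sigma(z)^2)=0$ is a two-dimensional face, i.e. has nonempty interior in that surface. *)

(* Defs.v *)
From mathcomp Require Import all_boot all_order all_algebra.
From mathcomp Require Import all_classical all_reals all_analysis.
From mathcomp Require Import complex.

Set Implicit Arguments.
Unset Strict Implicit.
Unset Printing Implicit Defensive.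

Import Order.TTheory GRing.Theory Num.Theory numFieldNormedType.Exports.
Local Open Scope classical_set_scope.
Local Open Scope ring_scope.

(** * The real quadratic field, as a subset of the reals *)

Definition squarefree (n : nat) : Prop :=
  forall d : nat, (d ^ 2 %| n)%N -> d = 1%N.

Definition quad_field (R : realType) (n : nat) : set R :=
  [set x | exists a b : rat, x = ratr a + ratr b * Num.sqrt n%:R].

Definition quad_int (R : realType) (n : nat) : set R :=
  [set x | quad_field n x /\ integralOver (intr : int -> R) x].

(* [s] restricts to the non-trivial element of Gal(K/Q); its values outside K
   are irrelevant. *)
Definition galois_conj (R : realType) (n : nat) (s : R -> R) : Prop :=
  [/\ set_bij (quad_field n) (quad_field n) s,
      forall x y, quad_field n x -> quad_field n y -> s (x + y) = s x + s y,
      forall x y, quad_field n x -> quad_field n y -> s (x * y) = s x * s y,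
      forall q : rat, s (ratr q) = ratr q
    & exists2 x, quad_field n x & s x <> x].

Definition quad_unit (R : realType) (n : nat) : set R :=
  [set u | [/\ u != 0, quad_int n u & quad_int n u^-1]].

Definition fundamental_unit (R : realType) (n : nat) (e : R) : Prop :=
  [/\ quad_unit n e, 1 < e & forall u, quad_unit n u -> 1 < u -> e <= u].

(** * Spaces *)

(* [R^o] is [R] seen as a vector space over itself, so that the products below
   carry both their topology and their vector space structure. *)
Definition plane (R : realType) := (R^o * R^o)%type.

(* The pair ((x1, y1), (x2, y2)) stands for (x1 + y1 i, x2 + y2 i). *)
Definition bipoint (R : realType) := (plane R * plane R)%type.

Definition space3 (R : realType) := (plane R * R^o)%type.

Definition H2H2 (R : realType) : set (bipoint R) :=
  [set p | 0 < p.1.2 /\ 0 < p.2.2].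

(* Interior of [A] in the subspace topology of [S]. *)
Definition interior_in (X : topologicalType) (S A : set X) : set X :=
  [set x | S x /\ within S (nbhs x) A].

Definition frontier (X : topologicalType) (A : set X) : set X :=
  closure A `\` interior A.

(* Elements of the group are the elements of [G] up to the relation [same]. *)
Definition fundamental_domain (X : topologicalType) (gT : Type)
    (S : set X) (G : set gT) (same : gT -> gT -> Prop) (act : gT -> X -> X)
    (D : set X) : Prop :=
  [/\ D `<=` S,
      \bigcup_(g in G) (act g @` D) = S
    & forall g g', G g -> G g' -> ~ same g g' ->
        interior_in S ((act g @` D) `&` (act g' @` D)) = set0].

(** * The cusp group *)

Definition mx2 (R : realType) (a b c d : R) : 'M[R]_2 :=
  \matrix_(i, j) (if i == ord0 then (if j == ord0 then a else b)
                  else (if j == ord0 then c else d)).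

Definition mobius (R : realType) (g : 'M[R]_2) (p : plane R) : plane R :=
  let z : R[i] := Complex p.1 p.2 in
  let w : R[i] := (real_complex R (g ord0 ord0) * z + real_complex R (g ord0 ord_max))
    / (real_complex R (g ord_max ord0) * z + real_complex R (g ord_max ord_max)) in
  (complex.Re w, complex.Im w).

(* Image of the point at infinity; [None] is infinity. *)
Definition mobius_infty (R : realType) (g : 'M[R]_2) : option R :=
  if g ord_max ord0 == 0 then None else Some (g ord0 ord0 / g ord_max ord0).

Definition act (R : realType) (s : R -> R) (g : 'M[R]_2) (p : bipoint R) : bipoint R :=
  (mobius g p.1, mobius (map_mx s g) p.2).

Definition SL2 (R : realType) (n : nat) : set 'M[R]_2 :=
  [set g : 'M[R]_2 | (forall i j, quad_int n (g i j)) /\ \det g = 1].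

(* Equality in PSL_2. *)
Definition psl_eq (R : realType) (g g' : 'M[R]_2) : Prop := g = g' \/ g = - g'.

Definition cusp_group (R : realType) (n : nat) (s : R -> R) : set 'M[R]_2 :=
  [set g : 'M[R]_2 | [/\ SL2 n g, mobius_infty g = None & mobius_infty (map_mx s g) = None]].

Definition tau (R : realType) (z : R) : 'M[R]_2 := mx2 1 z 0 1.

Definition eta (R : realType) (e : R) (l : int) : 'M[R]_2 :=
  mx2 (e ^ l) 0 0 (e ^ (- l)).

(** * Leaves and Dirichlet domains *)

Definition leaf (R : realType) (y1 y2 : R) : set (bipoint R) :=
  [set p | p.1.2 = y1 /\ p.2.2 = y2].

Definition delta (R : realType) (y1 y2 : R) (p q : bipoint R) : R :=
  `|p.1.1 - q.1.1| ^+ 2 / y1 ^+ 2 + `|p.2.1 - q.2.1| ^+ 2 / y2 ^+ 2.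

Definition center (R : realType) (y1 y2 : R) : bipoint R := ((0, y1), (0, y2)).

Definition dirichlet (R : realType) (n : nat) (s : R -> R) (y1 y2 : R) : set (bipoint R) :=
  [set p | leaf y1 y2 p /\
     forall z, quad_int n z ->
       delta y1 y2 (center y1 y2) p <= delta y1 y2 (center y1 y2) (act s (tau z) p)].

Definition mediatriz (R : realType) (s : R -> R) (y1 y2 z : R) : set (bipoint R) :=
  [set p | leaf y1 y2 p /\
     delta y1 y2 (center y1 y2) p = delta y1 y2 (center y1 y2) (act s (tau z) p)].

Definition segment (R : realType) (V : lmodType R) (p q : V) : set V :=
  [set x | exists2 t : R, 0 <= t <= 1 & x = (1 - t) *: p + t *: q].

Definition contributes_side (R : realType) (n : nat) (s : R -> R) (y1 y2 z : R) : Prop :=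
  [/\ quad_int n z, z <> 0
    & exists p q : bipoint R, p <> q /\
        mediatriz s y1 y2 z `&` dirichlet n s y1 y2 = segment p q].

(** * Cusp sections *)

Definition cusp_section (R : realType) (n : nat) (s : R -> R) (e h : R) : set (bipoint R) :=
  \bigcup_(k in [set k : R | 1 <= k < e ^+ 4])
     dirichlet n s (h * Num.sqrt k) (h / Num.sqrt k).

Definition cusp_section_bar (R : realType) (n : nat) (s : R -> R) (e h : R) : set (bipoint R) :=
  \bigcup_(k in [set k : R | 1 <= k <= e ^+ 4])
     dirichlet n s (h * Num.sqrt k) (h / Num.sqrt k).

Definition cusp_domain (R : realType) (n : nat) (s : R -> R) (e : R) : set (bipoint R) :=
  \bigcup_(h in [set h : R | 0 < h]) cusp_section n s e h.

Definition level (R : realType) (p : bipoint R) : R := p.1.2 / p.2.2.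

Definition Psi (R : realType) (p : bipoint R) : space3 R :=
  ((p.1.1, p.2.1), level p).

Definition level_plane (R : realType) (k : R) : set (space3 R) := [set q | q.2 = k].

Definition surface (R : realType) (s : R -> R) (z : R) : set (space3 R) :=
  [set q | 2 * z * q.1.1 + z ^+ 2
           + q.2 ^+ 2 * (2 * s z * q.1.2 + (s z) ^+ 2) = 0].

Definition is_face (R : realType) (S A : set (space3 R)) : Prop :=
  interior_in S (A `&` S) !=set0.

Definition contributes_face (R : realType) (n : nat) (s : R -> R) (e h z : R) : Prop :=
  [/\ quad_int n z, z <> 0 & is_face (surface s z) (@Psi R @` cusp_section n s e h)].

Definition slice (R : realType) (A : set (space3 R)) (k : R) : set (plane R) :=
  [set x | A (x, k)].

(** * The list L *)

Definition z1' (R : realType) (n : nat) : R :=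
  if (n %% 4 == 1)%N then (1 + Num.sqrt n%:R) / 2 else Num.sqrt n%:R.

(* [pairs n s j] is (z_(j+1), z'_(j+1)). *)
Fixpoint pairs (R : realType) (n : nat) (s : R -> R) (j : nat) : R * R :=
  match j with
  | 0%N => (1, z1' R n)
  | j'.+1 => let: (z, z') := pairs n s j' in
             (z + z', if `|s z| < `|s z'| then z else z')
  end.

(* Indices start at 1. *)
Definition zseq (R : realType) (n : nat) (s : R -> R) (i : nat) : R := (pairs n s i.-1).1.
Definition zseq' (R : realType) (n : nat) (s : R -> R) (i : nat) : R := (pairs n s i.-1).2.

Definition is_terminal (R : realType) (n : nat) (s : R -> R) (e : R) (i : nat) : Prop :=
  [set zseq n s i; zseq' n s i] = [set e ^+ 2 * 1; e ^+ 2 * z1' R n].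

Definition stopping_index (R : realType) (n : nat) (s : R -> R) (e : R) (m : nat) : Prop :=
  [/\ (1 <= m)%N, is_terminal n s e m
    & forall i, (1 <= i < m)%N -> ~ is_terminal n s e i].

Definition listL (R : realType) (n : nat) (s : R -> R) (m : nat) : set R :=
  [set z | (exists2 i, (1 <= i <= m)%N &
              [\/ z = zseq n s i, z = - zseq n s i, z = zseq' n s i | z = - zseq' n s i])
           \/ (n %% 4 = 1)%N /\ (z = s (z1' R n) \/ z = - s (z1' R n))].

Definition pair_level (R : realType) (s : R -> R) (z z' : R) : R :=
  Num.sqrt (- (z * z') / s (z * z')).

(** * Shapes *)

Definition convex_hull (R : realType) (V : lmodType R) (N : nat) (v : 'I_N -> V) : set V :=
  [set x | exists a : 'I_N -> R,
     [/\ forall i, 0 <= a i, \sum_i a i = 1 & x = \sum_i a i *: v i]].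

Definition hexagon (R : realType) (P : set (plane R)) : Prop :=
  exists v : 'I_6 -> plane R,
    P = convex_hull v /\
    forall i : 'I_6, ~ convex_hull (fun j : 'I_5 => v (lift i j)) (v i).

Definition lin_indep (R : realType) (u w : plane R) : Prop :=
  u.1 * w.2 - u.2 * w.1 <> 0 :> R.

Definition parallelogram (R : realType) (P : set (plane R)) : Prop :=
  exists a u w : plane R, lin_indep u w /\
    P = [set x | exists t r : R,
           [/\ 0 <= t <= 1, 0 <= r <= 1 & x = a + t *: u + r *: w]].

Definition leaf_coord (R : realType) (p : bipoint R) : plane R := (p.1.1, p.2.1).

(* On the leaf with y1 = h sqrt k and y2 = h / sqrt k (which has level k), the
   sides of the Dirichlet domain contributed by z, -z, z', -z' exist, make up
   the whole boundary, and this boundary is that of a parallelogram. *)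
Definition parallelogram_bounded_by (R : realType) (n : nat) (s : R -> R)
    (h k z z' : R) : Prop :=
  let y1 := h * Num.sqrt k in
  let y2 := h / Num.sqrt k in
  let W : set R := [set w | [\/ w = z, w = - z, w = z' | w = - z']] in
  [/\ parallelogram (@leaf_coord R @` dirichlet n s y1 y2),
      forall w, W w -> contributes_side n s y1 y2 w
    & frontier (@leaf_coord R @` dirichlet n s y1 y2)
      = \bigcup_(w in W) (@leaf_coord R @` (mediatriz s y1 y2 w `&` dirichlet n s y1 y2))].

Definition lattice (R : realType) (Lam : set (plane R)) : Prop :=
  exists u w : plane R, lin_indep u w /\
    Lam = [set v | exists a b : int, v = a%:~R *: u + b%:~R *: w].

(* [P] with points identified along [E] is the flat torus R^2 / Lam: the
   inclusion of the compact set [P] in R^2 induces a bijection (hence a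
   homeomorphism) from P / E to R^2 / Lam, and only boundary points of [P] are
   identified.  Translations are isometries of the flat metric
   dx1^2 / y1^2 + dx2^2 / y2^2 of every leaf, so no choice of metric is involved. *)
Definition flat_torus (R : realType) (P : set (plane R))
    (E : plane R -> plane R -> Prop) : Prop :=
  exists2 Lam : set (plane R), lattice Lam &
    [/\ compact P,
        forall x, exists2 y, P y & Lam (y - x),
        forall x y, P x -> P y -> (E x y <-> Lam (y - x))
      & forall x y, P x -> P y -> E x y -> x <> y -> frontier P x /\ frontier P y].

Definition U_identified (R : realType) (n : nat) (s : R -> R) (k : R)
    (x y : plane R) : Prop :=
  exists (z : R) (p : bipoint R),
    [/\ quad_int n z, H2H2 p, Psi p = (x, k) & Psi (act s (tau z) p) = (y, k)].

Definition exceptional_index (n m i : nat) : Prop :=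
  (1 <= i < m)%N \/ (n %% 4 <> 1)%N /\ i = m.

(* The side of the cusp section contributed by [z]. *)
Definition side (R : realType) (n : nat) (s : R -> R) (e h z : R) : set (bipoint R) :=
  cusp_section n s e h `&` (@Psi R @^-1` surface s z).

Definition sides_description (R : realType) (n : nat) (s : R -> R) (e : R)
    (m : nat) (h : R) : Prop :=
  let A := @Psi R @` cusp_section n s e h in
  [/\ forall q, A q -> 1 <= q.2 <= e ^+ 4,
      is_face (level_plane 1) (closure A) /\ is_face (level_plane (e ^+ 4)) (closure A),
      forall z, contributes_face n s e h z <-> listL n s m z
    & frontier A = closure A `&`
        (level_plane 1 `|` level_plane (e ^+ 4) `|` \bigcup_(z in listL n s m) surface s z)].

Definition torus_shapes (R : realType) (n : nat) (s : R -> R) (e : R)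
    (m : nat) (h : R) : Prop :=
  let Abar := @Psi R @` cusp_section_bar n s e h in
  let kk i := pair_level s (zseq n s i) (zseq' n s i) in
  [/\ closure (@Psi R @` cusp_section n s e h) = Abar,
      forall k, 1 <= k <= e ^+ 4 -> flat_torus (slice Abar k) (U_identified n s k),
      forall k, 1 <= k <= e ^+ 4 ->
        (hexagon (slice Abar k) <-> forall i, exceptional_index n m i -> k <> kk i),
      forall i, exceptional_index n m i ->
        [/\ 1 <= kk i <= e ^+ 4,
            parallelogram_bounded_by n s h (kk i) (zseq n s i) (zseq' n s i)
          & slice Abar (kk i) =
            @leaf_coord R @` dirichlet n s (h * Num.sqrt (kk i)) (h / Num.sqrt (kk i))]
    & ((n %% 4 <> 1)%N -> kk m = e ^+ 4) /\
      ((n %% 4 = 1)%N ->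
         e ^+ 4 < kk m /\ parallelogram_bounded_by n s h (kk m) (zseq n s m) (zseq' n s m))].

Definition gluing_maps (R : realType) (n : nat) (s : R -> R) (e : R)
    (m : nat) (h : R) : Prop :=
  (forall z, listL n s m z ->
     act s (tau z) @` side n s e h z = side n s e h (- z)) /\
  act s (eta e 1) @` (cusp_section_bar n s e h `&` [set p | level p = 1])
    = cusp_section_bar n s e h `&` [set p | level p = e ^+ 4].

(* Main.v *)
Require Import Defs.
From mathcomp Require Import all_boot all_order all_algebra.
From mathcomp Require Import all_classical all_reals all_analysis.
From mathcomp Require Import algC algnum complex zify ring lra.
Import Order.TTheory GRing.Theory Num.Theory numFieldNormedType.Exports.
Set Implicit Arguments.
Unset Strict Implicit.
Unset Printing Implicit Defensive.
Local Open Scope classical_set_scope.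
Local Open Scope ring_scope.

(** At level [k] the Dirichlet domain is the Voronoi cell of the lattice
    [{(z, s z)}] for the form [x1^2 + k^2 x2^2].  If [a, b] is a basis such that
    [a, b, -(a + b)] pairwise have non-positive inner products (an obtuse
    superbase), the cell is cut out by [±a, ±b, ±(a + b)] alone; it is a hexagon,
    unless [a] and [b] are orthogonal, when it is a parallelogram.  For a basis of
    two positive numbers whose conjugates have opposite signs, this happens exactly
    for [k] between the level where [a, b] are orthogonal and the level where the
    next pair [a + b] and whichever of [a, b] has the smaller conjugate are; these
    levels increase to infinity along the sequence of pairs.  Such a pair is
    determined by any level in its interval, because the relevant vectors are the
    only minimal ones in their classes modulo twice the lattice.  Multiplication
    by [e^2] maps the lattice at level 1 to the lattice at level [e^4], so it sends
    the initial pair to a later pair of the sequence. *)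

(** * The ring of integers *)

(** The shape of a cell varies with the level, so slice-by-slice statements say nothing about
    neighbourhoods in three-space. The bridge is that the finite list [L] cuts out every cell of the
    section at once. Moreover [sform] is affine along rays from the [k]-axis and positive on that
    axis: contracting a point of a cell towards the axis makes all inequalities strict, and
    stretching a boundary point violates one. The orthogonal levels are the delicate ones: there
    [a + b] and [a - b] are active at corners only, and the uniqueness of the pair is argued at a
    slightly higher level. That an element of [L] gives a two-dimensional face is seen at one level
    strictly inside the section, at the midpoint of its bisector, where all the other inequalities
    are strict. The unit is squared because [e] may have norm [-1], while [e^2] has norm 1. Levels
    are compared through their squares, which are rational in a pair and its conjugates; hence the
    bound [e^8]. Translates of the domain by distinct group elements either share no level or differ
    by a translation, and in the latter case their overlap lies on a surface. *)

Lemma rat_integral_int (R : realType) (r : rat) :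
  integralOver (intr : int -> R) (ratr r) -> exists m : int, r = m%:~R.
Proof.
case=> p pmon proot.
have Hr : root (map_poly (intr : int -> rat) p) r.
  rewrite -(fmorph_root (ratr : rat -> R)) -map_poly_comp.
  by rewrite (eq_map_poly (g := intr)) // => x /=; rewrite ratr_int.
(* In [algC] a rational algebraic integer is known to be an integer. *)
have HA : root (map_poly (intr : int -> algC) p) (ratr r).
  move: Hr; rewrite -(fmorph_root (ratr : rat -> algC)) -map_poly_comp.
  by rewrite (eq_map_poly (g := intr)) // => x /=; rewrite ratr_int.
have : (ratr r : algC) \is a Num.int.
  apply: Cint_rat_Aint; first exact: Crat_rat.
  apply: (root_monic_Aint HA); first exact: monic_map.
  by apply/polyOverP => i; rewrite coef_map /= intr_int.
case/intrP => m Hm; exists m.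
by apply: (fmorph_inj (ratr : {rmorphism rat -> algC})); rewrite /= Hm ratr_int.
Qed.

(** The square of the reduced denominator divides [n] times the square of the numerator, hence [n]
    itself by coprimality; squarefreeness makes the denominator 1. *)
Lemma squarefree_int (n : nat) (r : rat) (m : int) :
  squarefree n -> n%:R * r ^+ 2 = m%:~R -> exists k : int, r = k%:~R.
Proof.
move=> sqf Hr.
suff d1 : `|denq r|%N = 1%N.
  exists (numq r); rewrite -[LHS]divq_num_den -[denq r]gez0_abs ?denq_ge0 //.
  by rewrite d1 divr1.
apply: sqf.
have Hz : (n%:Z * numq r ^+ 2 = m * denq r ^+ 2)%R.
  apply: (@intr_inj rat).
  move: Hr; rewrite -[r in r ^+ 2]divq_num_den !(rmorphM, rmorphXn) /= => <-.
  have : (denq r)%:~R != 0 :> rat by rewrite intr_eq0 denq_neq0.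
  by move=> dn0; field.
have : (`|denq r| ^ 2 %| n * `|numq r| ^ 2)%N.
  have -> : (n * `|numq r| ^ 2 = `|(n%:Z * numq r ^+ 2)%R|)%N.
    by rewrite abszM abszX.
  by rewrite Hz abszM abszX dvdn_mull.
rewrite Gauss_dvdl // coprimeXl // coprimeXr // coprime_sym.
exact: coprime_num_den.
Qed.

Lemma sqrt_irrational (R : realType) (n : nat) (q : rat) :
  (2 <= n)%N -> squarefree n -> ratr q <> Num.sqrt n%:R :> R.
Proof.
move=> n2 sqf Hq.
have Hq2 : q ^+ 2 = n%:R.
  apply: (fmorph_inj (ratr : rat -> R)).
  by rewrite rmorphXn /= Hq sqr_sqrtr ?ler0n // ratr_nat.
have [k Hk] : exists k : int, q = k%:~R.
  (* Multiplying [q^2 = n] by [n] gives the required form; the integer [q] then has a square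
     dividing [n]. *)
  apply: (@squarefree_int n q (n%:Z ^+ 2)) => //.
  by rewrite Hq2 rmorphXn /= expr2.
have Hkn : (`|k| ^ 2)%N = n.
  suff : (k ^+ 2 = n%:Z)%R by move=> E; rewrite -abszX E.
  by apply: (@intr_inj rat); rewrite rmorphXn /= -Hk Hq2.
have k1 : `|k|%N = 1%N by apply: sqf; rewrite Hkn.
by move: n2; rewrite -Hkn k1.
Qed.

Lemma quad_field_inj (R : realType) (n : nat) (a b c d : rat) :
  (2 <= n)%N -> squarefree n ->
  ratr a + ratr b * Num.sqrt n%:R = ratr c + ratr d * Num.sqrt n%:R :> R ->
  a = c /\ b = d.
Proof.
move=> n2 sqf E.
have [bd|bd] := eqVneq b d.
  split=> //; apply: (fmorph_inj (ratr : rat -> R)).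
  by move: E; rewrite bd => /addIr.
exfalso; apply: (@sqrt_irrational R n ((c - a) / (b - d)) n2 sqf).
have H : ratr b - ratr d != 0 :> R.
  by rewrite -rmorphB /= fmorph_eq0 subr_eq0.
rewrite fmorph_div /= !rmorphB /=.
apply: (mulIf H); rewrite divfK //.
by move: E; lra.
Qed.

Section Conjugation.
Variables (R : realType) (n : nat) (s : R -> R).
Hypothesis (n2 : (2 <= n)%N) (sqf : squarefree n) (conj : galois_conj n s).
Local Notation rn := (Num.sqrt (n%:R : R)).
Local Notation K := (@quad_field R n).
Local Notation O := (@quad_int R n).
Local Notation w := (@z1' R n).

Lemma sqr_sqrtn : rn ^+ 2 = n%:R.
Proof. by rewrite sqr_sqrtr ?ler0n. Qed.

Lemma sqrt_gt1 : 1 < rn.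
Proof. by rewrite -[X in X < _]sqrtr1 ltr_sqrt ?ltr1n // ltr0n ltnW. Qed.

Lemma quad_field_rat q : K (ratr q).
Proof. by exists q, 0; rewrite rmorph0 mul0r addr0. Qed.

Lemma quad_field_sqrtn : K rn.
Proof. by exists 0, 1; rewrite rmorph0 add0r rmorph1 mul1r. Qed.

Lemma quad_fieldM x y : K x -> K y -> K (x * y).
Proof.
move=> [a [b ->]] [c [d ->]]; exists (a * c + b * d * n%:R), (a * d + b * c).
by rewrite !(rmorphD, rmorphM) /= ratr_nat; have := sqr_sqrtn; move: rn => r <-; ring.
Qed.

(** The image is again a square root of [n], and the sign [+] would make [s] the identity on the
    field. *)
Lemma conj_sqrtn : s rn = - rn.
Proof.
case: conj => _ sD sM sQ [x [a [b ->]] sx].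
have Kr := quad_field_sqrtn; have Kq := quad_field_rat.
have Kb : K (ratr b * rn) by exact: quad_fieldM.
have : s rn ^+ 2 = rn ^+ 2.
  rewrite expr2 -sM; [|exact: quad_field_sqrtn..].
  by rewrite -expr2 sqr_sqrtn; have := sQ n%:R; rewrite ratr_nat.
move/eqP; rewrite eqf_sqr => /orP[/eqP E|/eqP //].
by case: sx; rewrite sD // !sQ sM // sQ E.
Qed.

Lemma conjE (a b : rat) : s (ratr a + ratr b * rn) = ratr a - ratr b * rn.
Proof.
case: (conj) => _ sD sM sQ _.
have Kr := quad_field_sqrtn; have Kq := quad_field_rat.
have Kb : K (ratr b * rn) by exact: quad_fieldM.
by rewrite sD // sQ sM // sQ conj_sqrtn mulrN.
Qed.

Lemma conjD x y : K x -> K y -> s (x + y) = s x + s y.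
Proof. by case: conj => _ + _ _ _; exact. Qed.

Lemma conjM x y : K x -> K y -> s (x * y) = s x * s y.
Proof. by case: conj => _ _ + _ _; exact. Qed.

Lemma conj_int (m : int) : s m%:~R = m%:~R.
Proof. by case: conj => _ _ _ + _ => /(_ m%:~R); rewrite ratr_int. Qed.

Definition z1'_conj : R := if (n %% 4 == 1)%N then (1 - rn) / 2 else - rn.

Lemma z1'_rat : exists a b : rat, [/\ w = ratr a + ratr b * rn, z1'_conj = ratr a - ratr b * rn & b != 0].
Proof.
rewrite /z1' /z1'_conj; case: ifP => _.
  exists (2^-1), (2^-1); rewrite fmorphV /= ratr_nat.
  by split=> //; rewrite [LHS]mulrDl ?mulNr mulrC // ?mul1r ?mulr1 mulrC [_ * rn]mulrC ?mulr1 ?mul1r.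
by exists 0, 1; rewrite rmorph0 rmorph1 ?add0r ?sub0r ?mul1r.
Qed.

Lemma conj_z1' : s w = z1'_conj.
Proof. by have [a [b [-> -> _]]] := z1'_rat; rewrite conjE. Qed.

Lemma quad_field_z1' : K w.
Proof. by have [a [b [-> _ _]]] := z1'_rat; exists a, b. Qed.

(** Trace and norm of [w]: they give its monic integer polynomial and make all norms integers. For
    [n = 4q + 1] the norm is [(1 - n)/4 = -q]. *)
Lemma z1'_quadratic : exists t m : int, w + z1'_conj = t%:~R /\ w * z1'_conj = m%:~R.
Proof.
rewrite /z1' /z1'_conj; case: ifP => [/eqP n1|_].
  exists 1, (- (n %/ 4)%:Z); split; first by field.
  have -> : (1 + rn) / 2 * ((1 - rn) / 2) = (1 - rn ^+ 2) / 4 :> R by field.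
  by rewrite sqr_sqrtn {1}(divn_eq n 4) n1 natrD natrM rmorphN /=; field.
exists 0, (- n%:Z); rewrite subrr mulrN -expr2 sqr_sqrtn.
by rewrite rmorphN.
Qed.

Lemma integral_z1' : integralOver (intr : int -> R) w.
Proof.
have [t [m [Ht Hm]]] := z1'_quadratic.
exists ('X^2 - t *: 'X + m%:P).
  rewrite monicE -addrA lead_coefDl ?lead_coefXn // size_polyXn.
  apply: (leq_ltn_trans (size_polyD _ _)); rewrite size_polyN gtn_max.
  apply/andP; split; last exact: (leq_ltn_trans (size_polyC_leq1 _)).
  by apply: (leq_ltn_trans (size_scale_leq _ _)); rewrite size_polyX.
rewrite /root rmorphD rmorphB /= map_polyZ map_polyXn map_polyX map_polyC /=.
rewrite !hornerE /= -Ht -Hm; apply/eqP; ring.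
Qed.

Lemma quad_int_lin (p q : int) : O (p%:~R + q%:~R * w).
Proof.
split.
  have [a [b [-> _ _]]] := z1'_rat; exists (p%:~R + q%:~R * a), (q%:~R * b).
  rewrite !(rmorphD, rmorphM) /= !ratr_int; ring.
apply: integral_add; first exact: integral_id.
by apply: integral_mul; [exact: integral_id|exact: integral_z1'].
Qed.

Lemma conj_lin (p q : int) : s (p%:~R + q%:~R * w) = p%:~R + q%:~R * z1'_conj.
Proof.
have Ki m : K (m%:~R : R) by rewrite -ratr_int; exact: quad_field_rat.
have Kw := quad_field_z1'.
by rewrite conjD ?conjM ?conj_int ?conj_z1' //; exact: quad_fieldM.
Qed.

Lemma integral_conj (a b : rat) :
  integralOver (intr : int -> R) (ratr a + ratr b * rn) ->
  integralOver (intr : int -> R) (ratr a - ratr b * rn).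
Proof.
set x := _ + _ => -[p pm px]; exists p => //; rewrite -conjE -/x.
have Kx : K x by exists a, b.
(* Membership in the field goes along in the induction because [s] is additive and multiplicative
   only there. *)
suff H (q : {poly int}) : K (map_poly intr q).[x] /\
    s (map_poly intr q).[x] = (map_poly intr q).[s x] :> R.
  by rewrite /root -(H p).2 (eqP px) -[0]/(0%:~R) conj_int.
elim/poly_ind: q => [|q c [IK IH]].
  by rewrite rmorph0 !horner0; split; [rewrite -[0](rmorph0 ratr); exact: quad_field_rat|exact: (conj_int 0)].
rewrite rmorphD rmorphM /= map_polyX map_polyC /= !hornerE.
have Kc : K c%:~R by rewrite -ratr_int; exact: quad_field_rat.
have Kqx : K ((map_poly intr q).[x] * x) by exact: quad_fieldM.
split; last by rewrite conjD // conjM // IH conj_int.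
case: Kqx Kc => [a1 [b1 ->]] [a2 [b2 ->]]; exists (a1 + a2), (b1 + b2).
rewrite !rmorphD /=; ring.
Qed.

Lemma quad_intP z : O z <-> exists p q : int, z = p%:~R + q%:~R * w.
Proof.
split; last by move=> [p [q ->]]; exact: quad_int_lin.
move=> [[a [b ->]] I1]; have I2 := integral_conj I1.
have [A HA] : exists A : int, 2 * a = A%:~R.
  apply: (@rat_integral_int R).
  have -> : ratr (2 * a) = (ratr a + ratr b * rn) + (ratr a - ratr b * rn).
    by rewrite rmorphM /= ratr_nat; ring.
  exact: integral_add.
have [N HN] : exists N : int, a ^+ 2 - n%:R * b ^+ 2 = N%:~R.
  apply: (@rat_integral_int R).
  have -> : ratr (a ^+ 2 - n%:R * b ^+ 2) = (ratr a + ratr b * rn) * (ratr a - ratr b * rn).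
    rewrite rmorphB rmorphXn rmorphM rmorphXn /= ratr_nat; have := sqr_sqrtn; move: rn => r <-.
    by ring.
  exact: integral_mul.
(* [n (2b)^2 = A^2 - 4N] is an integer, so squarefreeness clears the denominator of [2b]. *)
have [B HB] : exists B : int, 2 * b = B%:~R.
  apply: (@squarefree_int n _ (A ^+ 2 - 4 * N) sqf).
  rewrite rmorphB rmorphXn rmorphM /= -HA -HN; ring.
have E : (A ^+ 2 - n%:Z * B ^+ 2 = 4 * N)%R.
  apply: (@intr_inj rat); rewrite rmorphB rmorphXn [in RHS]rmorphM rmorphM rmorphXn /=.
  by rewrite -HA -HN -HB; ring.
have aE : a = A%:~R / 2 by rewrite -HA; field.
have bE : b = B%:~R / 2 by rewrite -HB; field.
have n4 : (n %% 4 != 0)%N.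
  apply/negP => n4; have := @sqf 2; rewrite -[(2 ^ 2)%N]/4%N /dvdn n4.
  by move=> /(_ isT).
have En : n = (n %/ 4 * 4 + n %% 4)%N by rewrite -divn_eq.
set q := (n %/ 4)%N in En; have := ltn_pmod n (isT : (0 < 4)%N).
(* Parities: modulo 4 the norm equation becomes [d^2 = r d'^2] with bits [d], [d']. For [r = 1] it
   forces [d = d'], for [r = 2] or [3] it forces [d = d' = 0]. *)
have Hp (X : int) : exists c d : int, (X = 2 * c + d /\ (d = 0 \/ d = 1))%R.
  exists (X %/ 2)%Z, (X %% 2)%Z; split; first by rewrite mulrC -divz_eq.
  by lia.
have [c [d [Ac dd]]] := Hp A; have [c' [d' [Bc dd']]] := Hp B.
set r := (n %% 4)%N in n4 En *.
have {}E : exists X Y Z : int, 4 * X + d ^+ 2 - 4 * Y - r%:Z * (4 * Z + d' ^+ 2) = 4 * N.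
  exists (c ^+ 2 + c * d), (q%:Z * (4 * (c' ^+ 2 + c' * d') + d' ^+ 2)), (c' ^+ 2 + c' * d').
  by rewrite -E Ac Bc [in RHS]En PoszD PoszM; ring.
case: E => X [Y [Z E]].
rewrite /z1' -/r; case: ifP => [/eqP r1|/eqP r1] r4.
  have [C HC] : exists C : int, A = B + 2 * C.
    exists (c - c'); rewrite Ac Bc.
    by rewrite r1 in E; case: dd => Hd; case: dd' => Hd'; rewrite Hd Hd' in E *; lia.
  exists C, B; rewrite aE bE HC !(fmorph_div, ratr_int, ratr_nat) rmorphD rmorphM /=.
  by field.
have [d0 d'0] : d = 0 /\ d' = 0.
  have [r2|r3] : r = 2%N \/ r = 3%N by lia.
    by rewrite r2 in E; case: dd => Hd; case: dd' => Hd'; rewrite Hd Hd' in E *; lia.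
  by rewrite r3 in E; case: dd => Hd; case: dd' => Hd'; rewrite Hd Hd' in E *; lia.
exists c, c'; rewrite aE bE Ac Bc d0 d'0 !(fmorph_div, ratr_int, ratr_nat) !rmorphD !rmorphM /=.
by field.
Qed.

End Conjugation.

(** * Arithmetic, conjugation and norms in the ring of integers *)

Section QuadInt.
Variables (R : realType) (n : nat) (s : R -> R).
Hypothesis st : [/\ (2 <= n)%N, squarefree n & galois_conj n s].
Local Notation rn := (Num.sqrt (n%:R : R)).
Local Notation O := (@quad_int R n).
Local Notation w := (@z1' R n).
Local Notation w' := (@z1'_conj R n).

Lemma quad_int_coords z : O z -> exists p q : int,
  z = p%:~R + q%:~R * w /\ s z = p%:~R + q%:~R * w'.
Proof.
case: st => n2 sqf cj /(quad_intP n2 sqf cj _) [p [q ->]].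
by exists p, q; rewrite (conj_lin cj).
Qed.

Lemma quad_int_intr (m : int) : O m%:~R.
Proof. by have := quad_int_lin R n m 0; rewrite mul0r addr0. Qed.

Lemma quad_int0 : O 0. Proof. exact: (quad_int_intr 0). Qed.
Lemma quad_int1 : O 1. Proof. exact: (quad_int_intr 1). Qed.

Lemma quad_int_z1' : O w.
Proof. by have := quad_int_lin R n 0 1; rewrite mul1r add0r. Qed.

Lemma quad_intN z : O z -> O (- z).
Proof.
move=> /quad_int_coords [p [q [-> _]]]; have := quad_int_lin R n (- p) (- q).
by rewrite !rmorphN mulNr -opprD.
Qed.

Lemma quad_intD z z' : O z -> O z' -> O (z + z').
Proof.
move=> /quad_int_coords [p [q [-> _]]] /quad_int_coords [p' [q' [-> _]]].
have := quad_int_lin R n (p + p') (q + q').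
by rewrite !rmorphD /= mulrDl addrACA.
Qed.

Lemma quad_intB z z' : O z -> O z' -> O (z - z').
Proof. by move=> Oz /quad_intN; exact: quad_intD. Qed.

Lemma quad_intM z z' : O z -> O z' -> O (z * z').
Proof.
move=> [Kz Iz] [Kz' Iz']; split; first exact: quad_fieldM.
exact: integral_mul.
Qed.

Lemma conj_intr (m : int) : s m%:~R = m%:~R.
Proof. by case: st => _ _ cj; rewrite (conj_int cj). Qed.

Lemma conj0 : s 0 = 0. Proof. exact: (conj_intr 0). Qed.
Lemma conj1 : s 1 = 1. Proof. exact: (conj_intr 1). Qed.

Lemma conj_z1'E : s w = w'.
Proof. by case: st => n2 _ cj; exact: conj_z1'. Qed.

Lemma conj_add z z' : O z -> O z' -> s (z + z') = s z + s z'.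
Proof. by case: st => _ _ cj [Kz _] [Kz' _]; rewrite (conjD cj). Qed.

Lemma conj_mul z z' : O z -> O z' -> s (z * z') = s z * s z'.
Proof. by case: st => _ _ cj [Kz _] [Kz' _]; rewrite (conjM cj). Qed.

Lemma conj_opp z : O z -> s (- z) = - s z.
Proof.
move=> Oz; apply/eqP; rewrite -addr_eq0 addrC -conj_add ?addrN ?conj0 //; exact: quad_intN.
Qed.

Lemma conj_sub z z' : O z -> O z' -> s (z - z') = s z - s z'.
Proof. by move=> Oz Oz'; rewrite conj_add ?conj_opp //; exact: quad_intN. Qed.

Lemma s_lin (p q : int) a b : O a -> O b ->
  O (p%:~R * a + q%:~R * b) /\
  s (p%:~R * a + q%:~R * b) = p%:~R * s a + q%:~R * s b.
Proof.
move=> Oa Ob; have [Op Oq] := (quad_int_intr p, quad_int_intr q).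
have [Oa' Ob'] := (quad_intM Op Oa, quad_intM Oq Ob).
by split; [exact: quad_intD|rewrite conj_add // !conj_mul // !conj_intr].
Qed.

Lemma norm_int z : O z -> exists N : int, z * s z = N%:~R.
Proof.
case: st => n2 _ _ /quad_int_coords [p [q [-> ->]]]; have [t [m [Ht Hm]]] := z1'_quadratic R n.
exists (p ^+ 2 + p * q * t + q ^+ 2 * m).
rewrite !(rmorphD, rmorphM) /= -Ht -Hm; ring.
Qed.

Lemma z1'_sub : w - w' != 0.
Proof.
case: st => n2 _ _; have := sqrt_gt1 R n2.
by rewrite /z1' /z1'_conj; case: ifP => _ r1; apply/eqP; lra.
Qed.

Lemma conj_eq0 z : O z -> s z = 0 -> z = 0.
Proof.
case: st => n2 sqf cj [[a [b ->]] _]; rewrite (conjE cj) => E.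
have [| -> b0] := @quad_field_inj R n a (- b) 0 0 n2 sqf.
  by rewrite rmorphN rmorph0 mul0r addr0 mulNr.
have -> : b = 0 by rewrite -[b]opprK b0 oppr0.
by rewrite rmorph0 mul0r addr0.
Qed.

(** The norms of [u] and of its inverse are integers with product 1. The square absorbs the sign,
    since a unit may have norm [-1]. *)
Lemma unit_norm u : O u -> O u^-1 -> u != 0 -> (u * s u) ^+ 2 = 1.
Proof.
move=> Ou Ov u0; have [N HN] := norm_int Ou; have [M HM] := norm_int Ov.
have : u * s u * (u^-1 * s u^-1) = 1.
  by rewrite mulrACA -conj_mul // mulfV // conj1 mulr1.
rewrite HN HM -intrM -[1]/(1%:~R) => /intr_inj E.
rewrite -rmorphXn; congr (_%:~R).
have : N \is a GRing.unit by apply/unitrPr; exists M.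
by rewrite qualifE /= => /orP[/eqP ->|/eqP ->].
Qed.

End QuadInt.

(** * Voronoi cells at a fixed level *)

Section VoronoiNumeric.
Variable R : realType.

(** One sector, spanned by vectors of squared lengths [U], [V] and inner product [g]: the excess [F]
    of their combination with coefficients [m], [k] is a sum of five non-negative terms. The terms
    with [m (m - 1)] and [k (k - 1)] force [m] and [k] into [{0, 1}] when [F] vanishes. *)
Lemma sextant_eq0 (U V g al be F : R) (m k : nat) :
  0 < U -> 0 < V -> 0 <= g -> - U <= al -> - V <= be ->
  F = m%:R ^+ 2 * U + k%:R ^+ 2 * V + 2 * (m%:R * k%:R) * g + m%:R * al + k%:R * be ->
  0 <= F /\
  (F = 0 -> [\/ m = 0%N /\ k = 0%N, m = 1%N /\ k = 0%N, m = 0%N /\ k = 1%N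
             | [/\ m = 1%N, k = 1%N, g = 0, al = - U & be = - V]]).
Proof.
move=> U0 V0 g0 hal hbe FE'.
have sq (j : nat) : 0 <= j%:R * (j%:R - 1) :> R.
  by case: j => [|j]; rewrite ?mul0r // mulr_ge0 // -natr1 addrK.
have h1 : 0 <= m%:R * (m%:R - 1) * U by rewrite mulr_ge0 ?sq // ltW.
have h2 : 0 <= k%:R * (k%:R - 1) * V by rewrite mulr_ge0 ?sq // ltW.
have h3 : 0 <= m%:R * k%:R * g by rewrite !mulr_ge0.
have h4 : 0 <= m%:R * (U + al) by rewrite mulr_ge0 //; lra.
have h5 : 0 <= k%:R * (V + be) by rewrite mulr_ge0 //; lra.
have FE : F = m%:R * (m%:R - 1) * U + k%:R * (k%:R - 1) * V + 2 * (m%:R * k%:R * g)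
     + m%:R * (U + al) + k%:R * (V + be) by rewrite FE'; ring.
split; first by rewrite FE; lra.
move=> F0; rewrite F0 in FE.
have small (j : nat) (W : R) : 0 < W -> j%:R * (j%:R - 1) * W = 0 -> j = 0%N \/ j = 1%N.
  move=> W0 /eqP; rewrite !mulf_eq0 (gt_eqF W0) orbF subr_eq0 pnatr_eq0 -[1]/(1%:R).
  by rewrite eqr_nat => /orP[] /eqP; [left|right].
have e1 : m%:R * (m%:R - 1) * U = 0 by lra.
have e2 : k%:R * (k%:R - 1) * V = 0 by lra.
have [m0|m1] := small _ _ U0 e1; have [k0|k1] := small _ _ V0 e2.
- by constructor 1.
- by constructor 3.
- by constructor 2.
by constructor 4; rewrite m1 k1 in FE h3 h4 h5; split=> //; lra.
Qed.

(* [A], [B], [g] are the inner products of [a] and [b], and [al], [be] twice their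
   inner products with the point.  Every integer vector is a non-negative combination
   of two neighbours among [±a, ±b, ±(a + b)], and neighbours have a non-negative
   inner product. *)
Lemma voronoi_int (A B g al be F : R) (p q : int) :
  g <= 0 -> 0 < A + g -> 0 < B + g -> - A <= al <= A -> - B <= be <= B ->
  - (A + B + 2 * g) <= al + be <= A + B + 2 * g ->
  F = p%:~R ^+ 2 * A + q%:~R ^+ 2 * B + 2 * (p%:~R * q%:~R) * g + p%:~R * al + q%:~R * be ->
  0 <= F /\
  (F = 0 -> p = 0 /\ q = 0 \/ exists2 e : int, e ^+ 2 = 1 &
    [\/ p = e /\ q = 0, p = 0 /\ q = e, p = e /\ q = e
     | [/\ p = e /\ q = - e, g = 0, al = - (e%:~R * A) & be = e%:~R * B]]).
Proof.
move=> g0 Ag Bg hal hbe hga.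
have A0 : 0 < A by lra.
have B0 : 0 < B by lra.
have C0 : 0 < A + B + 2 * g by lra.
have natE (r : int) : 0 <= r -> r = `|r|%N%:Z by move=> ?; rewrite gez0_abs.
have natER (r : int) : 0 <= r -> r%:~R = `|r|%N%:R :> R.
  by move=> r0; rewrite {1}(natE r r0).
move=> FE.
have [p0|p0] := leP 0 p; have [q0|q0] := leP 0 q.
- have [pq|pq] := leP q p.
    have [h1 h2] : (0 <= q /\ 0 <= p - q)%R by rewrite ?subr_ge0 ?oppr_ge0; split=> //; exact: ltW.
    (* [p a + q b = q (a + b) + (p - q) a], and [A + g] is the inner product of [a + b] and [a]. *)
    have := @sextant_eq0 (A + B + 2 * g) A (A + g) (al + be) al F `|q| `|p - q|.
    rewrite -(natER _ h1) -(natER _ h2) rmorphB /= => /(_ ltac:(lra) ltac:(lra) ltac:(lra) ltac:(lra) ltac:(lra) ltac:(rewrite FE; ring)).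
    case=> ? H; split=> // /H {H} [].
    + by move=> h; left; clear -p0 q0 pq h; lia.
    + by move=> h; right; exists 1 => //; constructor 3; clear -p0 q0 pq h; lia.
    + by move=> h; right; exists 1 => //; constructor 1; clear -p0 q0 pq h; lia.
    (* The corner case needs a right angle inside the sector; only the two sectors whose inner
       product is [-g] allow it. *)
    + by case=> _ _ ? _ _; exfalso; lra.
  have [h1 h2] : (0 <= p /\ 0 <= q - p)%R by rewrite ?subr_ge0 ?oppr_ge0; split=> //; exact: ltW.
  have := @sextant_eq0 (A + B + 2 * g) B (B + g) (al + be) be F `|p| `|q - p|.
  rewrite -(natER _ h1) -(natER _ h2) rmorphB /= => /(_ ltac:(lra) ltac:(lra) ltac:(lra) ltac:(lra) ltac:(lra) ltac:(rewrite FE; ring)).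
  case=> ? H; split=> // /H {H} [].
  + by move=> h; left; clear -p0 q0 pq h; lia.
  + by move=> h; exfalso; clear -p0 q0 pq h; lia.
  + by move=> h; right; exists 1 => //; constructor 2; clear -p0 q0 pq h; lia.
  + by case=> _ _ ? _ _; exfalso; lra.
- have [h1 h2] : (0 <= p /\ 0 <= - q)%R by rewrite ?subr_ge0 ?oppr_ge0; split=> //; exact: ltW.
  have := @sextant_eq0 A B (- g) al (- be) F `|p| `|- q|.
  rewrite -(natER _ h1) -(natER _ h2) rmorphN /= => /(_ ltac:(lra) ltac:(lra) ltac:(lra) ltac:(lra) ltac:(lra) ltac:(rewrite FE; ring)).
  case=> ? H; split=> // /H {H} [].
  + by move=> h; left; clear -p0 q0 h; lia.
  + by move=> h; exfalso; clear -p0 q0 h; lia.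
  + by move=> h; right; exists (-1) => //; constructor 2; clear -p0 q0 h; lia.
  + case=> h h' ? ? ?; right; exists 1 => //; constructor 4; rewrite mulr1z.
    by split; [clear -p0 q0 h h'; lia|lra|lra|lra].
- have [h1 h2] : (0 <= - p /\ 0 <= q)%R by rewrite ?subr_ge0 ?oppr_ge0; split=> //; exact: ltW.
  have := @sextant_eq0 A B (- g) (- al) be F `|- p| `|q|.
  rewrite -(natER _ h1) -(natER _ h2) rmorphN /= => /(_ ltac:(lra) ltac:(lra) ltac:(lra) ltac:(lra) ltac:(lra) ltac:(rewrite FE; ring)).
  case=> ? H; split=> // /H {H} [].
  + by move=> h; left; clear -p0 q0 h; lia.
  + by move=> h; right; exists (-1) => //; constructor 1; clear -p0 q0 h; lia.
  + by move=> h; exfalso; clear -p0 q0 h; lia.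
  + case=> h h' ? ? ?; right; exists (-1) => //; constructor 4; rewrite mulrN1z.
    by split; [clear -p0 q0 h h'; lia|lra|lra|lra].
- have [pq|pq] := leP q p.
    have [h1 h2] : (0 <= - p /\ 0 <= p - q)%R by rewrite ?subr_ge0 ?oppr_ge0; split=> //; exact: ltW.
    have := @sextant_eq0 (A + B + 2 * g) B (B + g) (- (al + be)) (- be) F `|- p| `|p - q|.
    rewrite -(natER _ h1) -(natER _ h2) rmorphB rmorphN /=.
    move=> /(_ ltac:(lra) ltac:(lra) ltac:(lra) ltac:(lra) ltac:(lra) ltac:(rewrite FE; ring)).
    case=> ? H; split=> // /H {H} [].
    + by move=> h; exfalso; clear -p0 q0 pq h; lia.
    + by move=> h; right; exists (-1) => //; constructor 3; clear -p0 q0 pq h; lia.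
    + by move=> h; exfalso; clear -p0 q0 pq h; lia.
    + by case=> _ _ ? _ _; exfalso; lra.
  have [h1 h2] : (0 <= - q /\ 0 <= q - p)%R by rewrite ?subr_ge0 ?oppr_ge0; split=> //; exact: ltW.
  have := @sextant_eq0 (A + B + 2 * g) A (A + g) (- (al + be)) (- al) F `|- q| `|q - p|.
  rewrite -(natER _ h1) -(natER _ h2) rmorphB rmorphN /=.
  move=> /(_ ltac:(lra) ltac:(lra) ltac:(lra) ltac:(lra) ltac:(lra) ltac:(rewrite FE; ring)).
  case=> ? H; split=> // /H {H} [].
  + by move=> h; exfalso; clear -p0 q0 pq h; lia.
  + by move=> h; exfalso; clear -p0 q0 pq h; lia.
  + by move=> h; exfalso; clear -p0 q0 pq h; lia.
  + by case=> _ _ ? _ _; exfalso; lra.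
Qed.

End VoronoiNumeric.

Section Forms.
Variables (R : realType) (n : nat) (s : R -> R).

(* [y1^2] times the excess of the right-hand side in the Dirichlet inequality of
   [tau z] at level [k = y1 / y2]; [surface s z] is its zero set. *)
Definition sform (z : R) (q : space3 R) : R :=
  2 * z * q.1.1 + z ^+ 2 + q.2 ^+ 2 * (2 * s z * q.1.2 + (s z) ^+ 2).

(** The Dirichlet domain in the coordinates [(x1, x2)] of a leaf; it depends on the leaf only
    through its level. *)
Definition vor (k : R) : set (plane R) :=
  [set x | forall z, quad_int n z -> 0 <= sform z (x, k)].

Definition bil (k a b : R) : R := a * b + k ^+ 2 * (s a * s b).

Definition lform (k a : R) (x : plane R) : R := 2 * (a * x.1 + k ^+ 2 * (s a * x.2)).

(** The determinant condition is independence of [(a, s a)] and [(b, s b)] in the plane. The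
    expansion of [s z] is recorded as well, so that uses need not distribute [s]. *)
Definition Zbasis (a b : R) : Prop :=
  [/\ quad_int n a, quad_int n b, a * s b - b * s a != 0
    & forall z, quad_int n z -> exists p q : int,
        z = p%:~R * a + q%:~R * b /\ s z = p%:~R * s a + q%:~R * s b].

(* [a, b, -(a + b)] is an obtuse superbase at level [k]; only [a] and [b] are
   allowed to be orthogonal, so that the intervals of levels are half-open. *)
Definition reduced (k a b : R) : Prop :=
  [/\ Zbasis a b, bil k a b <= 0, 0 < bil k a a + bil k a b
    & 0 < bil k b b + bil k a b].

End Forms.

Section Geometry.
Variables (R : realType) (n : nat) (s : R -> R).
Hypothesis st : [/\ (2 <= n)%N, squarefree n & galois_conj n s].
Local Notation O := (@quad_int R n).

Lemma sformE k z x : sform s z (x, k) = lform s k z x + bil s k z z.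
Proof. by rewrite /sform /lform /bil /=; ring. Qed.

Lemma bilC k a b : bil s k a b = bil s k b a.
Proof. by rewrite /bil; ring. Qed.

Lemma bil_gt0 k z : z != 0 -> 0 < bil s k z z.
Proof.
move=> z0; rewrite /bil -!expr2 ltr_pwDl ?exprn_even_gt0 //.
by rewrite mulr_ge0 ?sqr_ge0.
Qed.

Lemma sform_comb k x a b z (p q : R) :
  z = p * a + q * b -> s z = p * s a + q * s b ->
  sform s z (x, k) = p ^+ 2 * bil s k a a + q ^+ 2 * bil s k b b + 2 * (p * q) * bil s k a b
    + p * lform s k a x + q * lform s k b x.
Proof. by move=> E1 E2; rewrite sformE /lform /bil E2 E1; ring. Qed.

Lemma bil_comb k w a b z (p q : R) :
  z = p * a + q * b -> s z = p * s a + q * s b ->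
  bil s k z z - bil s k z w = p ^+ 2 * bil s k a a + q ^+ 2 * bil s k b b + 2 * (p * q) * bil s k a b
    + p * (- bil s k a w) + q * (- bil s k b w).
Proof. by move=> E1 E2; rewrite /bil E2 E1; ring. Qed.

Lemma linN k z x : O z -> lform s k (- z) x = - lform s k z x.
Proof. by move=> Oz; rewrite /lform (conj_opp st Oz); ring. Qed.

Lemma linD k z z' x : O z -> O z' -> lform s k (z + z') x = lform s k z x + lform s k z' x.
Proof. by move=> Oz Oz'; rewrite /lform (conj_add st Oz Oz'); ring. Qed.

Lemma bilDD k a b : O a -> O b ->
  bil s k (a + b) (a + b) = bil s k a a + bil s k b b + 2 * bil s k a b.
Proof. by move=> Oa Ob; rewrite /bil (conj_add st Oa Ob); ring. Qed.

Lemma bilNN k a : O a -> bil s k (- a) (- a) = bil s k a a.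
Proof. by move=> Oa; rewrite /bil (conj_opp st Oa); ring. Qed.

Lemma sform_opp k z x : O z -> sform s (- z) (x, k) = - lform s k z x + bil s k z z.
Proof. by move=> Oz; rewrite sformE linN // bilNN. Qed.

Lemma strip k z x : O z -> 0 <= sform s z (x, k) -> 0 <= sform s (- z) (x, k) ->
  - bil s k z z <= lform s k z x <= bil s k z z.
Proof. by move=> Oz; rewrite sform_opp // sformE => h1 h2; lra. Qed.

Lemma vor_ineqs k a b x : O a -> O b -> vor n s k x ->
  [/\ - bil s k a a <= lform s k a x <= bil s k a a,
      - bil s k b b <= lform s k b x <= bil s k b b &
      - (bil s k a a + bil s k b b + 2 * bil s k a b) <= lform s k a x + lform s k b x
        <= bil s k a a + bil s k b b + 2 * bil s k a b].
Proof.
move=> Oa Ob V; have Oab := quad_intD st Oa Ob.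
have H z : O z -> - bil s k z z <= lform s k z x <= bil s k z z.
  by move=> Oz; apply: strip => //; apply: V; [|apply: (quad_intN st)].
by split; [exact: H|exact: H|rewrite -bilDD // -linD //; exact: H].
Qed.

Lemma vor_reduced k a b x : reduced n s k a b ->
  - bil s k a a <= lform s k a x <= bil s k a a ->
  - bil s k b b <= lform s k b x <= bil s k b b ->
  - (bil s k a a + bil s k b b + 2 * bil s k a b) <= lform s k a x + lform s k b x
        <= bil s k a a + bil s k b b + 2 * bil s k a b -> vor n s k x.
Proof.
move=> [[Oa Ob _ H] g0 Ag Bg] h1 h2 h3 z /H [p [q [E1 E2]]].
by have [] := voronoi_int g0 Ag Bg h1 h2 h3 (sform_comb k x E1 E2).
Qed.

(** Up to sign only the superbase can be active, apart from the diagonal [a - b], which touches the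
    cell of an orthogonal pair in a single corner. The values of the two linear forms are kept
    because they pin that corner. *)
Lemma vor_eq0 k a b x z : reduced n s k a b -> vor n s k x -> O z -> sform s z (x, k) = 0 ->
  z = 0 \/ exists2 e : R, e = 1 \/ e = - 1 &
    [\/ z = e * a, z = e * b, z = e * (a + b)
     | [/\ z = e * (a - b), bil s k a b = 0, lform s k a x = - (e * bil s k a a)
         & lform s k b x = e * bil s k b b]].
Proof.
move=> [[Oa Ob _ H] g0 Ag Bg] V Oz F0.
have [h1 h2 h3] := vor_ineqs Oa Ob V.
have [p [q [E1 E2]]] := H _ Oz.
have [_] := voronoi_int g0 Ag Bg h1 h2 h3 (sform_comb k x E1 E2).
move=> /(_ F0) [[p0 q0]|[e e1 D]]; first by left; rewrite E1 p0 q0 !mul0r addr0.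
right; exists e%:~R; first by move/eqP: e1; rewrite sqrf_eq1 => /orP[] /eqP ->; [left|right].
case: D => [[pe qe]|[pe qe]|[pe qe]|[[pe qe] g1 la lb]]; rewrite E1 pe qe.
- by constructor 1; rewrite mul0r addr0.
- by constructor 2; rewrite mul0r add0r.
- by constructor 3; rewrite mulrDr.
- by constructor 4; split=> //; rewrite mulrBr rmorphN mulNr.
Qed.

Lemma lin_inj k a b x y : k != 0 -> a * s b - b * s a != 0 ->
  lform s k a x = lform s k a y -> lform s k b x = lform s k b y -> x = y.
Proof.
move=> k0 d0 Ea Eb.
have E1 : (a * s b - b * s a) * (x.1 - y.1) = 0.
  have -> : (a * s b - b * s a) * (x.1 - y.1) =
     (s b * (lform s k a x - lform s k a y) - s a * (lform s k b x - lform s k b y)) / 2.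
    by rewrite /lform; field.
  by rewrite Ea Eb !subrr !mulr0 subrr mul0r.
have E2 : (a * s b - b * s a) * (k ^+ 2 * (x.2 - y.2)) = 0.
  have -> : (a * s b - b * s a) * (k ^+ 2 * (x.2 - y.2)) =
     (a * (lform s k b x - lform s k b y) - b * (lform s k a x - lform s k a y)) / 2.
    by rewrite /lform; field.
  by rewrite Ea Eb !subrr !mulr0 subrr mul0r.
case: x y {Ea Eb} E1 E2 => [x1 x2] [y1 y2] /= /eqP.
rewrite mulf_eq0 (negbTE d0) subr_eq0 => /eqP -> /eqP.
by rewrite !mulf_eq0 (negbTE d0) (negbTE k0) subr_eq0 => /eqP ->.
Qed.

(** Activity at two distinct points excludes corner contacts: for orthogonal [a] and [b], both
    [a + b] and [a - b] are active at one corner only, up to sign, and a corner is determined by its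
    two linear forms. *)
Lemma vor_two_points k a b x y z : k != 0 -> reduced n s k a b -> vor n s k x -> vor n s k y ->
  x <> y -> O z -> z != 0 -> sform s z (x, k) = 0 -> sform s z (y, k) = 0 ->
  exists2 e : R, e = 1 \/ e = - 1 &
    [\/ z = e * a, z = e * b | z = e * (a + b) /\ bil s k a b < 0].
Proof.
move=> k0 red Vx Vy xy Oz z0 Fx Fy.
have [[Oa Ob d0 H] g0 Ag Bg] := red.
have [/eqP|[e e1 Dx]] := vor_eq0 red Vx Oz Fx; first by rewrite (negbTE z0).
have eqxy la lb : lform s k a x = la -> lform s k a y = la -> lform s k b x = lb -> lform s k b y = lb -> False.
  by move=> ? ? ? ?; apply: xy; apply: (lin_inj k0 d0); congruence.
have ab0 : a + b != 0.
  apply: contraNneq d0 => ab0; have -> : b = - a by rewrite -[b](addKr a) ab0 addr0.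
  by rewrite (conj_opp st Oa); apply/eqP; ring.
have ab0' : a - b != 0.
  apply: contraNneq d0 => /eqP; rewrite subr_eq0 => /eqP ->; by rewrite subrr.
exists e => //; case: Dx => [-> | -> | zE | [zE g1 lax lbx]].
- by constructor 1.
- by constructor 2.
- constructor 3; split=> //.
  rewrite lt_neqAle g0 andbT; apply/eqP => g1.
  have [hx1 hx2 _] := vor_ineqs Oa Ob Vx.
  have [hy1 hy2 _] := vor_ineqs Oa Ob Vy.
  have Oab := quad_intD st Oa Ob.
  case: e1 zE Fx Fy => -> ->; rewrite ?mul1r ?mulN1r => Fx Fy.
    rewrite sformE linD // bilDD // g1 in Fx.
    rewrite sformE linD // bilDD // g1 in Fy.
    by apply: (@eqxy (- bil s k a a) (- bil s k b b)); lra.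
  rewrite sform_opp // linD // bilDD // g1 in Fx.
  rewrite sform_opp // linD // bilDD // g1 in Fy.
  by apply: (@eqxy (bil s k a a) (bil s k b b)); lra.
- exfalso; have [/eqP|[e' e1' Dy]] := vor_eq0 red Vy Oz Fy; first by rewrite (negbTE z0).
  (* Coordinates in the basis are unique, so [z = e (a - b)] excludes the first three forms at [y];
     in the fourth, equal signs give the same corner. *)
  have z_comb (p q : R) : z = p * a + q * b -> s z = p * s a + q * s b -> p = e /\ q = - e.
    move=> zE1 szE1.
    have szE : s z = e * (s a - s b).
      by rewrite zE; case: e1 => ->; rewrite ?mul1r ?mulN1r ?(conj_opp st) ?(conj_sub st) //; exact: (quad_intB st).
    have E1 : (p - e) * (a * s b - b * s a) = (p * a + q * b - e * (a - b)) * s b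
       - (p * s a + q * s b - e * (s a - s b)) * b by ring.
    have E2 : (q + e) * (a * s b - b * s a) = (p * s a + q * s b - e * (s a - s b)) * a -
       (p * a + q * b - e * (a - b)) * s a by ring.
    move: E1 E2; rewrite -zE1 -szE1 -zE -szE !subrr !mul0r subrr.
    move=> /eqP + /eqP; rewrite !mulf_eq0 (negbTE d0) !orbF subr_eq0 addr_eq0.
    by move=> /eqP -> /eqP ->.
  have e0 : e != 0 by case: e1 => ->; rewrite ?oppr_eq0 oner_eq0.
  have e0' : e' != 0 by case: e1' => ->; rewrite ?oppr_eq0 oner_eq0.
  have sgn (u : R) : O u -> s (e' * u) = e' * s u.
    by move=> Ou; case: e1' => ->; rewrite ?mul1r ?mulN1r // (conj_opp st).
  case: Dy => [zE'|zE'|zE'|[zE' _ lay lby]].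
  + have [||_ q0] := z_comb e' 0; rewrite ?mul0r ?addr0 // ?zE' ?sgn //.
    by move/eqP: q0; rewrite eq_sym oppr_eq0 (negbTE e0).
  + have [||p0 _] := z_comb 0 e'; rewrite ?mul0r ?add0r // ?zE' ?sgn //.
    by move/eqP: p0; rewrite eq_sym (negbTE e0).
  + have [||p0 q0] := z_comb e' e'; rewrite -?mulrDr // ?zE' ?sgn ?(conj_add st) //; first exact: (quad_intD st).
    by case: e1 p0 q0 => ->; lra.
  + have [||p0 _] := z_comb e' (- e').
    * by rewrite zE' mulrBr mulNr.
    * by rewrite zE' sgn ?(conj_sub st) // ?mulrBr ?mulNr //; exact: (quad_intB st).
    by apply: (@eqxy (- (e * bil s k a a)) (e * bil s k b b)); rewrite -?p0 // p0.
Qed.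

End Geometry.

(** * Voronoi-relevant vectors and the uniqueness of the obtuse superbase *)

Section Relevant.
Variables (R : realType) (n : nat) (s : R -> R).
Hypothesis st : [/\ (2 <= n)%N, squarefree n & galois_conj n s].
Local Notation O := (@quad_int R n).

(* The Voronoi-relevant vectors: the midpoint of [0] and [z] has no nearest
   lattice points other than these two. *)
Definition relevant (k z : R) : Prop :=
  [/\ O z, z != 0
    & forall w, O w -> w != 0 -> w != z -> 0 < bil s k w w - bil s k w z].

(** The minus sign: the zero set of [sform z] is the bisector of [0] and [-z], so the midpoint in
    question is [-z/2]. *)
Lemma sform_mid k z w :
  sform s w ((- z / 2, - s z / 2), k) = bil s k w w - bil s k w z.
Proof. by rewrite /sform /bil /=; field. Qed.

Lemma Zbasis_neq0 a b : Zbasis n s a b -> a != 0.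
Proof.
move=> [Oa Ob d0 _]; apply: contraNneq d0 => ->.
by rewrite (conj0 st) mul0r mulr0 subrr.
Qed.

(** [voronoi_int] is applied at the midpoint [-a/2], where the linear forms of [a] and [b] are
    [- bil a a] and [- bil a b]; the excess vanishes there only for [0] and [a]. *)
Lemma reduced_relevant k a b : reduced n s k a b -> relevant k a.
Proof.
move=> [Zab g0 Ag Bg]; have a0 := Zbasis_neq0 Zab; have [Oa Ob d0 H] := Zab.
split=> // w Ow w0 wa; have [p [q [E1 E2]]] := H _ Ow.
have E := bil_comb k a E1 E2; rewrite (bilC s k b a) in E.
have h1 : - bil s k a a <= - bil s k a a <= bil s k a a by lra.
have h2 : - bil s k b b <= - bil s k a b <= bil s k b b by lra.
have h3 : - (bil s k a a + bil s k b b + 2 * bil s k a b) <= - bil s k a a + - bil s k a b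
    <= bil s k a a + bil s k b b + 2 * bil s k a b by lra.
have [F0 FE] := voronoi_int g0 Ag Bg h1 h2 h3 E.
rewrite lt_neqAle F0 andbT eq_sym; apply/eqP => /[dup] /FE {FE F0} + F0.
rewrite F0 in E.
case=> [[p0 q0]|[c c1]].
  by move/eqP: w0; rewrite E1 p0 q0 !mul0r addr0.
move/eqP: c1; rewrite sqrf_eq1 => /orP[] /eqP ->.
  case=> [[p0 q0]|[p0 q0]|[p0 q0]|[[p0 q0] _ _ h]].
  - by move/eqP: wa; rewrite E1 p0 q0 mul1r mul0r addr0.
  - by rewrite p0 q0 in E; lra.
  - by rewrite p0 q0 in E; lra.
  - by lra.
case=> [[p0 q0]|[p0 q0]|[p0 q0]|[[p0 q0] _ h _]].
- by rewrite p0 q0 rmorphN1 in E; lra.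
- by rewrite p0 q0 rmorphN1 in E; lra.
- by rewrite p0 q0 rmorphN1 in E; lra.
- by rewrite rmorphN1 in h; lra.
Qed.

Lemma reduced_sym k a b : reduced n s k a b -> reduced n s k b a.
Proof.
move=> [[Oa Ob d0 H] g0 Ag Bg]; split; rewrite 1?(bilC s k b a) //.
split=> //; first by rewrite -opprB oppr_eq0.
by move=> z /H [p [q [-> ->]]]; exists q, p; split; rewrite addrC.
Qed.

Lemma reduced_opp k a b : reduced n s k a b -> reduced n s k (- a) (- b).
Proof.
move=> [[Oa Ob d0 H] g0 Ag Bg].
have gE : bil s k (- a) (- b) = bil s k a b by rewrite /bil !(conj_opp st) //; ring.
split; rewrite ?gE ?(bilNN st) //.
split; [exact: quad_intN st _ Oa|exact: quad_intN st _ Ob|by rewrite !(conj_opp st) // !mulrNN|].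
move=> z /H [p [q [-> ->]]]; exists (- p), (- q).
by rewrite !(conj_opp st) // !rmorphN /= !mulrNN.
Qed.

(** A strictly obtuse superbase is symmetric in its three vectors; this carries statements about a
    basis vector over to [a + b]. *)
Lemma reduced_sum k a b : reduced n s k a b -> bil s k a b < 0 ->
  reduced n s k a (- (a + b)).
Proof.
move=> [[Oa Ob d0 H] g0 Ag Bg] g1; have Oab := quad_intD st Oa Ob.
have gE : bil s k a (- (a + b)) = - (bil s k a a + bil s k a b).
  by rewrite /bil (conj_opp st Oab) (conj_add st) //; ring.
split; rewrite ?gE ?(bilNN st) ?(bilDD st) //; try lra.
split=> //; first exact: quad_intN st _ Oab.
  rewrite (conj_opp st Oab) (conj_add st) //.
  have -> : a * - (s a + s b) - - (a + b) * s a = - (a * s b - b * s a) by ring.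
  by rewrite oppr_eq0.
move=> z /H [p [q [-> ->]]]; exists (p - q), (- q).
by rewrite (conj_opp st Oab) (conj_add st) // rmorphB rmorphN /=; split; ring.
Qed.

Lemma relevant_opp k z : relevant k z -> relevant k (- z).
Proof.
move=> [Oz z0 H]; split; [exact: quad_intN st _ Oz|by rewrite oppr_eq0|move=> w Ow w0 wz].
have := H (- w) (quad_intN st Ow); rewrite oppr_eq0 eqr_oppLR => /(_ w0 wz).
by rewrite (bilNN st) // /bil (conj_opp st Ow) (conj_opp st Oz) !mulNr !mulrN.
Qed.

(** With [z + z' = 2v] the excesses of [v] against [z] and [z'] add up to the inner product of [v]
    with [2v - z - z' = 0], while relevance makes both positive unless [v] is [0], [z] or [z']. *)
Lemma relevant_mod2 k z z' v : relevant k z -> relevant k z' -> O v ->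
  z + z' = v + v -> z = z' \/ z = - z'.
Proof.
move=> [Oz z0 H] [Oz' z0' H'] Ov E.
have [v0|v0] := eqVneq v 0.
  by right; apply/eqP; rewrite -addr_eq0 E v0 addr0.
have [vz|vz] := eqVneq v z.
  by left; apply: (addrI z); rewrite E vz.
have [vz'|vz'] := eqVneq v z'.
  by left; apply: (addIr z'); rewrite E vz'.
have h1 := H _ Ov v0 vz; have h2 := H' _ Ov v0 vz'.
have Es : s z + s z' = s v + s v by rewrite -!(conj_add st) // E.
have E0 : bil s k v v - bil s k v z + (bil s k v v - bil s k v z') =
   v * (v + v - (z + z')) + k ^+ 2 * (s v * (s v + s v - (s z + s z'))).
  by rewrite /bil; ring.
by move: E0; rewrite E Es !subrr !mulr0 addr0; lra.
Qed.

(* Two relevant vectors that agree modulo twice the lattice are equal up to sign. *)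
Lemma relevant_cases k a b z : reduced n s k a b -> bil s k a b < 0 ->
  0 < a -> 0 < b -> relevant k z -> 0 < z -> [\/ z = a, z = b | z = a + b].
Proof.
move=> red g1 a0 b0 rz z0.
have ra := reduced_relevant red; have rb := reduced_relevant (reduced_sym red).
have rab : relevant k (a + b).
  rewrite -[a + b]opprK; apply: relevant_opp.
  exact: reduced_relevant (reduced_sym (reduced_sum red g1)).
have [[Oa Ob _ H] _ _ _] := red; have [Oz zn0 Hz] := rz.
have [p [q [E1 E2]]] := H _ Oz.
have Hp (m : int) : exists c : int, m = c + c \/ m + 1 = c + c.
  have [d [r [-> [->|->]]]] : exists c d : int, m = 2 * c + d /\ (d = 0 \/ d = 1).
    exists (m %/ 2)%Z, (m %% 2)%Z; split; first by rewrite mulrC -divz_eq.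
    by clear; lia.
  - by exists d; left; ring.
  - by exists (d + 1); right; ring.
have vO (c d : int) : O (c%:~R * a + d%:~R * b).
  by apply: (quad_intD st); apply: quad_intM => //; exact: quad_int_intr.
have pos (x y : R) : 0 < y -> 0 < x -> x = y \/ x = - y -> x = y.
  by move=> x0 y0 [//|E]; lra.
have [c [pc|pc]] := Hp p; have [d [qd|qd]] := Hp q.
(* A relevant vector is not twice a lattice vector: for [z = 2v] the excess of [v] would be
   [- bil v v]. *)
- exfalso; have [v [Ov zv]] : exists v, O v /\ z = v + v.
    exists (c%:~R * a + d%:~R * b); split; first exact: vO.
    by rewrite E1 pc qd !rmorphD /=; ring.
  have v0 : v != 0 by apply: contraNneq zn0 => v0; rewrite zv v0 addr0.
  have vz : v != z by rewrite zv -subr_eq0 opprD addNKr oppr_eq0.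
  have := Hz _ Ov v0 vz.
  have -> : bil s k v v - bil s k v z = - bil s k v v.
    by rewrite /bil zv (conj_add st Ov Ov); ring.
  by have := bil_gt0 s k v0; lra.
- constructor 2; apply: pos => //.
  apply: (relevant_mod2 rz rb (vO c d)).
  have -> : z + b = p%:~R * a + (q + 1)%:~R * b by rewrite E1 !rmorphD /=; ring.
  by rewrite qd pc !rmorphD /=; ring.
- constructor 1; apply: pos => //.
  apply: (relevant_mod2 rz ra (vO c d)).
  have -> : z + a = (p + 1)%:~R * a + q%:~R * b by rewrite E1 !rmorphD /=; ring.
  by rewrite qd pc !rmorphD /=; ring.
- constructor 3; apply: pos; rewrite ?addr_gt0 //.
  apply: (relevant_mod2 rz rab (vO c d)).
  have -> : z + (a + b) = (p + 1)%:~R * a + (q + 1)%:~R * b.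
    by rewrite E1 !rmorphD /=; ring.
  by rewrite qd pc !rmorphD /=; ring.
Qed.

(** Each of [a'], [b'], [a' + b'] is one of [a], [b], [a + b]. Positivity fixes the signs and leaves
    only the matchings that send the sum to the sum. *)
Lemma reduced_uniq k a b a' b' :
  reduced n s k a b -> bil s k a b < 0 -> 0 < a -> 0 < b ->
  reduced n s k a' b' -> bil s k a' b' < 0 -> 0 < a' -> 0 < b' ->
  (a, b) = (a', b') \/ (a, b) = (b', a').
Proof.
move=> red g1 a0 b0 red' g1' a0' b0'.
have C := relevant_cases red g1 a0 b0.
have ra := reduced_relevant red'; have rb := reduced_relevant (reduced_sym red').
have rab : relevant k (a' + b').
  rewrite -[a' + b']opprK; apply: relevant_opp.
  exact: reduced_relevant (reduced_sym (reduced_sum red' g1')).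
have ab' : a' <> b'.
  by case: red' => -[_ _ + _] _ _ _ => /[swap] ->; rewrite subrr eqxx.
have {ra}[Ca|Ca|Ca] := C _ ra a0'; have {rb}[Cb|Cb|Cb] := C _ rb b0';
  have {rab}[Cab|Cab|Cab] := C _ rab (addr_gt0 a0' b0');
  rewrite ?Ca ?Cb; by [left|right|exfalso; lra|exfalso; apply: ab'; lra].
Qed.

End Relevant.

(** * The sequence of pairs *)

Section Sequence.
Variables (R : realType) (n : nat) (s : R -> R).
Hypothesis st : [/\ (2 <= n)%N, squarefree n & galois_conj n s].
Local Notation O := (@quad_int R n).

(** Opposite signs of the conjugates make the inner product of the pair decrease in [k^2] from a
    positive value, so that it vanishes at exactly one positive level. *)
Definition good (p : R * R) : Prop :=
  [/\ Zbasis n s p.1 p.2, 0 < p.1, 0 < p.2 & s p.1 * s p.2 < 0].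

(* The square of [pair_level]; [a] and [b] are orthogonal at this level. *)
Definition sqlevel (p : R * R) : R := (p.1 * p.2) / - (s p.1 * s p.2).

Definition step (p : R * R) : R * R :=
  (p.1 + p.2, if `|s p.1| < `|s p.2| then p.1 else p.2).

Definition swap (p : R * R) : R * R := (p.2, p.1).

Lemma pairs_iter j : pairs n s j = iter j step (1, z1' R n).
Proof. by elim: j => [|j IH] //=; rewrite IH; case: (iter _ _ _). Qed.

Lemma Zbasis_sym a b : Zbasis n s a b -> Zbasis n s b a.
Proof.
move=> [Oa Ob d0 H]; split=> //; first by rewrite -opprB oppr_eq0.
by move=> z /H [p [q [-> ->]]]; exists q, p; split; rewrite addrC.
Qed.

Lemma Zbasis_add a b : Zbasis n s a b -> Zbasis n s (a + b) a.
Proof.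
move=> [Oa Ob d0 H]; split=> //; first exact: (quad_intD st).
  rewrite (conj_add st) //.
  have -> : (a + b) * s a - a * (s a + s b) = - (a * s b - b * s a) by ring.
  by rewrite oppr_eq0.
move=> z /H [p [q [-> ->]]]; exists q, (p - q).
by rewrite (conj_add st) // rmorphB /=; split; ring.
Qed.

Lemma good_swap p : good p -> good (swap p).
Proof. by case=> Z ? ? ?; split=> //=; [exact: Zbasis_sym|rewrite mulrC]. Qed.

Lemma sqlevel_swap p : sqlevel (swap p) = sqlevel p.
Proof. by rewrite /sqlevel /= [p.2 * p.1]mulrC [s p.2 * _]mulrC. Qed.

(** The absolute values differ because [p.1 + p.2] is nonzero and so is its conjugate, which takes
    the sign of the larger one. *)
Lemma good_conj_lt p : good p ->
  (`|s p.1| < `|s p.2| /\ (s p.1 + s p.2) * s p.2 > 0 /\ (s p.1 + s p.2) * s p.1 < 0) \/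
  (`|s p.2| < `|s p.1| /\ (s p.1 + s p.2) * s p.1 > 0 /\ (s p.1 + s p.2) * s p.2 < 0).
Proof.
move=> [[Op1 Op2 _ _] p1 p2 sp].
have s12 : s p.1 + s p.2 != 0.
  rewrite -(conj_add st) //; apply/eqP => /(conj_eq0 st (quad_intD st Op1 Op2)); lra.
have p10 : s p.1 != 0 by apply: contraTneq sp => ->; rewrite mul0r ltxx.
have p20 : s p.2 != 0 by apply: contraTneq sp => ->; rewrite mulr0 ltxx.
have [h1|h1|h1] := ltrgt0P (s p.1); last by rewrite h1 eqxx in p10.
- have h2 : s p.2 < 0 by rewrite pmulr_rlt0 in sp.
  rewrite (ltr0_norm h2); have [h3|h3] := ltP (s p.1) (- s p.2).
    by left; split=> //; split; nra.
  have h4 : - s p.2 < s p.1.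
    by rewrite lt_neqAle h3 andbT eq_sym -addr_eq0.
  by right; split=> //; split; nra.
- have h2 : 0 < s p.2 by rewrite nmulr_rlt0 in sp.
  rewrite (gtr0_norm h2); have [h3|h3] := ltP (- s p.1) (s p.2).
    by left; split=> //; split; nra.
  have h4 : s p.2 < - s p.1.
    rewrite lt_neqAle h3 andbT; apply: contra s12 => /eqP ->.
    by rewrite addrN.
  by right; split=> //; split; nra.
Qed.

(** Normal form that settles the conditional in [step]: the pair is ordered by its conjugates. The
    sum then has the conjugate sign of [q.2], which is why it is paired with [q.1]. *)
Lemma stepP p : good p -> exists q, [/\ q = p \/ q = swap p, good q,
   `|s q.1| < `|s q.2|, step p = (q.1 + q.2, q.1)
   & 0 < (s q.1 + s q.2) * s q.2 /\ (s q.1 + s q.2) * s q.1 < 0].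
Proof.
move=> gp; case: (good_conj_lt gp) => [[h1 h2]|[h1 h2]].
  by exists p; split=> //; [left|rewrite /step h1].
exists (swap p); split=> //; [by right|exact: good_swap| |].
  by rewrite /step ltNge (ltW h1) /= addrC.
by rewrite /= [s p.2 + _]addrC.
Qed.

Lemma step_swap p : good p -> step (swap p) = step p.
Proof.
move=> gp; rewrite /step /= addrC; congr (_, _).
by case: (good_conj_lt gp) => -[h1 _]; rewrite h1 ltNge (ltW h1).
Qed.

Lemma good_step p : good p -> good (step p).
Proof.
move=> /stepP [q [_ [Z q1 q2 sq] _ -> [h1 h2]]]; have [ Op Oq _ _] := Z.
by split=> /=; [exact: Zbasis_add|exact: addr_gt0| |rewrite (conj_add st)].
Qed.

Lemma good_iter p j : good p -> good (iter j step p).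
Proof. by move=> gp; elim: j => //= j; exact: good_step. Qed.

Lemma sqlevel_gt0 p : good p -> 0 < sqlevel p.
Proof. by case=> _ p1 p2 sp; rewrite divr_gt0 ?mulr_gt0 ?oppr_gt0. Qed.

Lemma bil_le0 k p : good p -> (bil s k p.1 p.2 <= 0) = (sqlevel p <= k ^+ 2).
Proof.
case=> _ p1 p2 sp; rewrite /bil /sqlevel ler_pdivrMr ?oppr_gt0 //.
by apply/idP/idP => ?; lra.
Qed.

Lemma bil_lt0 k p : good p -> (bil s k p.1 p.2 < 0) = (sqlevel p < k ^+ 2).
Proof.
case=> _ p1 p2 sp; rewrite /bil /sqlevel ltr_pdivrMr ?oppr_gt0 //.
by apply/idP/idP => ?; lra.
Qed.

Lemma sqlevel_step p : good p -> sqlevel p < sqlevel (step p).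
Proof.
move=> /stepP [q [pq gq hq -> [h1 h2]]].
have -> : sqlevel p = sqlevel q by case: pq => ->; rewrite ?sqlevel_swap.
case: gq => -[Op1 Op2 _ _] q1 q2 sq; rewrite /sqlevel /= (conj_add st) //.
rewrite ltr_pdivrMr ?oppr_gt0 // mulrAC ltr_pdivlMr ?oppr_gt0 //.
rewrite -subr_gt0; set d := (X in 0 < X).
have -> : d = q.1 * q.2 * s q.1 ^+ 2 + q.1 ^+ 2 * - (s q.1 * s q.2) by rewrite /d; ring.
by apply: ltr_wpDl; [rewrite mulr_ge0 ?sqr_ge0 // ltW // mulr_gt0
  | rewrite mulr_gt0 ?exprn_gt0 // oppr_gt0].
Qed.

(** The upper bound says that [q.1] has positive inner product with [q.1 + q.2]. For [q.2] this
    holds at every level, because [q.2] and the sum have conjugates of the same sign. *)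
Lemma reduced_step k p : good p -> sqlevel p <= k ^+ 2 < sqlevel (step p) ->
  reduced n s k p.1 p.2.
Proof.
move=> gp /andP[]; have [q [pq gq hq -> [h1 h2]]] := stepP gp.
have -> : sqlevel p = sqlevel q by case: pq => ->; rewrite ?sqlevel_swap.
rewrite -(bil_le0 k gq) /sqlevel /= => g0.
case: gq => -[Op1 Op2 d0 H] q1 q2 sq; rewrite (conj_add st) //.
rewrite ltr_pdivlMr ?oppr_gt0 // => h3.
suff : reduced n s k q.1 q.2 by case: pq => -> // /(reduced_sym).
split=> //; rewrite /bil.
  by move: h3; rewrite mulrN; nra.
have : 0 <= k ^+ 2 * ((s q.1 + s q.2) * s q.2) by rewrite mulr_ge0 ?sqr_ge0 // ltW.
have : 0 < q.2 * (q.1 + q.2) by rewrite mulr_gt0 ?addr_gt0.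
by move=> *; lra.
Qed.

Lemma sqlevel_unbounded p M : good p -> exists j, M < sqlevel (iter j step p).
Proof.
move=> gp.
(* [D] is the determinant of the lattice up to sign, so it does not change along
   the sequence, while the product of the pair grows by at least [mu ^+ 2]. *)
pose D (p : R * R) := p.1 * `|s p.2| + p.2 * `|s p.1|.
pose mu := Num.min p.1 p.2.
have mu0 : 0 < mu by case: gp => _ p1 p2 _; rewrite lt_min p1.
have inv j : let q := iter j step p in
    [/\ D q = D p, mu <= q.1, mu <= q.2 & j%:R * mu ^+ 2 <= q.1 * q.2].
  elim: j => [|j [ED m1 m2 m12]].
    split=> //; rewrite ?ge_min ?lexx ?orbT //= mul0r.
    by case: gp => _ p1 p2 _; rewrite mulr_ge0 // ltW.
  have gj := good_iter j gp; rewrite iterS; move: (iter j step p) gj ED m1 m2 m12 => q.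
  move=> /stepP [r [qr [[Op1 Op2 _ _] r1 r2 sr] hr -> [h1 h2]]] ED m1 m2 m12.
  have [Er [m1' [m2' m12']]] : D r = D p /\ (mu <= r.1 /\ (mu <= r.2 /\ j%:R * mu ^+ 2 <= r.1 * r.2)).
    case: qr => -> //=; rewrite [q.2 * q.1]mulrC; do !split=> //.
    by rewrite -ED /D /= addrC.
  rewrite -natr1 /=; split=> //.
  - rewrite -Er /D /= (conj_add st) //.
    have E1 : `|s r.1 + s r.2| = `|s r.2| - `|s r.1|.
      move: hr; have [k1|k1|k1] := ltrgt0P (s r.1); [| |by move: sr; rewrite k1 mul0r ltxx].
        have k2 : s r.2 < 0 by rewrite pmulr_rlt0 in sr.
        by rewrite (ltr0_norm k2) => ?; rewrite ltr0_norm; lra.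
      have k2 : 0 < s r.2 by rewrite nmulr_rlt0 in sr.
      by rewrite (gtr0_norm k2) => ?; rewrite gtr0_norm; lra.
    by rewrite E1; ring.
  - by apply: (le_trans m1'); rewrite lerDl ltW.
  - nra.
have D0 : 0 < D p.
  case: gp => _ p1 p2 sp; have sn0 : s p.1 * s p.2 != 0 by rewrite lt_eqF.
  move: sn0; rewrite mulf_eq0 negb_or => /andP[conj1 s2].
  by rewrite addr_gt0 // mulr_gt0 ?normr_gt0.
have mu20 : 0 < mu ^+ 2 by rewrite exprn_gt0.
(* Enough for the product of the pair: by squaring [D], that product times [u v] is at most [D^2],
   and as the product exceeds 1, also [u v <= D^2]. *)
pose N := `|M| * D p ^+ 2 + 1.
have N0 : 1 <= N by rewrite lerDr mulr_ge0 ?sqr_ge0.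
have [j Hj] : exists j : nat, N / mu ^+ 2 < j%:R.
  by exists (Num.bound (N / mu ^+ 2)); rewrite archi_boundP // divr_ge0 // ?sqr_ge0 //; lra.
exists j; have [ED m1 m2 m12] := inv j; have gq := good_iter j gp.
move: (iter j step p) gq ED m1 m2 m12 => q [Zq q1 q2 sq] ED m1 m2 m12.
rewrite ltr_pdivrMr // in Hj.
rewrite /sqlevel ltr_pdivlMr ?oppr_gt0 //.
have Eu : - (s q.1 * s q.2) = `|s q.1| * `|s q.2| by rewrite -normrM ltr0_norm.
rewrite Eu; set u := `|s q.1| in Eu *; set v := `|s q.2| in Eu *.
have u0 : 0 <= u by exact: normr_ge0.
have v0 : 0 <= v by exact: normr_ge0.
have P1 : 1 < q.1 * q.2 by lra.
have P2 : `|M| * D q ^+ 2 < q.1 * q.2 by move: Hj; rewrite /N -ED; lra.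
have P3 : q.1 * q.2 * (u * v) <= D q ^+ 2.
  rewrite /D -/u -/v.
  have : 0 <= q.1 * v * (q.2 * u) by rewrite !mulr_ge0 // ltW.
  by have := sqr_ge0 (q.1 * v); have := sqr_ge0 (q.2 * u); nra.
apply: le_lt_trans (ler_wpM2r _ (ler_norm M)) _; first exact: mulr_ge0.
have P4 : u * v <= q.1 * q.2 * (u * v) by rewrite ler_peMl ?mulr_ge0 // ltW.
apply: le_lt_trans P2; rewrite ler_wpM2l //; exact: le_trans P4 P3.
Qed.

End Sequence.

(** * Recurrence of the pairs under multiplication by a unit *)

Section Termination.
Variables (R : realType) (n : nat) (s : R -> R).
Hypothesis st : [/\ (2 <= n)%N, squarefree n & galois_conj n s].
Local Notation O := (@quad_int R n).
Local Notation step := (step s).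
Local Notation sqlevel := (sqlevel s).
Local Notation good := (good n s).

Definition same_pair (p q : R * R) : Prop := p = q \/ p = swap q.

Lemma same_pair_sqlevel p q : same_pair p q -> sqlevel p = sqlevel q.
Proof. by case=> ->; rewrite ?sqlevel_swap. Qed.

Lemma same_pair_good p q : same_pair p q -> good q -> good p.
Proof. by case=> -> // /good_swap. Qed.

Lemma same_pair_step p q : same_pair p q -> good q -> step p = step q.
Proof. by case=> -> // gq; rewrite (step_swap st). Qed.

Lemma set2_same_pair p q :
  ([set p.1; p.2] = [set q.1; q.2] :> set R) <-> same_pair p q.
Proof.
split=> [E|[->|->] //=]; last by rewrite setUC.
have H (x : R) : (x = p.1 \/ x = p.2) <-> (x = q.1 \/ x = q.2).
  by have /(congr1 (fun A : set R => A x)) := E => /= ->.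
have p1 := (H p.1).1 (or_introl erefl).
have p2 := (H p.2).1 (or_intror erefl).
have q1 := (H q.1).2 (or_introl erefl).
have q2 := (H q.2).2 (or_intror erefl).
case: p q {E H} p1 p2 q1 q2 => [a b] [c d] /= p1 p2 q1 q2.
rewrite /same_pair /swap /=.
by case: p1 => ?; case: p2 => ?; case: q1 => ?; case: q2 => ?;
  (left; congruence) || (right; congruence).
Qed.

Lemma sqlevel_mono p i j : good p -> (i < j)%N -> sqlevel (iter i step p) < sqlevel (iter j step p).
Proof.
move=> gp; elim: j => // j IH; rewrite ltnS leq_eqVlt => /orP[/eqP ->|/IH h].
  exact/(sqlevel_step st)/(good_iter st).
exact: lt_trans h (sqlevel_step st (good_iter st _ gp)).
Qed.

Lemma sqlevel_interval p X : good p -> sqlevel p <= X ->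
  exists j, sqlevel (iter j step p) <= X < sqlevel (iter j.+1 step p).
Proof.
move=> gp h0.
have ex : exists j, X < sqlevel (iter j step p) by exact: (sqlevel_unbounded st).
case: (ex_minnP ex) => -[|j] hj mj; first by rewrite ltNge h0 in hj.
exists j; rewrite hj andbT leNgt; apply/negP => /mj; by rewrite ltnn.
Qed.

(** [reduced_uniq] needs strictly obtuse pairs, whereas at [X] they may be orthogonal. The intervals
    are half-open, so both pairs stay reduced at a slightly larger [Z], where they are strictly
    obtuse. *)
Lemma good_uniq p q X : good p -> good q ->
  sqlevel p <= X < sqlevel (step p) -> sqlevel q <= X < sqlevel (step q) -> same_pair p q.
Proof.
move=> gp gq /andP[p1 p2] /andP[q1 q2].
pose Y := Num.min (sqlevel (step p)) (sqlevel (step q)).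
have XY : X < Y by rewrite lt_min p2.
pose Z := (X + Y) / 2.
have XZ : X < Z by rewrite midf_lt.
have ZY : Z < Y by rewrite midf_lt.
have Z0 : 0 <= Z by apply: ltW; apply: le_lt_trans XZ; apply: le_trans p1; exact: ltW (sqlevel_gt0 gp).
have ZE : Z = Num.sqrt Z ^+ 2 by rewrite sqr_sqrtr.
have [Zp Zq] : Z < sqlevel (step p) /\ Z < sqlevel (step q).
  by move: ZY; rewrite lt_min => /andP.
have rp : reduced n s (Num.sqrt Z) p.1 p.2.
  by apply: (reduced_step st gp); rewrite -ZE Zp andbT ltW // (le_lt_trans p1).
have rq : reduced n s (Num.sqrt Z) q.1 q.2.
  by apply: (reduced_step st gq); rewrite -ZE Zq andbT ltW // (le_lt_trans q1).
have bp : bil s (Num.sqrt Z) p.1 p.2 < 0 by rewrite (bil_lt0 _ gp) -ZE (le_lt_trans p1).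
have bq : bil s (Num.sqrt Z) q.1 q.2 < 0 by rewrite (bil_lt0 _ gq) -ZE (le_lt_trans q1).
case: gp gq => _ p10 p20 _ [_ q10 q20 _].
have := reduced_uniq st rp bp p10 p20 rq bq q10 q20.
by rewrite -!surjective_pairing.
Qed.

Section Scale.
Variables (u : R).
Hypotheses (Ou : O u) (Ou' : O u^-1) (nu : u * s u = 1) (u1 : 1 < u).

(** Applied with [u = e^2], whose norm is 1 whatever the norm of [e]. *)
Definition scale (p : R * R) : R * R := (u * p.1, u * p.2).

Let u0 : 0 < u. Proof. by rewrite (lt_trans ltr01). Qed.
Let suE : s u = u^-1. Proof. by apply: (mulfI (lt0r_neq0 u0)); rewrite nu mulfV ?lt0r_neq0. Qed.

Lemma good_scale p : good p -> good (scale p).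
Proof.
move=> [[Op Oq d0 H] p1 p2 sp].
have sE z : O z -> s (u * z) = u^-1 * s z by move=> Oz; rewrite (conj_mul st) // suE.
split; rewrite /= ?mulr_gt0 // ?sE //; last first.
  have -> : u^-1 * s p.1 * (u^-1 * s p.2) = u^-1 ^+ 2 * (s p.1 * s p.2) by ring.
  by rewrite pmulr_rlt0 // exprn_gt0 // invr_gt0.
split; rewrite ?sE //; [exact: quad_intM|exact: quad_intM| |].
  have -> : u * p.1 * (u^-1 * s p.2) - u * p.2 * (u^-1 * s p.1) =
     u * u^-1 * (p.1 * s p.2 - p.2 * s p.1) by ring.
  by rewrite mulfV ?mul1r // lt0r_neq0.
move=> z Oz; have [a [b [E1 E2]]] := H _ (quad_intM Ou' Oz); exists a, b.
have zE : z = u * (u^-1 * z) by rewrite mulrA mulfV ?mul1r // lt0r_neq0.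
split; first by rewrite zE E1; ring.
by rewrite zE sE ?E2; [ring|exact: quad_intM].
Qed.

Lemma sqlevel_scale p : good p -> sqlevel (scale p) = u ^+ 4 * sqlevel p.
Proof.
move=> [[Op Oq d0 H] p1 p2 sp].
rewrite /sqlevel /= !(conj_mul st) // suE.
have : s p.1 * s p.2 != 0 by rewrite lt_eqF.
rewrite mulf_eq0 negb_or => /andP[conj1 s2].
by field; rewrite conj1 s2 lt0r_neq0.
Qed.

Lemma step_scale p : good p -> step (scale p) = scale (step p).
Proof.
move=> [[Op Oq d0 H] p1 p2 sp].
rewrite /step /scale /= !(conj_mul st) // suE !normrM ltr_pM2l ?normr_gt0 ?invr_neq0 ?lt0r_neq0 //.
by rewrite mulrDr; case: ifP.
Qed.

(** Scaling commutes with [step] and multiplies squared levels by [u^4], so the interval of the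
    scaled pair contains [u^4]. Some pair of the sequence also has [u^4] in its interval, and
    [good_uniq] identifies the two. *)
Lemma iter_scale p : good p -> sqlevel p <= 1 < sqlevel (step p) ->
  exists2 j, (0 < j)%N & same_pair (iter j step p) (scale p).
Proof.
move=> gp /andP[h1 h2].
have u4 : 1 < u ^+ 4 by rewrite exprn_egt1.
have [j hj] := @sqlevel_interval p (u ^+ 4) gp (le_trans h1 (ltW u4)).
have gj := good_iter st j gp.
have P : same_pair (iter j step p) (scale p).
  apply: (good_uniq gj (good_scale gp) hj).
  rewrite step_scale // !sqlevel_scale //; last exact: (good_step st).
  by rewrite ger_pMr ?h1 ?ltr_pMr // (lt_trans ltr01).
exists j => //; case: j P {hj gj} => //= /same_pair_sqlevel E.
have h : sqlevel p < u ^+ 4 * sqlevel p by rewrite ltr_pMl // (sqlevel_gt0 gp).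
by rewrite -sqlevel_scale // -E ltxx in h.
Qed.

End Scale.
End Termination.

(** * The list [L] and the terminal pair in terms of the sequence *)

Section ListL.
Variables (R : realType) (n : nat) (s : R -> R) (e : R).
Hypothesis st : [/\ (2 <= n)%N, squarefree n & galois_conj n s].
Hypothesis fe : fundamental_unit n e.
Local Notation O := (@quad_int R n).
Local Notation w := (z1' R n).
Local Notation rn := (Num.sqrt (n%:R : R)).

(** For [n = 1 mod 4] the pair [(1, w)] is orthogonal only at a level above 1, so the lowest levels
    of the section belong to its predecessor [(w - 1, 1)]. Since [w - 1 = - s w], this pair accounts
    for the extra elements of [L]. *)
Definition start : R * R := if (n %% 4 == 1)%N then (w - 1, 1) else (1, w).

Definition pairseq (j : nat) : R * R := iter j (step s) start.

(* The sequence [pairseq] starts one step before the paper's when n = 1 mod 4. *)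
Definition offset : nat := (n %% 4 != 1)%N.

Lemma Zbasis_1w : Zbasis n s 1 w.
Proof.
split; [exact: quad_int1|exact: quad_int_z1'| |].
  by rewrite mul1r (conj1 st) mulr1 -oppr_eq0 opprB (conj_z1'E st) (z1'_sub st).
move=> z /(quad_int_coords st) [p [q [-> ->]]]; exists p, q.
by rewrite (conj1 st) (conj_z1'E st) !mulr1.
Qed.

Lemma good_1w : good n s (1, w).
Proof.
have [n2 _ _] := st; have := sqrt_gt1 R n2 => h.
split=> /=; [exact: Zbasis_1w|by []| |].
  by rewrite /z1'; case: ifP => _; lra.
by rewrite (conj1 st) (conj_z1'E st) mul1r /z1'_conj; case: ifP => _; lra.
Qed.

Lemma sw1 : (n %% 4 == 1)%N -> s w = 1 - w.
Proof. by rewrite (conj_z1'E st) /z1'_conj /z1' => ->; field. Qed.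

Lemma z1'_gt1 : 1 < w.
Proof.
have [n2 _ _] := st; have := sqrt_gt1 R n2 => h.
by rewrite /z1'; case: ifP => _; lra.
Qed.

Lemma s_sub1 : (n %% 4 == 1)%N -> s (w - 1) = - w.
Proof. by move=> n1; rewrite (conj_sub st) ?(sw1 n1) ?(conj1 st); [ring|exact: quad_int_z1'|exact: quad_int1]. Qed.

Lemma step_start1 : (n %% 4 == 1)%N -> step s start = (w, 1).
Proof.
move=> n1; have w1 := z1'_gt1.
rewrite /start n1 /step /= (s_sub1 n1) (conj1 st) subrK normrN normr1 ifN //.
by rewrite -leNgt ger0_norm; lra.
Qed.

Lemma good_start : good n s start.
Proof.
have w1 := z1'_gt1.
rewrite /start; case: ifP => n1; last exact: good_1w.
have Ow1 : O (w - 1) by apply: (quad_intB st); [exact: quad_int_z1'|exact: quad_int1].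
split=> /=; [|by lra|by []|by rewrite (s_sub1 n1) (conj1 st); lra].
split=> //; [exact: quad_int1| |].
  by rewrite (s_sub1 n1) (conj1 st) mulr1 mul1r opprK; apply/eqP; lra.
move=> z /(quad_int_coords st) [p [q [-> E]]]; exists q, (p + q).
have scw : z1'_conj R n = 1 - w by rewrite -(conj_z1'E st) sw1.
by rewrite E scw (s_sub1 n1) (conj1 st) !rmorphD /=; split; ring.
Qed.

Lemma good_pairseq j : good n s (pairseq j).
Proof. exact: (good_iter st _ good_start). Qed.

Lemma sqlevel_start : sqlevel s start <= 1 < sqlevel s (step s start).
Proof.
have w1 := z1'_gt1; have [n1|n1] := boolP (n %% 4 == 1)%N.
  rewrite step_start1 // /start n1 /sqlevel /= (s_sub1 n1) (sw1 n1) (conj1 st).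
  by rewrite !mulr1 ler_pdivrMr ?ltr_pdivlMr; try (apply/andP; split); lra.
have -> : sqlevel s start = 1.
  rewrite /start (negbTE n1) /sqlevel /= (conj1 st) (conj_z1'E st) /z1'_conj /z1' (negbTE n1).
  by rewrite !mul1r opprK divff // sqrtr_eq0 -ltNge ltr0n; case: st => /ltnW.
rewrite lexx /=; have := sqlevel_step st good_start.
rewrite {1}/start (negbTE n1) /sqlevel /= (conj1 st) (conj_z1'E st) /z1'_conj /z1' (negbTE n1).
by rewrite !mul1r opprK divff // sqrtr_eq0 -ltNge ltr0n; case: st => /ltnW.
Qed.

(** Only up to order: for [n = 1 mod 4] the first step gives [(w, 1)] instead of [(1, w)], and later
    steps do not see the order. *)
Lemma pairs_pairseq i : (0 < i)%N -> same_pair (pairs n s i.-1) (pairseq (i - offset)).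
Proof.
rewrite pairs_iter /offset /pairseq; have [n1|n1] := boolP (n %% 4 == 1)%N.
  rewrite subn0 => i0; rewrite -[in iter i]( prednK i0).
  elim: i.-1 => [|j IH]; first by right; rewrite /= step_start1.
  by left; have := same_pair_step st IH (good_pairseq j.+1).
by rewrite /start (negbTE n1) subn1 => _; left.
Qed.

Let e1 : 1 < e. Proof. by case: fe. Qed.
Let e0 : 0 < e. Proof. exact: lt_trans ltr01 e1. Qed.

Lemma fund_int : [/\ O e, O e^-1 & e ^+ 2 * s (e ^+ 2) = 1].
Proof.
case: fe => -[en0 Oe Oe'] _ _; split=> //.
by rewrite expr2 (conj_mul st) // mulrACA -expr2 (unit_norm st).
Qed.

Let Oe2 : O (e ^+ 2). Proof. by case: fund_int => Oe _ _; rewrite expr2; exact: quad_intM. Qed.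
Let Oe2' : O (e ^+ 2)^-1.
Proof. by case: fund_int => _ Oe _; rewrite expr2 invfM; exact: quad_intM. Qed.
Let ne2 : e ^+ 2 * s (e ^+ 2) = 1. Proof. by case: fund_int. Qed.
Let e21 : 1 < e ^+ 2. Proof. by rewrite exprn_egt1. Qed.

Lemma same_pair_sym (p q : R * R) : same_pair p q -> same_pair q p.
Proof. by case=> ->; [left|right; rewrite /swap -surjective_pairing]. Qed.

Lemma same_pair_trans (p q r : R * R) : same_pair p q -> same_pair q r -> same_pair p r.
Proof.
by case=> -> [] ->; rewrite /same_pair /swap -?surjective_pairing; [left|right|right|left].
Qed.

Lemma terminal_pairseq i : (0 < i)%N ->
  is_terminal n s e i <-> same_pair (pairseq (i - offset)) (scale (e ^+ 2) (1, w)).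
Proof.
move=> i0; rewrite /is_terminal /zseq /zseq'.
rewrite (set2_same_pair (pairs n s i.-1) (scale (e ^+ 2) (1, w))).
have P := pairs_pairseq i0.
by split; apply: same_pair_trans => //; exact: same_pair_sym.
Qed.

Lemma sqlevel_scaleE p : good n s p ->
  sqlevel s (scale (e ^+ 2) p) = e ^+ 8 * sqlevel s p.
Proof. by move=> gp; rewrite (sqlevel_scale st Oe2 ne2 e21 gp) -exprM. Qed.

(** [iter_scale] locates the scaled [start]; for [n = 1 mod 4] the terminal pair comes one step
    later. *)
Lemma terminal_index : exists2 M, (0 < M)%N &
  same_pair (pairseq M) (scale (e ^+ 2) (1, w)) /\
  same_pair (pairseq (M - (n %% 4 == 1)%N)) (scale (e ^+ 2) start).
Proof.
have [J J0 HJ] := iter_scale st Oe2 Oe2' ne2 e21 good_start sqlevel_start.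
have [n1|n1] := boolP (n %% 4 == 1)%N; last first.
  exists J => //; rewrite subn0; split=> //.
  by move: HJ; rewrite /pairseq {2}/start (negbTE n1).
exists J.+1 => //; rewrite subn1; split=> //.
right; rewrite /pairseq iterS (same_pair_step st HJ); last first.
  exact: (good_scale st Oe2 Oe2' ne2 e21 good_start).
by rewrite (step_scale st Oe2 ne2 e21 good_start) step_start1.
Qed.

Lemma pairseq_mono i j : (i < j)%N -> sqlevel s (pairseq i) < sqlevel s (pairseq j).
Proof. exact: (sqlevel_mono st good_start). Qed.

Lemma e8_gt1 : 1 < e ^+ 8. Proof. by rewrite exprn_egt1. Qed.

Lemma sqlevel_1w : (n %% 4 != 1)%N -> sqlevel s (1, w) = 1.
Proof.
move=> n1; rewrite /sqlevel /= (conj1 st) (conj_z1'E st) /z1'_conj /z1' (negbTE n1).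
by rewrite !mul1r opprK divff // sqrtr_eq0 -ltNge ltr0n; case: st => /ltnW.
Qed.

Definition in_pair (z : R) (p : R * R) : Prop :=
  exists2 c : R, c = 1 \/ c = -1 & z = c * p.1 \/ z = c * p.2.

Lemma in_pair_same z p q : same_pair p q -> in_pair z p <-> in_pair z q.
Proof. by case=> -> //; split=> -[c c1 [|] zE]; exists c => //; [right|left|right|left]. Qed.

Lemma in_pairP z p :
  [\/ z = p.1, z = - p.1, z = p.2 | z = - p.2] <-> in_pair z p.
Proof.
split=> [[]|[c [->|->] [|]]]; rewrite ?mul1r ?mulN1r => zE.
- by exists 1; [left|left; rewrite mul1r].
- by exists (-1); [right|left; rewrite mulN1r].
- by exists 1; [left|right; rewrite mul1r].
- by exists (-1); [right|right; rewrite mulN1r].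
- by constructor 1.
- by constructor 3.
- by constructor 2.
- by constructor 4.
Qed.

(** Interface to the geometry: [M] is the index of the terminal pair in [pairseq] and [m] its index
    in the list. The comparisons with [1] and [e^8] locate the first and last pairs relative to the
    two end slices. *)
Lemma listL_pairseq : exists M m : nat,
  [/\ [/\ (0 < M)%N, m = (M + offset)%N & stopping_index n s e m],
      sqlevel s (pairseq M.-1) < e ^+ 8,
      if (n %% 4 == 1)%N then sqlevel s (pairseq 0) < 1 /\ e ^+ 8 < sqlevel s (pairseq M)
      else sqlevel s (pairseq 0) = 1 /\ sqlevel s (pairseq M) = e ^+ 8
    & forall z, listL n s m z <-> exists2 j, (j <= M)%N & in_pair z (pairseq j)].
Proof.
have [M M0 [HM HM']] := terminal_index; exists M, (M + offset)%N.
have [l1 l2] := andP sqlevel_start; have w1 := z1'_gt1.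
have e80 : 0 < e ^+ 8 by rewrite (lt_trans ltr01) // e8_gt1.
have lM := same_pair_sqlevel s HM; rewrite (sqlevel_scaleE good_1w) in lM.
have lM' := same_pair_sqlevel s HM'; rewrite (sqlevel_scaleE good_start) in lM'.
have m0 : (0 < M + offset)%N by rewrite addn_gt0 M0.
split.
- split=> //; split=> //.
    by apply/terminal_pairseq => //; rewrite addnK.
  (* No earlier stop: squared levels increase strictly, so the terminal one occurs once. *)
  move=> i /andP[i0 im] /(terminal_pairseq i0) /(same_pair_sqlevel s).
  rewrite (sqlevel_scaleE good_1w) -lM => E.
  have : (i - offset < M)%N by move: im M0; clear; lia.
  by move=> /pairseq_mono; rewrite E ltxx.
- have [n1|n1] := boolP (n %% 4 == 1)%N.
    rewrite n1 subn1 in lM'; rewrite lM'.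
    rewrite gtr_pMr // /sqlevel /start n1 /= (s_sub1 n1) (conj1 st) !mulr1 opprK.
    by rewrite ltr_pdivrMr; lra.
  have := @pairseq_mono M.-1 M; rewrite prednK // leqnn => /(_ isT).
  by rewrite lM (sqlevel_1w n1) mulr1.
- case: ifP => n1; rewrite lM.
    split; last first.
      rewrite ltr_pMr // /sqlevel /= (conj1 st) (sw1 n1) !mul1r ltr_pdivlMr; lra.
    rewrite /pairseq /= /sqlevel /start n1 /= (s_sub1 n1) (conj1 st) !mulr1 opprK.
    by rewrite ltr_pdivrMr; lra.
  by rewrite /pairseq /= /start n1 sqlevel_1w ?n1 // mulr1.
- move=> z; split.
    case=> [[i /andP[i0 im] H]|[/eqP n1 H]].
      exists (i - offset)%N; first by rewrite leq_subLR addnC.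
      exact/(in_pair_same _ (pairs_pairseq i0))/in_pairP.
    exists 0%N => //; rewrite /pairseq /= /start n1 /=.
    move: H; rewrite (sw1 n1).
    by case=> ->; [exists (-1); [right|left => /=; ring]|exists 1; [left|left => /=; ring]].
  case=> j jM H; have [j0|] := posnP (j + offset)%N; last first.
    move=> j0; left; exists (j + offset)%N; first by rewrite j0 leq_add2r.
    apply/in_pairP/(in_pair_same _ (pairs_pairseq j0)).
    by rewrite addnK.
  (* Only [start] for [n = 1 mod 4] has no index in the list: its [1] is [z_1], and [w - 1] is the
     conjugate added by hand. *)
  move/eqP: j0; rewrite addn_eq0 /offset eqb0 negbK => /andP[/eqP j0 n1].
  rewrite j0 /pairseq /= /start n1 /= in H.
  case: H => c c1 [zE|zE]; last first.
    left; exists 1%N; first by rewrite m0.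
    by rewrite /zseq /zseq' /= zE; case: c1 => ->; [constructor 1; rewrite mulr1|constructor 2; rewrite mulr1].
  right; split; first exact/eqP.
  by rewrite (sw1 n1) zE; case: c1 => ->; [right|left] => /=; ring.
Qed.

End ListL.

(** * The list cuts out every cell of the section, and each member is relevant somewhere inside *)

Section Levels.
Variables (R : realType) (n : nat) (s : R -> R) (e : R).
Hypothesis st : [/\ (2 <= n)%N, squarefree n & galois_conj n s].
Hypothesis fe : fundamental_unit n e.
Local Notation O := (@quad_int R n).
Local Notation Q := (pairseq n s).
Variables (M : nat) (L : set R).
Hypotheses (M0 : (0 < M)%N) (hM1 : sqlevel s (Q M.-1) < e ^+ 8)
  (hM : e ^+ 8 <= sqlevel s (Q M))
  (HL : forall z, L z <-> exists2 j, (j <= M)%N & in_pair z (Q j)).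

Let e1 : 1 < e. Proof. by case: fe. Qed.

Lemma in_pair_L j (z : R) : (j <= M)%N -> in_pair z (Q j) -> L z.
Proof. by move=> jM zj; apply/HL; exists j. Qed.

Lemma in_pair_int j (z : R) : in_pair z (Q j) -> O z /\ z != 0.
Proof.
have [Zj _ _ _] := good_pairseq st j.
have [a0 b0] := (Zbasis_neq0 st Zj, Zbasis_neq0 st (Zbasis_sym Zj)).
case: Zj => Oa Ob _ _.
case=> c [->|->] [->|->]; rewrite ?mul1r ?mulN1r ?oppr_eq0 //;
  by split=> //; exact: (quad_intN st).
Qed.

Lemma listL_int z : L z -> O z /\ z != 0.
Proof. by move=> /HL [j _]; exact: in_pair_int. Qed.

Lemma in_pair_opp (z : R) p : in_pair z p -> in_pair (- z) p.
Proof.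
case=> c c1 zE; exists (- c); last by case: zE => ->; [left|right]; rewrite mulNr.
by case: c1 => ->; [right|left; rewrite opprK].
Qed.

Lemma listL_opp z : L z -> L (- z).
Proof. by move=> /HL [j jM zj]; apply: in_pair_L jM _; exact: in_pair_opp. Qed.

Lemma expr8 (k : R) : (k ^+ 4) ^+ 2 = k ^+ 8. Proof. by rewrite -exprM. Qed.

(** The last clause is for the third superbase vector: when the pair is strictly obtuse its sum is
    needed too, and [j < M] puts the sum into the next pair of the list. *)
Lemma level_pair k : 1 <= k <= e ^+ 4 -> exists j,
  [/\ (j <= M)%N, reduced n s k (Q j).1 (Q j).2
    & bil s k (Q j).1 (Q j).2 < 0 -> (j < M)%N].
Proof.
move=> /andP[k1 k4]; have [l0 _] := andP (sqlevel_start st).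
have k0 : 0 <= k by exact: le_trans ler01 k1.
have k21 : 1 <= k ^+ 2 by rewrite expr_ge1.
have k28 : k ^+ 2 <= e ^+ 8 by rewrite -expr8 ler_sqr // nnegrE exprn_ge0 // ltW // (lt_trans ltr01).
have [j hj] := sqlevel_interval st (good_start st) (le_trans l0 k21).
have gj := good_pairseq st j; exists j.
have [hj1 hj2] := andP hj; split.
- rewrite leqNgt; apply/negP => /(pairseq_mono st) h.
  by have := lt_le_trans (le_lt_trans (le_trans k28 hM) h) hj1; rewrite ltxx.
- exact: (reduced_step st gj).
- rewrite (bil_lt0 _ gj) => h; rewrite ltnNge leq_eqVlt; apply/negP => /orP[/eqP Mj|/(pairseq_mono st) h'].
    by have := lt_le_trans h (le_trans k28 hM); rewrite Mj ltxx.
  by have := lt_le_trans (lt_trans h' h) (le_trans k28 hM); rewrite ltxx.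
Qed.

Lemma in_pair_step j : in_pair ((Q j).1 + (Q j).2) (Q j.+1).
Proof. by exists 1; [left|left; rewrite mul1r]. Qed.

Lemma in_pair1 (p : R * R) : in_pair p.1 p.
Proof. by exists 1; [left|left; rewrite mul1r]. Qed.

Lemma in_pair2 (p : R * R) : in_pair p.2 p.
Proof. by exists 1; [left|right; rewrite mul1r]. Qed.

(** Passing from all integers to one finite list, valid at all levels of the section, is what makes
    closures and interiors in three-space accessible. At an orthogonal level the strip of [a + b]
    follows from the other two. *)
Lemma vor_listL k x : 1 <= k <= e ^+ 4 ->
  vor n s k x <-> forall z, L z -> 0 <= sform s z (x, k).
Proof.
move=> hk; split=> [V z /listL_int [Oz _]|H]; first exact: V.
have [j [jM red jM']] := level_pair hk.
have L1 := in_pair_L jM (in_pair1 _); have L2 := in_pair_L jM (in_pair2 _).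
have [[Oa Ob _ _] g0 Ag Bg] := red.
have S z : L z -> - bil s k z z <= lform s k z x <= bil s k z z.
  move=> Lz; have [Oz _] := listL_int Lz.
  by apply: (strip st) => //; apply: H => //; exact: listL_opp.
apply: (vor_reduced red); [exact: S|exact: S|].
have [g1|g1] := ltP (bil s k (Q j).1 (Q j).2) 0.
  rewrite -(bilDD st) // -(linD st) //; apply: S.
  exact: in_pair_L (jM' g1) (in_pair_step j).
have := S _ L1; have := S _ L2.
by move=> ? ?; lra.
Qed.

Lemma listL_two_points k x y z : 1 <= k <= e ^+ 4 -> vor n s k x -> vor n s k y ->
  x <> y -> O z -> z != 0 -> sform s z (x, k) = 0 -> sform s z (y, k) = 0 -> L z.
Proof.
move=> hk Vx Vy xy Oz z0 Fx Fy; have [j [jM red jM']] := level_pair hk.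
have k0 : k != 0 by case/andP: hk => k1 _; rewrite gt_eqF // (lt_le_trans ltr01).
have [c c1] := vor_two_points st k0 red Vx Vy xy Oz z0 Fx Fy.
case=> [->|->|[-> /jM' jM1]].
- by apply: in_pair_L jM _; exists c => //; left.
- by apply: in_pair_L jM _; exists c => //; right.
- by apply: in_pair_L jM1 _; exists c => //; left.
Qed.

Lemma in_pair_relevant k (z : R) p : relevant n s k p.1 -> relevant n s k p.2 ->
  in_pair z p -> relevant n s k z.
Proof.
move=> r1 r2 [c c1 [->|->]]; case: c1 => ->; rewrite ?mul1r ?mulN1r //;
  exact: (relevant_opp st).
Qed.

(** Before the last pair, every interval meets the open range of squared levels between [1] and
    [e^8]; the midpoint of the overlap lies off the orthogonal level. *)
Lemma strict_level j : (j < M)%N -> exists k, [/\ 1 < k < e ^+ 4,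
  reduced n s k (Q j).1 (Q j).2 & bil s k (Q j).1 (Q j).2 < 0].
Proof.
move=> jM; have [l0 l1] := andP (sqlevel_start st).
have mono := pairseq_mono st.
have h1 : 1 < sqlevel s (Q j.+1).
  case: j {jM} => [//|j]; apply: lt_trans l1 (@mono 1%N j.+2 _) => //.
have h2 : sqlevel s (Q j) < e ^+ 8.
  have : (j <= M.-1)%N by rewrite -ltnS prednK.
  by rewrite leq_eqVlt => /orP[/eqP ->//|/mono h]; exact: lt_trans h hM1.
have h3 : sqlevel s (Q j) < sqlevel s (Q j.+1) by exact: mono.
have e81 : 1 < e ^+ 8 by rewrite exprn_egt1.
pose lo := Num.max 1 (sqlevel s (Q j)); pose hi := Num.min (e ^+ 8) (sqlevel s (Q j.+1)).
have lohi : lo < hi by rewrite gt_max !lt_min e81 h1 h2 h3.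
have m1 : lo < (lo + hi) / 2 by rewrite midf_lt.
have m2 : (lo + hi) / 2 < hi by rewrite midf_lt.
move: ((lo + hi) / 2) m1 m2 => Y; rewrite gt_max lt_min => /andP[Y1 Yj] /andP[Y8 Yj1].
have Y0 : 0 < Y by exact: lt_trans ltr01 Y1.
have gj := good_pairseq st j.
have YE : Num.sqrt Y ^+ 2 = Y by rewrite sqr_sqrtr // ltW.
exists (Num.sqrt Y); split.
- have e40 : 0 <= e ^+ 4 by rewrite exprn_ge0 // ltW // (lt_trans ltr01).
  rewrite -[X in X < _]sqrtr1 ltr_sqrt // Y1 /=.
  by rewrite -(ger0_norm e40) -sqrtr_sqr ltr_sqrt ?expr8 // exprn_gt0 // (lt_trans ltr01).
- by apply: (reduced_step st gj); rewrite YE (ltW Yj).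
- by rewrite (bil_lt0 _ gj) YE.
Qed.

Lemma listL_relevant z : L z -> exists2 k, 1 < k < e ^+ 4 & relevant n s k z.
Proof.
move=> /HL [j]; rewrite leq_eqVlt => /orP[/eqP ->|jM] zj.
  (* The last pair is orthogonal only at or above the top level; its elements are the sum and a
     member of the previous pair, which are relevant together with that pair. *)
  have jM : (M.-1 < M)%N by rewrite prednK.
  have [k [hk red g1]] := strict_level jM; exists k => //.
  have ra := reduced_relevant st red; have rb := reduced_relevant st (reduced_sym red).
  have rab : relevant n s k ((Q M.-1).1 + (Q M.-1).2).
    rewrite -[_ + _]opprK; apply: (relevant_opp st).
    exact: (reduced_relevant st (reduced_sym (reduced_sum st red g1))).
  apply: in_pair_relevant zj; rewrite -(prednK M0) /pairseq iterS //=.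
  by case: ifP.
have [k [hk red g1]] := strict_level jM; exists k => //.
by apply: in_pair_relevant zj; [exact: (reduced_relevant st red)|exact: (reduced_relevant st (reduced_sym red))].
Qed.

End Levels.

(** * The image of the cusp section in three-space *)

(** Several topological claims below (closure, frontier, faces, overlaps) are tested along a line
    through the point. *)
Lemma nbhs_line (R : realType) (V : normedModType R) (q d : V) (U : set V) :
  nbhs q U -> exists2 r : R, 0 < r & forall t, `|t| < r -> U (q + t *: d).
Proof.
move=> Uq.
have C : (fun t : R => q + t *: d) @ (0 : R) --> q.
  rewrite -[X in _ --> X]addr0; apply: cvgD; first exact: cvg_cst.
  rewrite -[X in _ --> X](scale0r d); apply: cvgZr_tmp; exact: cvg_id.
have /nbhs_ballP [r /= r0 H] := C _ Uq.
by exists r => // t tr; apply: H; rewrite /ball /= sub0r normrN.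
Qed.

Lemma closure_line (R : realType) (V : normedModType R) (q d : V) (A : set V) :
  (forall t : R, 0 < t < 1 -> A (q + t *: d)) -> closure A q.
Proof.
move=> H B Bq; have [r r0 Hr] := @nbhs_line _ _ q d _ Bq.
pose t := Num.min (r / 2) (1 / 2).
have t0 : 0 < t by rewrite lt_min !divr_gt0.
exists (q + t *: d); split.
  by apply: H; rewrite t0 /= gt_min; apply/orP; right; lra.
by apply: Hr; rewrite gtr0_norm // gt_min; apply/orP; left; lra.
Qed.

Lemma interior_line (R : realType) (V : normedModType R) (q d : V) (A : set V) :
  (forall t : R, 0 < t < 1 -> ~ A (q + t *: d)) -> ~ interior A q.
Proof.
move=> H Aq; have [r r0 Hr] := @nbhs_line _ _ q d _ Aq.
pose t := Num.min (r / 2) (1 / 2).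
have t0 : 0 < t by rewrite lt_min !divr_gt0.
apply: (H t).
  by rewrite t0 /= gt_min; apply/orP; right; lra.
by apply: Hr; rewrite gtr0_norm // gt_min; apply/orP; left; lra.
Qed.

Lemma scale_reg (R : realType) (t : R) (x : R^o) : t *: x = t * x :> R.
Proof. by []. Qed.

Lemma space3E (R : realType) (x d : plane R) (k c : R^o) (t : R) :
  (x, k) + t *: (d, c) = (x + t *: d, k + t * c) :> space3 R.
Proof. by []. Qed.

Section Cont.
Variables (R : realType) (s : R -> R).

Lemma sform_cont z : continuous (sform s z : space3 R -> R).
Proof.
move=> q.
have c1 : (fun q' : space3 R => q'.1.1 : R) @ q --> (q.1.1 : R).
  by apply: (@cvg_comp _ _ _ fst fst); [exact: cvg_fst|exact: cvg_fst].
have c2 : (fun q' : space3 R => q'.1.2 : R) @ q --> (q.1.2 : R).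
  by apply: (@cvg_comp _ _ _ fst snd); [exact: cvg_fst|exact: cvg_snd].
have c3 : (fun q' : space3 R => q'.2 : R) @ q --> (q.2 : R) by exact: cvg_snd.
rewrite /sform; apply: cvgD; first apply: cvgD.
- by apply: cvgM => //; exact: cvg_cst.
- exact: cvg_cst.
- under [X in X @ _]eq_fun => q' do rewrite expr2.
  rewrite expr2; apply: cvgM; first exact: cvgM.
  by apply: cvgD; [apply: cvgM => //; exact: cvg_cst|exact: cvg_cst].
Qed.

Lemma sform_near z (q : space3 R) : 0 < sform s z q -> \forall q' \near q, 0 < sform s z q'.
Proof.
move=> h; apply: (@sform_cont z q [set x | 0 < x]); apply: (@open_nbhs_nbhs _ (sform s z q) [set x | 0 < x]).
by split=> //; exact: open_gt.
Qed.

Lemma level_near_gt (q : space3 R) (a : R) : a < q.2 -> \forall q' \near q, a < q'.2.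
Proof.
move=> h; have H : (fun q' : space3 R => q'.2 : R) @ q --> (q.2 : R) by exact: cvg_snd.
apply: (H [set x | a < x]); apply: (@open_nbhs_nbhs _ (q.2 : R) [set x | a < x]).
by split=> //; exact: open_gt.
Qed.

Lemma level_near_lt (q : space3 R) (a : R) : q.2 < a -> \forall q' \near q, q'.2 < a.
Proof.
move=> h; have H : (fun q' : space3 R => q'.2 : R) @ q --> (q.2 : R) by exact: cvg_snd.
apply: (H [set x | x < a]); apply: (@open_nbhs_nbhs _ (q.2 : R) [set x | x < a]).
by split=> //; exact: open_lt.
Qed.

Lemma closed_sform z : closed [set q : space3 R | 0 <= sform s z q].
Proof.
have -> : [set q : space3 R | 0 <= sform s z q] = sform s z @^-1` [set x | 0 <= x] by [].
by apply: closed_comp; [move=> q _; exact: sform_cont|exact: closed_ge].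
Qed.

End Cont.

(** * Closure, frontier and faces of the region *)

Section Region.
Variables (R : realType) (n : nat) (s : R -> R) (e : R).
Hypothesis st : [/\ (2 <= n)%N, squarefree n & galois_conj n s].
Hypothesis fe : fundamental_unit n e.
Local Notation O := (@quad_int R n).
Local Notation Q := (pairseq n s).
Variables (M : nat) (L : set R).
Hypotheses (M0 : (0 < M)%N) (hM1 : sqlevel s (Q M.-1) < e ^+ 8)
  (hM : e ^+ 8 <= sqlevel s (Q M))
  (HL : forall z, L z <-> exists2 j, (j <= M)%N & in_pair z (Q j)).

Definition region : set (space3 R) := [set q | 1 <= q.2 < e ^+ 4 /\ vor n s q.2 q.1].
Definition region_bar : set (space3 R) := [set q | 1 <= q.2 <= e ^+ 4 /\ vor n s q.2 q.1].

Let e1 : 1 < e. Proof. by case: fe. Qed.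
Let e41 : 1 < e ^+ 4. Proof. by rewrite exprn_egt1. Qed.

(** Finiteness of [L] enters through the bounded index: induction over the pairs, with the four
    elements of a pair and its negatives at a time. *)
Lemma near_listL (T : Type) (F : set_system T) (FF : Filter F) (P : R -> T -> Prop) :
  (forall z, L z -> \forall q \near F, P z q) ->
  \forall q \near F, forall z, L z -> P z q.
Proof.
move=> H.
have H1 N : (N <= M.+1)%N -> \forall q \near F, forall j, (j < N)%N ->
    forall z, in_pair z (Q j) -> P z q.
  elim: N => [_|N IH NM]; first by apply: nearW.
  have HP z : in_pair z (Q N) -> \forall q \near F, P z q.
    by move=> zN; apply: H; apply/HL; exists N.
  have i1 := in_pair1 (Q N); have i2 := in_pair2 (Q N).
  have h1 := HP _ i1; have h2 := HP _ i2.
  have h3 := HP _ (in_pair_opp i1); have h4 := HP _ (in_pair_opp i2).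
  have h5 := IH (ltnW NM).
  near=> q => j; rewrite ltnS leq_eqVlt => /orP[/eqP ->|jN] z; last first.
    by move: j jN z; near: q.
  move=> /in_pairP [] ->; near: q; [exact: h1|exact: h3|exact: h2|exact: h4].
apply: filterS (H1 M.+1 (leqnn _)) => q Hq z /HL [j jM zj].
exact: (Hq j).
Unshelve. all: by end_near.
Qed.

(** [sform] is affine along the ray from the axis point, where its value is [bil z z > 0]. Shrinking
    thus makes every inequality strict; by the same identity, stretching violates an active one in
    [sformZ_lt0]. *)
Lemma sformZ_gt0 k x t z : vor n s k x -> O z -> z != 0 -> 0 <= t < 1 ->
  0 < sform s z (t *: x, k).
Proof.
move=> V Oz z0 /andP[t0 t1]; have := V z Oz.
have -> : sform s z (t *: x, k) = t * sform s z (x, k) + (1 - t) * bil s k z z.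
  by rewrite /sform /bil /= !scale_reg; ring.
have h := bil_gt0 s k z0.
by move=> h2; rewrite ltr_wpDl ?mulr_ge0 // mulr_gt0 // subr_gt0.
Qed.

Lemma sformZ_lt0 k (x : plane R) t z : z != 0 -> 0 < t -> sform s z (x, k) = 0 ->
  sform s z ((1 + t) *: x, k) < 0.
Proof.
move=> z0 t0 E.
have -> : sform s z ((1 + t) *: x, k) = (1 + t) * sform s z (x, k) - t * bil s k z z.
  by rewrite /sform /bil /= !scale_reg; ring.
by rewrite E mulr0 sub0r oppr_lt0 mulr_gt0 // bil_gt0.
Qed.

Lemma region_vor (q : space3 R) : 1 <= q.2 <= e ^+ 4 ->
  (forall z, L z -> 0 < sform s z q) -> vor n s q.2 q.1.
Proof.
move=> hk H; apply/(vor_listL st fe hM HL _ hk) => z /H; rewrite -surjective_pairing.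
exact: ltW.
Qed.

Lemma near_sform (q : space3 R) : (forall z, L z -> 0 < sform s z q) ->
  \forall q' \near q, forall z, L z -> 0 < sform s z q'.
Proof. by move=> H; apply: (@near_listL _ (nbhs q) _ (fun z q' => 0 < sform s z q')) => z /H; exact: sform_near. Qed.

Lemma region_interior (q : space3 R) : 1 < q.2 < e ^+ 4 ->
  (forall z, L z -> 0 < sform s z q) -> nbhs q region.
Proof.
move=> /andP[k1 k4] H.
have h1 := level_near_gt k1; have h2 := level_near_lt k4; have h3 := near_sform H.
near=> q'.
have k1' : 1 < q'.2 by near: q'.
have k4' : q'.2 < e ^+ 4 by near: q'.
split; first by rewrite (ltW k1') k4'.
apply: region_vor; first by rewrite !ltW.
by near: q'.
Unshelve. all: by end_near.
Qed.

Lemma closed_region_bar : closed region_bar.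
Proof.
have -> : region_bar = [set q : space3 R | 1 <= q.2] `&` [set q | q.2 <= e ^+ 4] `&`
   \bigcap_(z in [set z | L z]) [set q | 0 <= sform s z q].
  apply/seteqP; split=> q.
    by move=> [/andP[h1 h2] V]; split=> // z Lz; have := V z (listL_int st HL Lz).1; rewrite -surjective_pairing.
  move=> [[/= h1 h2] h3]; have h12 : 1 <= q.2 <= e ^+ 4 by rewrite h1.
  by split=> //; apply/(vor_listL st fe hM HL _ h12) => z Lz; rewrite -surjective_pairing; exact: h3.
have c3 : continuous (fun q' : space3 R => q'.2 : R) by move=> q; exact: cvg_snd.
apply: closedI; first apply: closedI.
- have -> : [set q : space3 R | 1 <= q.2] = (fun q' : space3 R => q'.2 : R) @^-1` [set x | 1 <= x] by [].
  by apply: closed_comp => [q _|]; [exact: c3|exact: closed_ge].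
- have -> : [set q : space3 R | q.2 <= e ^+ 4] = (fun q' : space3 R => q'.2 : R) @^-1` [set x | x <= e ^+ 4] by [].
  by apply: closed_comp => [q _|]; [exact: c3|exact: closed_le].
- by apply: closed_bigI => z _; exact: closed_sform.
Qed.

(** Only the top slice needs an argument. Lowering [k] directly could leave the cells, whose shape
    varies; after a contraction towards the axis all inequalities are strict, and a small drop in
    level is harmless. *)
Lemma closure_region : closure region = region_bar.
Proof.
apply/seteqP; split.
  rewrite ((closure_id region_bar).1 closed_region_bar).
  by apply: closureS => q [/andP[h1 h2] V]; split=> //; rewrite h1 ltW.
move=> [x k] [/= /andP[k1]]; rewrite le_eqVlt => /orP[/eqP kE|k4] V; last first.
  by apply: subset_closure; split=> //=; rewrite k1.
rewrite ((closure_id _).1 (@closed_closure _ region)).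
apply: (@closure_line _ _ _ (- x, 0)) => t /andP[t0 t1].
rewrite space3E mulr0 addr0 scalerN -[x in x - _]scale1r -scalerBl.
have H z : L z -> 0 < sform s z ((1 - t) *: x, k).
  move=> /(listL_int st HL) [Oz z0]; apply: sformZ_gt0 => //.
  by rewrite subr_ge0 ltW //= ltrBlDr ltrDl.
move=> B Bq.
have k1' : 1 < ((1 - t) *: x, k).2 by rewrite /= kE.
have N : nbhs ((1 - t) *: x, k) (B `&` ([set q' : space3 R | forall z, L z -> 0 < sform s z q']
    `&` [set q' : space3 R | 1 < q'.2])).
  by apply: filterI => //; apply: filterI; [exact: near_sform|exact: level_near_gt].
have [r r0 Hr] := @nbhs_line _ _ _ (0, -1 : R^o) _ N.
have r2 : 0 < r / 2 by rewrite divr_gt0.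
have := Hr (r / 2); rewrite space3E scaler0 addr0 mulrN1 => -[|B1 [B2 B3]].
  by rewrite gtr0_norm //; lra.
exists ((1 - t) *: x, k - r / 2); split=> //; split.
  by rewrite (ltW B3) /= kE ltrBlDr ltrDl.
apply: region_vor => //.
by rewrite (ltW B3) /= kE lerBlDr lerDl ltW.
Qed.

Lemma frontier_region : frontier region = closure region `&`
  (level_plane 1 `|` level_plane (e ^+ 4) `|` \bigcup_(z in L) surface s z).
Proof.
apply/seteqP; split=> [q [cq nq]|q [cq H]]; split=> //.
- have [/andP[k1 k4] V] : region_bar q by rewrite -closure_region.
  have [k1'|k1'] := eqVneq q.2 1; first by left; left.
  have [k4'|k4'] := eqVneq q.2 (e ^+ 4); first by left; right.
  apply: contrapT => nH; apply: nq; apply: region_interior.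
    by rewrite !lt_neqAle k1 k4 k4' eq_sym k1'.
  move=> z Lz; have := V z (listL_int st HL Lz).1; rewrite -surjective_pairing.
  rewrite le_eqVlt => /orP[/eqP E|//].
  by exfalso; apply: nH; right; exists z => //; exact: (esym E).
- have [/andP[k1 k4] V] : region_bar q by rewrite -closure_region.
  case: q k1 k4 V H {cq} => x k /= k1 k4 V [[kE|kE]|[z Lz Sz]].
  + have {}kE : k = 1 := kE.
    apply: (@interior_line _ _ _ (0, -1 : R^o)) => t /andP[t0 t1]; rewrite space3E => -[/= /andP[+ _] _].
    rewrite mulrN1.
    by rewrite leNgt ltrBlDr kE ltrDl t0.
  + have {}kE : k = e ^+ 4 := kE.
    apply: (@interior_line _ _ _ (0, 1 : R^o)) => t /andP[t0 t1]; rewrite space3E => -[/= /andP[_ +] _].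
    rewrite mulr1.
    by rewrite ltNge kE lerDl ltW.
  + apply: (@interior_line _ _ _ (x, 0 : R^o)) => t /andP[t0 t1]; rewrite space3E mulr0 addr0 => -[_ /=].
    have [Oz z0] := listL_int st HL Lz => /(_ z Oz).
    rewrite -[x in x + _]scale1r -scalerDl leNgt sformZ_lt0 //.
Qed.

(** Points on the axis satisfy every inequality strictly, so each end slice contains a neighbourhood
    of its axis point. *)
Lemma region_planes :
  is_face (level_plane 1) (closure region) /\ is_face (level_plane (e ^+ 4)) (closure region).
Proof.
have H k z : L z -> 0 < sform s z ((0, 0), k).
  move=> /(listL_int st HL) [_ z0].
  have -> : sform s z ((0, 0), k) = bil s k z z by rewrite /sform /bil /=; ring.
  exact: bil_gt0.
have F k : 1 <= k <= e ^+ 4 -> is_face (level_plane k) (closure region).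
  move=> hk; exists ((0, 0), k); split=> //; rewrite closure_region.
  apply: filterS (near_sform (H k)) => q' Hq' qk.
  have {}qk : q'.2 = k := qk.
  by split=> //; split; [rewrite qk|apply: region_vor; rewrite ?qk].
by split; apply: F; rewrite ?lexx ?ltW.
Qed.

Lemma contributes_region z :
  [/\ O z, z <> 0 & is_face (surface s z) region] <-> L z.
Proof.
split=> [[Oz /eqP z0 [[x k] [Sq Nq]]]|Lz].
  (* [d] is tangent to the surface within the slice, as [sform z] is constant along it; a face
     therefore contains two points of one slice. *)
  pose d : plane R := (k ^+ 2 * s z, - z).
  have [r r0 Hr] := @nbhs_line _ _ _ (d, 0 : R^o) _ Nq.
  have S t : sform s z (x + t *: d, k) = 0.
    have -> : sform s z (x + t *: d, k) = sform s z (x, k).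
      by rewrite /sform /= !scale_reg; ring.
    by [].
  have P t : `|t| < r -> region (x + t *: d, k).
    by move=> /Hr; rewrite space3E mulr0 addr0 => /(_ (S t)) [].
  have r2 : 0 < r / 2 by rewrite divr_gt0.
  have [/andP[k1 k4] V0] := P 0 ltac:(by rewrite normr0).
  have [_ V1] := P (r / 2) ltac:(by rewrite gtr0_norm //; lra).
  have hk : 1 <= k <= e ^+ 4 by rewrite k1 ltW.
  apply: (listL_two_points st fe hM HL hk V0 V1 _ Oz z0 (S _) (S _)).
  rewrite scale0r addr0 => /(congr1 (fun y : plane R => y.2 - x.2)) /=.
  rewrite subrr addrC addKr /GRing.scale /= => /eqP.
  by rewrite eq_sym mulrN oppr_eq0 mulf_eq0 (negbTE z0) gt_eqF.
have [Oz z0] := listL_int st HL Lz; split=> //; first exact/eqP.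
have [k /andP[k1 k4] [_ _ rz]] := listL_relevant st fe M0 hM1 HL Lz.
(* At a level where [z] is relevant, the midpoint of its bisector satisfies all other inequalities
   strictly, and so do nearby points. *)
pose q : space3 R := ((- z / 2, - s z / 2), k).
exists q; split.
  have : sform s z q = 0 by rewrite sform_mid subrr.
  by [].
have H : \forall q' \near q, forall w, L w -> w != z -> 0 < sform s w q'.
  apply: (@near_listL _ (nbhs q) _ (fun w q' => w != z -> 0 < sform s w q')) => w Lw; have [wz|wz] := eqVneq w z; first by apply: nearW.
  have [Ow w0] := listL_int st HL Lw.
  have : 0 < sform s w q by rewrite sform_mid rz.
  by move=> /sform_near; apply: filterS.
have h1 := level_near_gt (k1 : 1 < q.2).
have h2 := level_near_lt (k4 : q.2 < e ^+ 4).
apply: filterS (filterI H (filterI h1 h2)) => q' [Hq' [k1' k4']] Sq'; split=> //.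
split; first by rewrite ltW.
have hk' : 1 <= q'.2 <= e ^+ 4 by rewrite !ltW.
apply/(vor_listL st fe hM HL _ hk') => w Lw; rewrite -surjective_pairing.
have [->|wz] := eqVneq w z; last by apply: ltW; exact: Hq'.
by have -> : sform s z q' = 0 := Sq'.
Qed.

End Region.

(** * The action and the sections in coordinates *)

Section Action.
Variables (R : realType) (n : nat) (s : R -> R).
Hypothesis st : [/\ (2 <= n)%N, squarefree n & galois_conj n s].
Local Notation O := (@quad_int R n).

Lemma mobius_upper (g : 'M[R]_2) (p : plane R) : g ord_max ord0 = 0 ->
  mobius g p = ((g ord0 ord0 * p.1 + g ord0 ord_max) / g ord_max ord_max,
                g ord0 ord0 * p.2 / g ord_max ord_max).
Proof.
rewrite /mobius => ->; rewrite rmorph0 mul0r add0r -fmorphV /=.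
by case: p => x y /=; congr (_, _); simpc; rewrite /= ?mul0r ?mulr0 ?subr0 ?addr0 ?add0r; ring.
Qed.

Lemma act_tau (z : R) (p : bipoint R) : O z ->
  act s (tau z) p = ((p.1.1 + z, p.1.2), (p.2.1 + s z, p.2.2)).
Proof.
move=> Oz; rewrite /act !mobius_upper ?mxE //= ?(conj0 st) //.
by rewrite (conj1 st) !mul1r !divr1.
Qed.

Lemma delta_center (y1 y2 : R) (p : bipoint R) : delta y1 y2 (Defs.center y1 y2) p = p.1.1 ^+ 2 / y1 ^+ 2 + p.2.1 ^+ 2 / y2 ^+ 2.
Proof. by rewrite /delta /= !sub0r !normrN !real_normK ?num_real. Qed.

Lemma delta_tau (y1 y2 : R) (p : bipoint R) z : 0 < y1 -> 0 < y2 -> O z ->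
  delta y1 y2 (Defs.center y1 y2) (act s (tau z) p) - delta y1 y2 (Defs.center y1 y2) p =
  sform s z (leaf_coord p, y1 / y2) / y1 ^+ 2.
Proof.
move=> y10 y20 Oz; rewrite !delta_center act_tau // /sform /leaf_coord /=.
by field; rewrite !gt_eqF.
Qed.

Lemma dirichletP (y1 y2 : R) (p : bipoint R) : 0 < y1 -> 0 < y2 ->
  dirichlet n s y1 y2 p <-> leaf y1 y2 p /\ vor n s (y1 / y2) (leaf_coord p).
Proof.
move=> y10 y20; split=> -[lp H]; split=> // z Oz; have := H z Oz.
  rewrite -subr_ge0 delta_tau // => h.
  by move: h; rewrite pmulr_lge0 // invr_gt0 exprn_gt0.
by rewrite -[in X in _ -> X]subr_ge0 delta_tau // => h; rewrite divr_ge0 ?sqr_ge0.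
Qed.

Lemma mediatrizP (y1 y2 z : R) (p : bipoint R) : 0 < y1 -> 0 < y2 -> O z ->
  mediatriz s y1 y2 z p <-> leaf y1 y2 p /\ sform s z (leaf_coord p, y1 / y2) = 0.
Proof.
move=> y10 y20 Oz; have y10' : y1 ^+ 2 != 0 by rewrite expf_neq0 ?gt_eqF.
split=> -[lp H]; split=> //.
  have := delta_tau p y10 y20 Oz; rewrite -H subrr => /esym/eqP.
  by rewrite mulf_eq0 invr_eq0 (negbTE y10') orbF => /eqP.
by apply/eqP; rewrite eq_sym -subr_eq0 delta_tau // H mul0r.
Qed.

Lemma leaf_coordK (y1 y2 : R) (p : bipoint R) : leaf y1 y2 p ->
  p = (((leaf_coord p).1, y1), ((leaf_coord p).2, y2)).
Proof. by case: p => -[x1 y1'] [x2 y2'] [/= -> ->]. Qed.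

Lemma leaf_coord_dirichlet (y1 y2 : R) : 0 < y1 -> 0 < y2 ->
  @leaf_coord R @` dirichlet n s y1 y2 = vor n s (y1 / y2).
Proof.
move=> y10 y20; apply/seteqP; split=> [_ [p /(dirichletP _ y10 y20) [_ V] <-] //|x V].
exists ((x.1, y1), (x.2, y2)); last by rewrite /leaf_coord /= -surjective_pairing.
by apply/dirichletP => //; split=> //; rewrite /leaf_coord /= -surjective_pairing.
Qed.

Lemma level_sqrt (h k : R) : 0 < h -> 0 < k -> (h * Num.sqrt k) / (h / Num.sqrt k) = k.
Proof.
move=> h0 k0; have q0 : 0 < Num.sqrt k by rewrite sqrtr_gt0.
rewrite -[RHS](@sqr_sqrtr _ k (ltW k0)).
by field; rewrite !gt_eqF.
Qed.

Lemma sqrt_pos (h k : R) : 0 < h -> 0 < k -> 0 < h * Num.sqrt k /\ 0 < h / Num.sqrt k.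
Proof. by move=> h0 k0; rewrite mulr_gt0 ?divr_gt0 ?sqrtr_gt0. Qed.

Lemma Psi_sections (h : R) (K : set R) : 0 < h -> (forall k, K k -> 0 < k) ->
  @Psi R @` (\bigcup_(k in K) dirichlet n s (h * Num.sqrt k) (h / Num.sqrt k))
   = [set q | K q.2 /\ vor n s q.2 q.1].
Proof.
move=> h0 K0; apply/seteqP; split.
  move=> _ [p [k Kk Dp] <-]; have k0 := K0 _ Kk.
  have [y10 y20] := sqrt_pos h0 k0.
  move/(dirichletP _ y10 y20): Dp => -[[l1 l2] V].
  rewrite level_sqrt // in V.
  by rewrite /Psi /level /= l1 l2 level_sqrt.
move=> [x k] [/= Kk V]; have k0 := K0 _ Kk; have [y10 y20] := sqrt_pos h0 k0.
exists ((x.1, h * Num.sqrt k), (x.2, h / Num.sqrt k)); last first.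
  by rewrite /Psi /level /= level_sqrt // -surjective_pairing.
exists k => //; apply/dirichletP => //; split=> //.
by rewrite level_sqrt // /leaf_coord /= -surjective_pairing.
Qed.

Lemma Psi_section e h : 0 < h -> @Psi R @` cusp_section n s e h = region n s e.
Proof.
move=> h0; apply: Psi_sections => // k /andP[k1 _]; exact: lt_le_trans ltr01 k1.
Qed.

Lemma Psi_section_bar e h : 0 < h -> @Psi R @` cusp_section_bar n s e h = region_bar n s e.
Proof.
move=> h0; apply: Psi_sections => // k /andP[k1 _]; exact: lt_le_trans ltr01 k1.
Qed.

(** The parameters of a leaf are recovered from a point: [h^2] is the product of the heights and [k]
    their quotient. The set [K] serves the half-open and the closed range alike. *)
Lemma sectionsP (h : R) (K : set R) p : 0 < h -> (forall k, K k -> 0 < k) ->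
  (\bigcup_(k in K) dirichlet n s (h * Num.sqrt k) (h / Num.sqrt k)) p <->
  [/\ H2H2 p, p.1.2 * p.2.2 = h ^+ 2, K (level p) & vor n s (level p) (leaf_coord p)].
Proof.
move=> h0 K0; split.
  move=> [k Kk]; have k0 := K0 _ Kk; have [y10 y20] := sqrt_pos h0 k0.
  move=> /(dirichletP _ y10 y20) [[l1 l2] V]; rewrite level_sqrt // in V.
  rewrite /level /H2H2 /= l1 l2 level_sqrt //; split=> //.
  have q0 : 0 < Num.sqrt k by rewrite sqrtr_gt0.
  by field; rewrite gt_eqF.
move=> [[y10 y20] yh Kp V]; exists (level p) => //.
have k0 := K0 _ Kp; have [z10 z20] := sqrt_pos h0 k0.
apply/dirichletP => //; split; last by rewrite level_sqrt.
have q0 : 0 < Num.sqrt (level p) by rewrite sqrtr_gt0.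
have h2 : (h * Num.sqrt (level p)) ^+ 2 = p.1.2 ^+ 2.
  rewrite exprMn sqr_sqrtr ?(ltW k0) // -yh /level.
  by field; rewrite gt_eqF.
have E1 : h * Num.sqrt (level p) = p.1.2.
  by apply/eqP; rewrite -(@eqrXn2 _ 2) ?h2 // ltW.
split=> //.
have -> : h / Num.sqrt (level p) = h ^+ 2 / (h * Num.sqrt (level p)).
  by field; rewrite !gt_eqF.
by rewrite E1 -yh; field; rewrite gt_eqF.
Qed.

Lemma sectionP e h p : 0 < h -> cusp_section n s e h p <->
  [/\ H2H2 p, p.1.2 * p.2.2 = h ^+ 2, 1 <= level p < e ^+ 4
    & vor n s (level p) (leaf_coord p)].
Proof.
move=> h0; apply: sectionsP => // k /andP[k1 _]; exact: lt_le_trans ltr01 k1.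
Qed.

Lemma section_barP e h p : 0 < h -> cusp_section_bar n s e h p <->
  [/\ H2H2 p, p.1.2 * p.2.2 = h ^+ 2, 1 <= level p <= e ^+ 4
    & vor n s (level p) (leaf_coord p)].
Proof.
move=> h0; apply: sectionsP => // k /andP[k1 _]; exact: lt_le_trans ltr01 k1.
Qed.

End Action.

(** * Slices *)

Section Torus.
Variables (R : realType) (n : nat) (s : R -> R).
Hypothesis st : [/\ (2 <= n)%N, squarefree n & galois_conj n s].
Local Notation O := (@quad_int R n).
Local Notation w := (z1' R n).

Lemma sform_slice_cont z k : continuous (fun x : plane R => sform s z (x, k : R^o)).
Proof.
move=> x.
have c1 : (fun y : plane R => y.1 : R) @ x --> (x.1 : R) by exact: cvg_fst.
have c2 : (fun y : plane R => y.2 : R) @ x --> (x.2 : R) by exact: cvg_snd.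
rewrite /sform /=; apply: cvgD; first apply: cvgD.
- by apply: cvgM => //; exact: cvg_cst.
- exact: cvg_cst.
- apply: cvgM; first exact: cvg_cst.
  by apply: cvgD; [apply: cvgM => //; exact: cvg_cst|exact: cvg_cst].
Qed.

Lemma sform_slice_near z k (x : plane R) : 0 < sform s z (x, k) ->
  \forall y \near x, 0 < sform s z (y, k).
Proof.
move=> h; apply: (@sform_slice_cont z k x [set y | 0 < y]).
by apply: (@open_nbhs_nbhs _ (sform s z (x, k))); split=> //; exact: open_gt.
Qed.

Lemma closed_vor k : closed (vor n s k : set (plane R)).
Proof.
have -> : vor n s k = \bigcap_(z in [set z | O z]) [set x : plane R | 0 <= sform s z (x, k)] by [].
apply: closed_bigI => z _.
have -> : [set x : plane R | 0 <= sform s z (x, k)] =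
  (fun x : plane R => sform s z (x, k : R^o)) @^-1` [set x | 0 <= x] by [].
by apply: closed_comp => [x _|]; [exact: sform_slice_cont|exact: closed_ge].
Qed.

Lemma frontier_vor k x z : vor n s k x -> O z -> z != 0 -> sform s z (x, k) = 0 ->
  frontier (vor n s k : set (plane R)) x.
Proof.
move=> V Oz z0 E; split; first exact: subset_closure.
apply: (@interior_line _ _ x x) => t /andP[t0 t1] /(_ z Oz).
by rewrite -[x in x + _]scale1r -scalerDl leNgt sformZ_lt0.
Qed.

Lemma z1'_sub_ge1 : 1 <= w - s w.
Proof.
rewrite (conj_z1'E st); case: st => n2 _ _; have := sqrt_gt1 R n2.
by rewrite /z1' /z1'_conj; case: ifP => _ h; lra.
Qed.

(** The strips of the independent vectors [1] and [w] already bound the cell; eliminating [x.1]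
    leaves the factor [w - s w >= 1]. *)
Lemma vor_bounded k : 0 < k -> exists C : R, forall x, vor n s k x ->
  - C <= x.1 <= C /\ - C <= x.2 <= C.
Proof.
move=> k0; have d1 := z1'_sub_ge1; have w1 := z1'_gt1 st.
have B1 x : vor n s k x -> - bil s k 1 1 <= lform s k 1 x <= bil s k 1 1.
  by move=> V; apply: (strip st); [exact: quad_int1| |]; apply: V; [|apply: (quad_intN st)]; exact: quad_int1.
have B2 x : vor n s k x -> - bil s k w w <= lform s k w x <= bil s k w w.
  by move=> V; apply: (strip st); [exact: quad_int_z1'| |]; apply: V; [|apply: (quad_intN st)]; exact: quad_int_z1'.
set A1 := bil s k 1 1 in B1; set A2 := bil s k w w in B2.
have A10 : 0 <= A1 by apply/ltW/bil_gt0/oner_neq0.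
have A20 : 0 <= A2 by apply/ltW/bil_gt0/lt0r_neq0/(lt_trans ltr01).
pose C2 := (A2 + w * A1) / k ^+ 2; pose C := A1 + A2 + w * A1 + C2.
have C20 : 0 <= C2 by rewrite divr_ge0 ?sqr_ge0 // addr_ge0 // mulr_ge0 // ltW // (lt_trans ltr01).
have wA : 0 <= w * A1 by rewrite mulr_ge0 // ltW // (lt_trans ltr01).
exists C => x V; have := B1 x V; have := B2 x V.
rewrite /lform (conj1 st) !mul1r => /andP[h1 h2] /andP[h3 h4].
set Y := k ^+ 2 * x.2 in h3 h4.
have Yw : - (A2 + w * A1) <= 2 * ((w - s w) * Y) <= A2 + w * A1.
  have E : 2 * ((w - s w) * Y) = w * (2 * (x.1 + Y)) - 2 * (w * x.1 + k ^+ 2 * (s w * x.2)).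
    by rewrite /Y; ring.
  have g1 : w * (2 * (x.1 + Y)) <= w * A1 by rewrite ler_pM2l // (lt_trans ltr01).
  have g2 : w * (- A1) <= w * (2 * (x.1 + Y)) by rewrite ler_pM2l // (lt_trans ltr01).
  by rewrite E; lra.
have YB : - (A2 + w * A1) <= Y <= A2 + w * A1.
  by have [Y0|Y0] := leP 0 Y; nra.
have X2 : - C2 <= x.2 <= C2.
  have k20 : 0 < k ^+ 2 by rewrite exprn_gt0.
  rewrite /C2 -mulNr ler_pdivrMr // ler_pdivlMr // ![x.2 * _]mulrC -/Y.
  by [].
by rewrite /C; split; lra.
Qed.

Lemma compact_vor k : 0 < k -> compact (vor n s k : set (plane R)).
Proof.
move=> /vor_bounded [C H].
apply: (@subclosed_compact _ _ (`[- C, C]%classic `*` `[- C, C]%classic : set (plane R))).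
- exact: closed_vor.
- by apply: compact_setX; exact: segment_compact.
- by move=> x /H [h1 h2]; split; rewrite /= in_itv /=.
Qed.

Lemma int_min (f : int -> int -> R) (B : nat) :
  (forall p q, f p q <= f 0 0 -> (`|p| <= B)%N /\ (`|q| <= B)%N) ->
  exists p q, forall p' q', f p q <= f p' q'.
Proof.
move=> H.
pose g (i : 'I_(B + B).+1) : int := i%:Z - B%:Z.
have g_onto p : (`|p| <= B)%N -> exists i, g i = p.
  move=> pB; have h : (`|(p + B%:Z)%R| < (B + B).+1)%N by lia.
  by exists (Ordinal h); rewrite /g /=; lia.
pose F (ij : 'I_(B + B).+1 * 'I_(B + B).+1) := f (g ij.1) (g ij.2).
case: (@Order.TotalTheory.arg_minP _ _ _ (ord0, ord0) xpredT F isT) => -[i j] _ Hm.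
exists (g i), (g j) => p q; have [i0 hi0] := g_onto 0 (leq0n _).
have m0 : f (g i) (g j) <= f 0 0 by have := Hm (i0, i0) isT; rewrite /F /= hi0.
have [h|h] := leP (f p q) (f 0 0); last exact: le_trans m0 (ltW h).
have [/g_onto [i' hi] /g_onto [j' hj]] := H _ _ h.
by have := Hm (i', j') isT; rewrite /F /= hi hj.
Qed.

(** The translate of [x] closest to the centre lies in the cell. It exists because competing lattice
    elements have bounded coordinates, by [z - s z = q (w - s w)] with [w - s w >= 1]. *)
Lemma vor_cover k (x : plane R) : 0 < k ->
  exists2 z, O z & vor n s k (x + (z, s z)).
Proof.
move=> k0; have d1 := z1'_sub_ge1.
pose N (z : R) := (x.1 + z) ^+ 2 + k ^+ 2 * (x.2 + s z) ^+ 2.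
pose zz (p q : int) := p%:~R + q%:~R * w.
have szz p q : s (zz p q) = p%:~R + q%:~R * s w.
  by have := (s_lin st p q (quad_int1 R n) (quad_int_z1' R n)).2; rewrite (conj1 st) !mulr1.
have ozz p q : O (zz p q) by exact: quad_int_lin.
pose R0 := N (zz 0 0).
have k20 : 0 < k ^+ 2 by rewrite exprn_gt0.
have sqb (y r : R) : y ^+ 2 <= r -> `|y| <= 1 + r.
  move=> h; have : `|y| ^+ 2 <= r by rewrite real_normK ?num_real.
  by have := sqr_ge0 (`|y| - 1); have := normr_ge0 y; nra.
have R00 : 0 <= R0 by rewrite /R0 /N addr_ge0 ?sqr_ge0 // mulr_ge0 ?sqr_ge0 // ltW.
pose C1 := 1 + R0 + `|x.1|; pose C2 := 1 + R0 / k ^+ 2 + `|x.2|.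
have Hb p q : N (zz p q) <= R0 -> `|q%:~R| <= C1 + C2 /\ `|p%:~R| <= C1 + (C1 + C2) * `|w| :> R.
  move=> h.
  have h1 : `|zz p q| <= C1.
    have h2 : (x.1 + zz p q) ^+ 2 <= R0.
      by apply: le_trans h; rewrite /N lerDl mulr_ge0 ?sqr_ge0 // ltW.
    have := sqb _ _ h2; have := ler_normB (x.1 + zz p q) x.1.
    by rewrite [X in `|X| <= _]addrC addKr /C1 => *; lra.
  have h2 : `|s (zz p q)| <= C2.
    have h3 : (x.2 + s (zz p q)) ^+ 2 <= R0 / k ^+ 2.
      rewrite ler_pdivlMr // mulrC; apply: le_trans h; rewrite /N lerDr sqr_ge0 //.
    have := sqb _ _ h3; have := ler_normB (x.2 + s (zz p q)) x.2.
    by rewrite [X in `|X| <= _]addrC addKr /C2 => *; lra.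
  have Eq : q%:~R * (w - s w) = zz p q - s (zz p q) by rewrite szz /zz; ring.
  have hq : `|q%:~R| <= C1 + C2 :> R.
    have : `|q%:~R * (w - s w)| <= C1 + C2.
      rewrite Eq; apply: le_trans (ler_normB _ _) _; exact: lerD.
    rewrite normrM; apply: le_trans; rewrite ler_peMr //.
    by apply: le_trans d1 (ler_norm _).
  split=> //; have -> : p%:~R = zz p q - q%:~R * w by rewrite /zz; ring.
  apply: le_trans (ler_normB _ _) _; apply: lerD => //.
  by rewrite normrM ler_wpM2r.
pose B := (Num.bound (C1 + C2) + Num.bound (C1 + (C1 + C2) * `|w|))%N.
have toB (p : int) (C : R) : `|p%:~R| <= C -> (`|p| <= Num.bound C)%N.
  move=> h; have C0 : 0 <= C by exact: le_trans (normr_ge0 _) h.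
  rewrite -(ler_nat R) natr_absz intr_norm; apply: le_trans h _.
  exact: ltW (archi_boundP C0).
have [|p [q Hpq]] := @int_min (fun p q => N (zz p q)) B.
  move=> p q /Hb [/toB h1 /toB h2]; rewrite /B; split.
    by apply: leq_trans h2 _; rewrite leq_addl.
  by apply: leq_trans h1 _; rewrite leq_addr.
exists (zz p q) => // z Oz.
have [a [b [zE szE]]] := quad_int_coords st Oz.
have := Hpq (p + a) (q + b).
have E1 : zz (p + a) (q + b) = zz p q + z by rewrite zE /zz !rmorphD /=; ring.
have E2 : s (zz p q + z) = s (zz p q) + s z by rewrite (conj_add st).
rewrite E1 /N E2 -subr_ge0; congr (0 <= _).
by rewrite /sform /=; ring.
Qed.

Lemma U_identifiedP k (x y : plane R) : 0 < k ->
  U_identified n s k x y <-> exists2 z, O z & y - x = (z, s z).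
Proof.
move=> k0; split.
  move=> [z [p [Oz _ E1 E2]]]; rewrite (act_tau st) // in E2.
  exists z => //; have [<- <-] : (p.1.1, p.2.1) = x /\ (p.1.1 + z, p.2.1 + s z) = y.
    by have := congr1 fst E1; have := congr1 fst E2.
  by congr (_, _) => /=; rewrite addrC addKr.
move=> [z Oz E]; exists z, ((x.1, k), (x.2, 1)); split=> //.
- by rewrite /Psi /level /= divr1 -surjective_pairing.
- rewrite (act_tau st) // /Psi /level /= divr1; congr (_, _).
  have -> : y = x + (z, s z) by rewrite -E addrC subrK.
  by case: x {E} => x1 x2.
Qed.

Lemma flat_torus_vor k : 0 < k -> flat_torus (vor n s k) (U_identified n s k).
Proof.
move=> k0; exists [set v : plane R | exists2 z, O z & v = (z, s z)].
  exists (1, 1), (w, s w); split.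
    by rewrite /lin_indep /= !mul1r; have := z1'_sub_ge1; lra.
  apply/seteqP; split=> v.
    case=> z /(quad_int_coords st) [p [q [-> ->]]] ->; exists p, q.
    by rewrite (conj_z1'E st); congr (_, _); rewrite /= !scale_reg mulr1.
  case=> p [q ->]; exists (p%:~R + q%:~R * w); first exact: quad_int_lin.
  have := (s_lin st p q (quad_int1 R n) (quad_int_z1' R n)).2; rewrite (conj1 st) !mulr1 => ->.
  by congr (_, _); rewrite /= !scale_reg mulr1.
split.
- exact: compact_vor.
- move=> x; have [z Oz V] := vor_cover x k0; exists (x + (z, s z)) => //.
  by exists z => //; rewrite addrC addKr.
- by move=> x y _ _; exact: U_identifiedP.
- move=> x y Vx Vy /(U_identifiedP _ _ k0) [z Oz E] xy.
  have yE : y = (x.1 + z, x.2 + s z).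
    have -> : y = x + (z, s z) by rewrite -E addrC subrK.
    by case: x {E xy Vx} => x1 x2.
  have z0 : z != 0.
    apply/eqP => z0; apply: xy; rewrite yE z0 (conj0 st) !addr0.
    by rewrite -surjective_pairing.
  have Oz' := quad_intN st Oz.
  have h1 := Vx z Oz; have h2 := Vy (- z) Oz'.
  (* Both values are non-negative and they are opposite, so both vanish. *)
  have E1 : sform s (- z) (y, k) = - sform s z (x, k).
    by rewrite yE /sform (conj_opp st Oz) /=; ring.
  have E0 : sform s z (x, k) = 0 by apply/eqP; rewrite eq_le h1 andbT -oppr_ge0 -E1.
  split; first exact: frontier_vor Vx Oz z0 E0.
  by apply: (frontier_vor Vy Oz'); rewrite ?oppr_eq0 // E1 E0 oppr0.
Qed.

End Torus.

(** * Convex hulls; a parallelogram is not a hexagon *)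

Section Convex.
Variable R : realType.
Implicit Types x y : plane R.

Lemma hull_vertex N (v : 'I_N -> plane R) i : Defs.convex_hull v (v i).
Proof.
exists (fun j => (j == i)%:R); split.
- by move=> j; rewrite ler0n.
- by rewrite (bigD1 i) //= eqxx big1 ?addr0 // => j /negbTE ->.
- rewrite (bigD1 i) //= eqxx scale1r big1 ?addr0 // => j /negbTE ->.
  by rewrite scale0r.
Qed.

Lemma hull_convex N (v : 'I_N -> plane R) x y t : 0 <= t <= 1 ->
  Defs.convex_hull v x -> Defs.convex_hull v y -> Defs.convex_hull v ((1 - t) *: x + t *: y).
Proof.
move=> /andP[t0 t1] [a [a0 a1 ->]] [b [b0 b1 ->]].
exists (fun i => (1 - t) * a i + t * b i); split.
- by move=> i; rewrite addr_ge0 ?mulr_ge0 // subr_ge0.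
- by rewrite big_split /= -!mulr_sumr a1 b1 !mulr1 subrK.
- rewrite !scaler_sumr -big_split /=; apply: eq_bigr => i _.
  by rewrite [RHS]scalerDl !scalerA.
Qed.

Lemma sum_fst N (f : 'I_N -> plane R) : (\sum_i f i).1 = \sum_i (f i).1.
Proof. exact: (big_morph (fun x : plane R => x.1) (fun x y => erefl) erefl). Qed.

Lemma sum_snd N (f : 'I_N -> plane R) : (\sum_i f i).2 = \sum_i (f i).2.
Proof. exact: (big_morph (fun x : plane R => x.2) (fun x y => erefl) erefl). Qed.

Lemma hull_functional N (v : 'I_N -> plane R) (al be c : R) x : Defs.convex_hull v x ->
  exists a : 'I_N -> R, [/\ forall i, 0 <= a i, \sum_i a i = 1
    & c - (al * x.1 + be * x.2) = \sum_i a i * (c - (al * (v i).1 + be * (v i).2))].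
Proof.
move=> [a [a0 a1 ->]]; exists a; split=> //.
rewrite sum_fst sum_snd !mulr_sumr -[c in c - _]mulr1 -a1 mulr_sumr -big_split /= -sumrB.
by apply: eq_bigr => i _; rewrite !scale_reg; ring.
Qed.

Lemma hull_le N (v : 'I_N -> plane R) (al be c : R) x : Defs.convex_hull v x ->
  (forall i, al * (v i).1 + be * (v i).2 <= c) -> al * x.1 + be * x.2 <= c.
Proof.
move=> /(hull_functional al be c) [a [a0 a1 E]] H; rewrite -subr_ge0 E.
by apply: sumr_ge0 => i _; rewrite mulr_ge0 // subr_ge0.
Qed.

Lemma hull_lt N (v : 'I_N -> plane R) (al be c : R) x : Defs.convex_hull v x ->
  (forall i, al * (v i).1 + be * (v i).2 < c) -> al * x.1 + be * x.2 < c.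
Proof.
move=> /(hull_functional al be c) [a [a0 a1 E]] H; rewrite -subr_gt0 E.
have h i : 0 <= a i * (c - (al * (v i).1 + be * (v i).2)).
  by rewrite mulr_ge0 // subr_ge0 ltW.
rewrite lt_neqAle sumr_ge0 // andbT eq_sym; apply/eqP => S0.
have H0 := psumr_eq0P (fun i _ => h i) S0.
have : \sum_i a i = 0.
  apply: big1 => i _; have /eqP := H0 i isT.
  by rewrite mulf_eq0 subr_eq0 [c == _]gt_eqF // orbF => /eqP.
by rewrite a1 => /eqP; rewrite oner_eq0.
Qed.

Definition para (a u w : plane R) : set (plane R) :=
  [set x | exists t r : R, [/\ 0 <= t <= 1, 0 <= r <= 1 & x = a + t *: u + r *: w]].

(** A corner is extreme: when [a] is a convex combination of the [v i], the weighted offsets along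
    [u] and along [w] are non-negative with sum zero, so a point of positive weight has no
    offset. *)
Lemma para_corner N (v : 'I_N -> plane R) a u w : lin_indep u w ->
  para a u w = Defs.convex_hull v -> exists i, v i = a.
Proof.
move=> d0 E.
have [c [c0 c1 aE]] : Defs.convex_hull v a.
  by rewrite -E; exists 0, 0; rewrite !lexx ler01 !scale0r !addr0.
have /choice [tr Htr] i : exists tr : R * R, [/\ 0 <= tr.1 <= 1, 0 <= tr.2 <= 1
    & v i = a + tr.1 *: u + tr.2 *: w].
  have : para a u w (v i) by rewrite E; exact: hull_vertex.
  by case=> t [r [h1 h2 ->]]; exists (t, r).
have [i ci] : exists i, 0 < c i.
  apply: contrapT => H; have : \sum_i c i = 0.
    apply: big1 => i _; apply/eqP; rewrite eq_le c0 andbT leNgt; apply/negP => ci.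
    by apply: H; exists i.
  by rewrite c1 => /eqP; rewrite oner_eq0.
pose T := \sum_i c i * (tr i).1; pose S := \sum_i c i * (tr i).2.
have E1 : T * u.1 + S * w.1 = 0.
  have H : \sum_i c i * ((v i).1 - a.1) = 0.
    under eq_bigr do rewrite mulrBr.
    rewrite sumrB -mulr_suml c1 mul1r aE sum_fst; apply/eqP; rewrite subr_eq0; exact/eqP.
  rewrite /T /S !mulr_suml -big_split /= -[RHS]H; apply: eq_bigr => j _.
  by have [_ _ ->] := Htr j; rewrite /= !scale_reg; ring.
have E2 : T * u.2 + S * w.2 = 0.
  have H : \sum_i c i * ((v i).2 - a.2) = 0.
    under eq_bigr do rewrite mulrBr.
    rewrite sumrB -mulr_suml c1 mul1r aE sum_snd; apply/eqP; rewrite subr_eq0; exact/eqP.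
  rewrite /T /S !mulr_suml -big_split /= -[RHS]H; apply: eq_bigr => j _.
  by have [_ _ ->] := Htr j; rewrite /= !scale_reg; ring.
have T0 : T = 0.
  apply/eqP; have : T * (u.1 * w.2 - u.2 * w.1) = (T * u.1 + S * w.1) * w.2 - (T * u.2 + S * w.2) * w.1 by ring.
  by rewrite E1 E2 !mul0r subrr => /eqP; rewrite mulf_eq0 => /orP[//|/eqP].
have S0 : S = 0.
  apply/eqP; have : S * (u.1 * w.2 - u.2 * w.1) = (T * u.2 + S * w.2) * u.1 - (T * u.1 + S * w.1) * u.2 by ring.
  by rewrite E1 E2 !mul0r subrr => /eqP; rewrite mulf_eq0 => /orP[//|/eqP].
exists i; have [_ _ ->] := Htr i.
have hT j : 0 <= c j * (tr j).1 by have [/andP[? _] _ _] := Htr j; rewrite mulr_ge0.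
have hS j : 0 <= c j * (tr j).2 by have [_ /andP[? _] _] := Htr j; rewrite mulr_ge0.
have /eqP := psumr_eq0P (fun j _ => hT j) T0 (i := i) isT.
have /eqP := psumr_eq0P (fun j _ => hS j) S0 (i := i) isT.
rewrite !mulf_eq0 !(gt_eqF ci) /= => /eqP -> /eqP ->.
by rewrite !scale0r !addr0.
Qed.

(** Rebasing at another corner lets [para_corner] serve all four. *)
Lemma para_flip1 a u w : para (a + u) (- u) w = para a u w.
Proof.
apply/seteqP; split=> x [t [r [/andP[t0 t1] hr ->]]]; exists (1 - t), r;
  (split=> //; [by apply/andP; split; lra|]);
  case: a u w => a1 a2 [u1 u2] [w1 w2]; congr (_, _); rewrite /= !scale_reg; ring.
Qed.

Lemma para_swap a u w : para a u w = para a w u.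
Proof.
by apply/seteqP; split=> x [t [r [ht hr ->]]]; exists r, t; split=> //; rewrite addrAC.
Qed.

Lemma para_flip2 a u w : para (a + w) u (- w) = para a u w.
Proof. by rewrite para_swap para_flip1 para_swap. Qed.

(** The four corners occur among the six points, so some further point lies in the hull of the
    others. *)
Lemma para_not_hexagon (P : set (plane R)) : parallelogram P -> ~ hexagon P.
Proof.
move=> [a [u [w [d0 PE]]]] [v [Pv nv]].
have E : para a u w = Defs.convex_hull v by rewrite -Pv PE.
have [i1 H1] := para_corner d0 E.
have dn (u' w' : plane R) : lin_indep u' w' -> lin_indep (- u') w' /\ lin_indep u' (- w').
  by rewrite /lin_indep /= => h; split=> h'; apply: h; lra.
have [d1 d2] := dn _ _ d0; have [_ d3] := dn _ _ d1.
have [i2 H2] : exists i, v i = a + u by apply: (para_corner d1); rewrite para_flip1.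
have [i3 H3] : exists i, v i = a + w by apply: (para_corner d2); rewrite para_flip2.
have [i4 H4] : exists i, v i = a + u + w.
  by apply: (para_corner d3); rewrite para_flip2 para_flip1.
have [i Hi] : exists i : 'I_6, i \notin [:: i1; i2; i3; i4].
  apply: contrapT => H; have : (#|'I_6| <= #|[:: i1; i2; i3; i4]|)%N.
    apply: subset_leq_card; apply/fintype.subsetP => i _; apply: contrapT => /negP h.
    by apply: H; exists i.
  by rewrite card_ord => h; have := leq_trans h (card_size _).
apply: (nv i).
pose v' := fun j : 'I_5 => v (lift i j).
have hv j : j \in [:: i1; i2; i3; i4] -> Defs.convex_hull v' (v j).
  move=> jl; have ij : i != j by apply: contraNneq Hi => ->.
  have [j' -> _] := unlift_some ij; exact: (hull_vertex v').
have : para a u w (v i) by rewrite E; exact: hull_vertex.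
case=> t [r [ht hr ->]].
have h1 : Defs.convex_hull v' a by rewrite -H1; apply: hv; rewrite !inE eqxx.
have h2 : Defs.convex_hull v' (a + u) by rewrite -H2; apply: hv; rewrite !inE eqxx ?orbT.
have h3 : Defs.convex_hull v' (a + w) by rewrite -H3; apply: hv; rewrite !inE eqxx ?orbT.
have h4 : Defs.convex_hull v' (a + u + w) by rewrite -H4; apply: hv; rewrite !inE eqxx ?orbT.
have := hull_convex hr (hull_convex ht h1 h2) (hull_convex ht h3 h4).
set y := (X in Defs.convex_hull v' X); suff -> : y = a + t *: u + r *: w by [].
rewrite /y; case: (a) (u) (w) => a1 a2 [u1 u2] [w1 w2].
by congr (_, _); rewrite /= !scale_reg; ring.
Qed.

End Convex.

(** * The cell of a strictly obtuse superbase is a hexagon *)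

Section Shapes.
Variables (R : realType) (n : nat) (s : R -> R).
Hypothesis st : [/\ (2 <= n)%N, squarefree n & galois_conj n s].
Local Notation O := (@quad_int R n).

(* The point of the plane at which [lform k a] and [lform k b] take the values [P] and [Q]. *)
Definition pt (k a b P Q : R) : plane R :=
  ((s b * P - s a * Q) / (2 * (a * s b - b * s a)),
   (a * Q - b * P) / (2 * k ^+ 2 * (a * s b - b * s a))).

Section Pt.
Variables (k a b : R).
Hypotheses (k0 : k != 0) (d0 : a * s b - b * s a != 0).

Lemma lin_pt P Q : lform s k a (pt k a b P Q) = P /\ lform s k b (pt k a b P Q) = Q.
Proof. by rewrite /lform /pt /=; split; field; rewrite k0 d0. Qed.

Lemma pt_lin x : pt k a b (lform s k a x) (lform s k b x) = x.
Proof. by have [] := lin_pt (lform s k a x) (lform s k b x); exact: lin_inj. Qed.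

Lemma pt_comb t P Q P' Q' : (1 - t) *: pt k a b P Q + t *: pt k a b P' Q' =
  pt k a b ((1 - t) * P + t * P') ((1 - t) * Q + t * Q').
Proof. by rewrite /pt; congr (_, _); rewrite /= !scale_reg; ring. Qed.

End Pt.

Lemma lin_functional k a b (mu nu : R) x :
  mu * lform s k a x + nu * lform s k b x =
  (2 * (mu * a + nu * b)) * x.1 + (2 * k ^+ 2 * (mu * s a + nu * s b)) * x.2.
Proof. by rewrite /lform; ring. Qed.

Section Hexagon.
Variables (k a b : R).
Hypotheses (k0 : k != 0) (red : reduced n s k a b) (g1 : bil s k a b < 0).
Local Notation A := (bil s k a a).
Local Notation B := (bil s k b b).
Local Notation g := (bil s k a b).
Local Notation C := (A + B + 2 * g).

(** The corners in cyclic order, as values [(P, Q)] of the forms of [a] and [b]: at each one, two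
    neighbouring bounds among [|P| <= A], [|Q| <= B], [|P + Q| <= C] are attained. *)
Definition hex_coord (i : nat) : R * R :=
  nth (0, 0) [:: (A, B + 2 * g); (A, - B); (- (A + 2 * g), - B);
     (- A, - (B + 2 * g)); (- A, B); (A + 2 * g, B)] i.

Definition hex_vertex (i : 'I_6) : plane R := pt k a b (hex_coord i).1 (hex_coord i).2.

Let d0 : a * s b - b * s a != 0. Proof. by case: red => -[]. Qed.

Lemma lin_hex i : lform s k a (hex_vertex i) = (hex_coord i).1 /\
  lform s k b (hex_vertex i) = (hex_coord i).2.
Proof. exact: lin_pt. Qed.

Lemma hex_hull_le (mu nu c : R) x : Defs.convex_hull hex_vertex x ->
  (forall i : 'I_6, mu * (hex_coord i).1 + nu * (hex_coord i).2 <= c) ->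
  mu * lform s k a x + nu * lform s k b x <= c.
Proof.
move=> hx H; rewrite lin_functional; apply: (hull_le hx) => i.
by rewrite -lin_functional; have [-> ->] := lin_hex i.
Qed.

Lemma hex_extreme (i : 'I_6) (mu nu : R) :
  (forall j : 'I_6, i != j ->
    mu * (hex_coord j).1 + nu * (hex_coord j).2 < mu * (hex_coord i).1 + nu * (hex_coord i).2) ->
  ~ Defs.convex_hull (fun j : 'I_5 => hex_vertex (lift i j)) (hex_vertex i).
Proof.
move=> H /hull_lt h.
have := h (2 * (mu * a + nu * b)) (2 * k ^+ 2 * (mu * s a + nu * s b))
   (mu * (hex_coord i).1 + nu * (hex_coord i).2).
rewrite -lin_functional; have [-> ->] := lin_hex i; rewrite ltxx.
suff : forall j : 'I_5, 2 * (mu * a + nu * b) * (hex_vertex (lift i j)).1 +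
    2 * k ^+ 2 * (mu * s a + nu * s b) * (hex_vertex (lift i j)).2 <
    mu * (hex_coord i).1 + nu * (hex_coord i).2 by move=> H' /(_ H').
move=> j; rewrite -lin_functional; have [-> ->] := lin_hex (lift i j).
by apply: H; exact: neq_lift.
Qed.

(** The sum of the outer normals of the two sides meeting at corner [i], so the functional is
    maximal at that corner alone. *)
Let dir (i : nat) : R * R :=
  nth (0, 0) [:: (2, 1); (1, -1); (-1, -2); (-2, -1); (-1, 1); (1, 2)] i.

Lemma hex_irredundant (i : 'I_6) :
  ~ Defs.convex_hull (fun j : 'I_5 => hex_vertex (lift i j)) (hex_vertex i).
Proof.
have [_ _ Ag Bg] := red; have g1' := g1.
apply: (hex_extreme (mu := (dir i).1) (nu := (dir i).2)) => j.
case: i => -[|[|[|[|[|[|i]]]]]] // Hi; case: j => -[|[|[|[|[|[|j]]]]]] // Hj _;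
  rewrite /dir /hex_coord /=; lra.
Qed.

Lemma hull_seg P Q P' Q' t : 0 <= t <= 1 ->
  Defs.convex_hull hex_vertex (pt k a b P Q) -> Defs.convex_hull hex_vertex (pt k a b P' Q') ->
  Defs.convex_hull hex_vertex (pt k a b ((1 - t) * P + t * P') ((1 - t) * Q + t * Q')).
Proof. by move=> ht h h'; rewrite -pt_comb //; exact: hull_convex. Qed.

Lemma between (l r p : R) : l <= p <= r -> exists2 t, 0 <= t <= 1 & p = (1 - t) * l + t * r.
Proof.
move=> /andP[h1 h2]; have [E|lr] := eqVneq l r.
  exists 0; rewrite ?lexx ?ler01 //; have : p = l by apply/eqP; rewrite eq_le h1 E h2.
  by move=> ->; ring.
have lr' : 0 < r - l by rewrite subr_gt0 lt_neqAle lr (le_trans h1).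
exists ((p - l) / (r - l)).
  by rewrite divr_ge0 ?subr_ge0 ?(ltW lr') //= ?ler_pdivrMr // ?mul1r ?lerD2r // -subr_ge0 ltW.
by field; rewrite gt_eqF.
Qed.

Lemma hex_edge (i j : 'I_6) P Q t : 0 <= t <= 1 ->
  P = (1 - t) * (hex_coord i).1 + t * (hex_coord j).1 ->
  Q = (1 - t) * (hex_coord i).2 + t * (hex_coord j).2 ->
  Defs.convex_hull hex_vertex (pt k a b P Q).
Proof. by move=> ht -> ->; apply: hull_seg => //; exact: hull_vertex. Qed.

Let o (i : nat) (h : (i < 6)%N) : 'I_6 := Ordinal h.

(** At a fixed value [Q] of the second form the point lies between [l] and [r], both on edges of the
    hexagon; which edges depends on [Q] against [B + 2g] and its negative. Conversely, the six
    bounds need checking at the corners only. *)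
Lemma vor_hex : vor n s k = Defs.convex_hull hex_vertex.
Proof.
have [[Oa Ob _ _] _ Ag Bg] := red; have g1' := g1.
apply/seteqP; split=> x.
  move=> /(vor_ineqs st Oa Ob) []; rewrite -[x in Defs.convex_hull _ x](pt_lin k0 d0).
  move: (lform s k a x) (lform s k b x) => P Q hP hQ hPQ.
  have [r [hr1 hr2]] : exists r, P <= r /\ Defs.convex_hull hex_vertex (pt k a b r Q).
    have [hQ'|hQ'] := leP Q (B + 2 * g).
      have [|t ht Qt] := @between (- B) (B + 2 * g) Q; first by lra.
      exists A; split; first by lra.
      by apply: (@hex_edge (o (isT : (1 < 6)%N)) (o (isT : (0 < 6)%N)) _ _ t ht) => /=; [ring|].
    have [|t ht Qt] := @between (B + 2 * g) B Q; first by lra.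
    exists (C - Q); split; first by lra.
    by apply: (@hex_edge (o (isT : (0 < 6)%N)) (o (isT : (5 < 6)%N)) _ _ t ht) => //=; rewrite Qt; ring.
  have [l [hl1 hl2]] : exists l, l <= P /\ Defs.convex_hull hex_vertex (pt k a b l Q).
    have [hQ'|hQ'] := leP (- (B + 2 * g)) Q.
      have [|t ht Qt] := @between (- (B + 2 * g)) B Q; first by lra.
      exists (- A); split; first by lra.
      by apply: (@hex_edge (o (isT : (3 < 6)%N)) (o (isT : (4 < 6)%N)) _ _ t ht) => /=; [ring|].
    have [|t ht Qt] := @between (- B) (- (B + 2 * g)) Q; first by lra.
    exists (- C - Q); split; first by lra.
    by apply: (@hex_edge (o (isT : (2 < 6)%N)) (o (isT : (3 < 6)%N)) _ _ t ht) => //=; rewrite Qt; ring.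
  have [|t ht Pt] := @between l r P; first by rewrite hl1.
  have := hull_seg ht hl2 hr2; rewrite -Pt.
  by have -> : (1 - t) * Q + t * Q = Q by ring.
move=> hx.
have H mu nu c : (forall i : 'I_6, mu * (hex_coord i).1 + nu * (hex_coord i).2 <= c) ->
  mu * lform s k a x + nu * lform s k b x <= c by exact: hex_hull_le.
have E1 := H 1 0 A; have E2 := H (-1) 0 A; have E3 := H 0 1 B; have E4 := H 0 (-1) B.
have E5 := H 1 1 C; have E6 := H (-1) (-1) C.
apply: (vor_reduced red).
- apply/andP; split.
    suff : -1 * lform s k a x + 0 * lform s k b x <= A by lra.
    by apply: E2 => -[[|[|[|[|[|[|i]]]]]] Hi] //=; rewrite /hex_coord /=; lra.
  suff : 1 * lform s k a x + 0 * lform s k b x <= A by lra.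
  by apply: E1 => -[[|[|[|[|[|[|i]]]]]] Hi] //=; rewrite /hex_coord /=; lra.
- apply/andP; split.
    suff : 0 * lform s k a x + -1 * lform s k b x <= B by lra.
    by apply: E4 => -[[|[|[|[|[|[|i]]]]]] Hi] //=; rewrite /hex_coord /=; lra.
  suff : 0 * lform s k a x + 1 * lform s k b x <= B by lra.
  by apply: E3 => -[[|[|[|[|[|[|i]]]]]] Hi] //=; rewrite /hex_coord /=; lra.
- apply/andP; split.
    suff : -1 * lform s k a x + -1 * lform s k b x <= C by lra.
    by apply: E6 => -[[|[|[|[|[|[|i]]]]]] Hi] //=; rewrite /hex_coord /=; lra.
  suff : 1 * lform s k a x + 1 * lform s k b x <= C by lra.
  by apply: E5 => -[[|[|[|[|[|[|i]]]]]] Hi] //=; rewrite /hex_coord /=; lra.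
Qed.

Lemma hexagon_vor : hexagon (vor n s k).
Proof. by exists hex_vertex; split; [exact: vor_hex|exact: hex_irredundant]. Qed.

End Hexagon.
End Shapes.

(** * Orthogonal levels, where the cell is a parallelogram *)

Section Orthogonal.
Variables (R : realType) (n : nat) (s : R -> R).
Hypothesis st : [/\ (2 <= n)%N, squarefree n & galois_conj n s].
Local Notation O := (@quad_int R n).

Definition orthogonal_basis (k a b : R) : Prop := Zbasis n s a b /\ bil s k a b = 0.

Lemma orth_sym k a b : orthogonal_basis k a b -> orthogonal_basis k b a.
Proof. by case=> Z E; split; [exact: Zbasis_sym|rewrite bilC]. Qed.

Lemma orth_reduced k a b : orthogonal_basis k a b -> reduced n s k a b.
Proof.
move=> [Z E]; have a0 := bil_gt0 s k (Zbasis_neq0 st Z).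
have b0 := bil_gt0 s k (Zbasis_neq0 st (Zbasis_sym Z)).
by split; rewrite ?E ?addr0.
Qed.

Lemma orth_opp k a b : orthogonal_basis k a b -> orthogonal_basis k (- a) (- b).
Proof.
move=> ob; have [Z E] := ob; have [Z' _ _ _] := reduced_opp st (orth_reduced ob).
split=> //; case: Z => Oa Ob _ _.
by rewrite -[RHS]E /bil !(conj_opp st) //; ring.
Qed.

Lemma vor_orth k a b x : orthogonal_basis k a b -> vor n s k x <->
  - bil s k a a <= lform s k a x <= bil s k a a /\
  - bil s k b b <= lform s k b x <= bil s k b b.
Proof.
move=> ob; have [[Oa Ob _ _] E] := ob; split.
  by move=> /(vor_ineqs st Oa Ob) [].
move=> [h1 h2]; apply: (vor_reduced (orth_reduced ob)) => //.
by rewrite E; lra.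
Qed.

Definition comb (a b t r : R) : plane R := t *: (a, s a) + r *: (b, s b).

Lemma lin_comb k a b t r : lform s k a (comb a b t r) = 2 * (t * bil s k a a + r * bil s k a b)
  /\ lform s k b (comb a b t r) = 2 * (t * bil s k a b + r * bil s k b b).
Proof. by rewrite /comb /lform /bil /= !scale_reg; split; ring. Qed.

Lemma combE k a b x : k != 0 -> orthogonal_basis k a b ->
  x = comb a b (lform s k a x / (2 * bil s k a a)) (lform s k b x / (2 * bil s k b b)).
Proof.
move=> k0 [Z E]; have a0 := bil_gt0 s k (Zbasis_neq0 st Z).
have b0 := bil_gt0 s k (Zbasis_neq0 st (Zbasis_sym Z)).
have [_ _ d0 _] := Z; set t := _ / _; set r := _ / _.
have [E1 E2] := lin_comb k a b t r; rewrite E in E1 E2.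
apply: (lin_inj k0 d0); rewrite ?E1 ?E2 /t /r.
  by field; rewrite !gt_eqF.
by field; rewrite !gt_eqF.
Qed.

Lemma parallelogram_vor k a b : k != 0 -> orthogonal_basis k a b ->
  parallelogram (vor n s k).
Proof.
move=> k0 ob; have [Z E] := ob; have [_ _ d0 _] := Z.
have a0 := bil_gt0 s k (Zbasis_neq0 st Z).
have b0 := bil_gt0 s k (Zbasis_neq0 st (Zbasis_sym Z)).
(* The cell is centred at the origin, with the basis vectors as edges. *)
exists (comb a b (- (1 / 2)) (- (1 / 2))), (a, s a), (b, s b); split.
  by apply/eqP; rewrite /= [s a * b]mulrC.
apply/seteqP; split=> x.
  move=> /(vor_orth _ ob) [/andP[h1 h2] /andP[h3 h4]].
  exists (lform s k a x / (2 * bil s k a a) + 1 / 2), (lform s k b x / (2 * bil s k b b) + 1 / 2).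
  have half (l A : R) : 0 < A -> - A <= l -> l <= A -> 0 <= l / (2 * A) + 1 / 2 <= 1.
    move=> A0 l1 l2; have -> : l / (2 * A) + 1 / 2 = (l + A) / (2 * A) by field; rewrite gt_eqF.
    by rewrite divr_ge0 ?ler_pdivrMr //=; lra.
  split; [exact: half|exact: half|].
  rewrite {1}(combE x k0 ob) /comb.
  by congr (_, _); rewrite /= !scale_reg; ring.
case=> t [r [/andP[t0 t1] /andP[r0 r1] ->]]; apply/(vor_orth _ ob).
have -> : comb a b (- (1 / 2)) (- (1 / 2)) + t *: (a, s a) + r *: (b, s b)
   = comb a b (t - 1 / 2) (r - 1 / 2).
  by rewrite /comb; congr (_, _); rewrite /= !scale_reg; ring.
have [-> ->] := lin_comb k a b (t - 1 / 2) (r - 1 / 2); rewrite E.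
by split; nra.
Qed.

Lemma orth_contributes y1 y2 a b : 0 < y1 -> 0 < y2 -> orthogonal_basis (y1 / y2) a b ->
  contributes_side n s y1 y2 a.
Proof.
move=> y10 y20; set k := y1 / y2 => ob; have k0 : k != 0 by rewrite gt_eqF ?divr_gt0.
have [Z E] := ob; have [Oa Ob d0 _] := Z.
have a0 := bil_gt0 s k (Zbasis_neq0 st Z).
have b0 := bil_gt0 s k (Zbasis_neq0 st (Zbasis_sym Z)).
split=> //; first by apply/eqP; exact: (Zbasis_neq0 st Z).
pose lp (x : plane R) : bipoint R := ((x.1, y1), (x.2, y2)).
(* The side of [a] lies at [a]-coordinate [-1/2], since [sform a] bisects [0] and [-a]. *)
exists (lp (comb a b (- (1 / 2)) (- (1 / 2)))), (lp (comb a b (- (1 / 2)) (1 / 2))).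
have seg t : (1 - t) *: lp (comb a b (- (1 / 2)) (- (1 / 2))) + t *: lp (comb a b (- (1 / 2)) (1 / 2))
    = lp (comb a b (- (1 / 2)) (t - 1 / 2)).
  by rewrite /lp /comb; congr ((_, _), (_, _)); rewrite /= !scale_reg; field.
split.
  move=> Epq; have := congr1 (fun p : bipoint R => p.1.1) Epq.
  rewrite /= !scale_reg => E1.
  by have /eqP := Zbasis_neq0 st (Zbasis_sym Z); apply; lra.
apply/seteqP; split=> p.
  case=> /(mediatrizP st p y10 y20 Oa) [lfp F] /(dirichletP st p y10 y20) [_ V].
  have [_ /andP[h3 h4]] := (vor_orth _ ob).1 V.
  exists (lform s k b (leaf_coord p) / (2 * bil s k b b) + 1 / 2).
    have -> : lform s k b (leaf_coord p) / (2 * bil s k b b) + 1 / 2 =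
      (lform s k b (leaf_coord p) + bil s k b b) / (2 * bil s k b b) by field; rewrite gt_eqF.
    by rewrite divr_ge0 ?ler_pdivrMr //=; lra.
  rewrite seg addrK.
  rewrite -/k sformE in F.
  have Fa : lform s k a (leaf_coord p) / (2 * bil s k a a) = - (1 / 2).
    have -> : lform s k a (leaf_coord p) = - bil s k a a by lra.
    by field; rewrite gt_eqF.
  have := combE (leaf_coord p) k0 ob; rewrite Fa => <-.
  exact: leaf_coordK.
move=> [t /andP[t0 t1] ->]; rewrite seg.
have [L1 L2] := lin_comb k a b (- (1 / 2)) (t - 1 / 2); rewrite E in L1 L2.
have lc x : leaf_coord (lp x) = x by case: x.
split.
  apply/(mediatrizP st _ y10 y20 Oa); split=> //; rewrite lc -/k sformE L1; lra.
apply/(dirichletP st _ y10 y20); split=> //; rewrite lc -/k.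
by apply/(vor_orth _ ob); rewrite L1 L2; split; nra.
Qed.

Lemma orth_bounded h k z z' : 0 < h -> 0 < k -> orthogonal_basis k z z' ->
  parallelogram_bounded_by n s h k z z'.
Proof.
move=> h0 k0 ob; have [y10 y20] := sqrt_pos h0 k0.
have kE := level_sqrt h0 k0; have k0' : k != 0 by rewrite gt_eqF.
rewrite /parallelogram_bounded_by; move: (h * Num.sqrt k) (h / Num.sqrt k) y10 y20 kE => y1 y2 y10 y20 kE.
rewrite leaf_coord_dirichlet // kE.
have [[Oz Oz' _ _] E] := ob; have Z := ob.1.
have z0 := Zbasis_neq0 st Z; have z0' := Zbasis_neq0 st (Zbasis_sym Z).
have W w : [\/ w = z, w = - z, w = z' | w = - z'] -> O w /\ w != 0.
  by case=> ->; rewrite ?oppr_eq0; split=> //; exact: (quad_intN st).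
split.
- exact: parallelogram_vor ob.
- move=> w /= Ww; rewrite -kE in ob; case: Ww => ->.
  + exact: orth_contributes ob.
  + exact: orth_contributes (orth_opp ob).
  + exact: orth_contributes (orth_sym ob).
  + exact: orth_contributes (orth_opp (orth_sym ob)).
- apply/seteqP; split=> x.
    move=> [cx nx]; have V : vor n s k x.
      by move: cx; rewrite -((closure_id _).1 (@closed_vor R n s k)).
    suff [w [Ww Fw]] : exists w, [\/ w = z, w = - z, w = z' | w = - z'] /\ sform s w (x, k) = 0.
      have [Ow _] := W w Ww; exists w => //; exists ((x.1, y1), (x.2, y2)); last first.
        by rewrite /leaf_coord /= -surjective_pairing.
      split.
        by apply/(mediatrizP st _ y10 y20 Ow); split=> //; rewrite kE /leaf_coord /= -surjective_pairing.
      by apply/(dirichletP st _ y10 y20); split=> //; rewrite kE /leaf_coord /= -surjective_pairing.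
    apply: contrapT => H; apply: nx.
    have P w : [\/ w = z, w = - z, w = z' | w = - z'] -> \forall y \near x, 0 < sform s w (y, k).
      move=> Ww; have Vw := V w (W w Ww).1.
      apply: sform_slice_near; rewrite lt_neqAle Vw andbT eq_sym.
      by apply/eqP => F; apply: H; exists w.
    have h1 := P z (Or41 _ _ _ erefl); have h2 := P (- z) (Or42 _ _ _ erefl).
    have h3 := P z' (Or43 _ _ _ erefl); have h4 := P (- z') (Or44 _ _ _ erefl).
    apply: filterS (filterI (filterI h1 h2) (filterI h3 h4)) => y [[/ltW k1 /ltW k2] [/ltW k3 /ltW k4]].
    by apply/(vor_orth _ ob); split; exact: (strip st).
  move=> [w Ww [p [/(mediatrizP st _ y10 y20 (W w Ww).1) [_ F] /(dirichletP st _ y10 y20) [_ V]] <-]].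
  rewrite kE in F V; have [Ow w0] := W w Ww.
  exact: frontier_vor V Ow w0 F.
Qed.

End Orthogonal.

(** * The cusp group *)

(** Used with [E = e^4], the factor by which the diagonal generator multiplies levels. Bernoulli's
    inequality makes the powers unbounded. *)
Lemma power_interval (R : realType) (E x : R) : 1 < E -> 0 < x ->
  exists l : int, 1 <= x * E ^ l < E.
Proof.
move=> E1 x0; have E0 : 0 < E by rewrite (lt_trans ltr01).
have unb (y : R) : exists N : nat, y < E ^+ N.
  have bern N : 1 + N%:R * (E - 1) <= E ^+ N.
    elim: N => [|N IH]; first by rewrite mul0r addr0 expr0.
    rewrite exprS -natr1; have h : 0 <= N%:R * (E - 1) ^+ 2 by rewrite mulr_ge0 ?sqr_ge0.
    have : E * (1 + N%:R * (E - 1)) <= E * E ^+ N by rewrite ler_pM2l.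
    by nra.
  exists (Num.bound (`|y| / (E - 1))); apply: lt_le_trans (bern _).
  have d0 : 0 < E - 1 by rewrite subr_gt0.
  have : `|y| / (E - 1) < (Num.bound (`|y| / (E - 1)))%:R.
    by rewrite archi_boundP // divr_ge0 // ltW.
  by rewrite ltr_pdivrMr // => h; have := ler_norm y; lra.
have [x1|x1] := leP 1 x.
  case: (ex_minnP (unb x)) => -[|N] hN mN; first by move: hN; rewrite expr0 ltNge x1.
  exists (- N%:Z); rewrite -exprnN.
  have EN : 0 < E ^+ N by rewrite exprn_gt0.
  rewrite ler_pdivlMr // ltr_pdivrMr // mul1r -exprS hN andbT.
  by rewrite leNgt; apply/negP => /mN; rewrite ltnn.
have [N0 hN0] := unb x^-1.
have ex : exists N, x^-1 <= E ^+ N by exists N0; exact: ltW.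
case: (ex_minnP ex) => -[|N] hN mN.
  by move: hN; rewrite expr0 invf_le1 // leNgt x1.
exists N.+1; rewrite -[E ^ _]/(E ^+ N.+1) mulrC -ler_pdivrMr // mul1r hN /=.
rewrite exprS -mulrA gtr_pMr // -ltr_pdivlMr // mul1r ltNge.
by apply/negP => /mN; rewrite ltnn.
Qed.

Lemma det_mx2 (R : comNzRingType) (A : 'M[R]_2) :
  \det A = A ord0 ord0 * A ord_max ord_max - A ord0 ord_max * A ord_max ord0.
Proof.
have E : lift ord0 ord0 = ord_max :> 'I_2 by apply: val_inj.
rewrite (expand_det_row _ ord0) !big_ord_recl big_ord0 addr0 E /cofactor !det_mx11 !mxE /=.
have -> : lift ord0 (0 : 'I_1) = ord_max :> 'I_2 by apply: val_inj.
have -> : lift ord_max (0 : 'I_1) = ord0 :> 'I_2 by apply: val_inj.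
by rewrite expr0 expr1 mul1r mulN1r mulrN.
Qed.

Section Cusp.
Variables (R : realType) (n : nat) (s : R -> R) (e : R).
Hypothesis st : [/\ (2 <= n)%N, squarefree n & galois_conj n s].
Hypothesis fe : fundamental_unit n e.
Local Notation O := (@quad_int R n).

Definition zunit (u : R) : Prop := [/\ O u, O u^-1 & u != 0].

Lemma zunit_norm u : zunit u -> (u * s u) ^+ 2 = 1.
Proof. by case=> Ou Ou' u0; exact: (unit_norm st). Qed.

Lemma zunit_conj u : zunit u -> s u != 0 /\ s u^-1 = (s u)^-1.
Proof.
move=> [Ou Ou' u0]; have su0 : s u != 0.
  by apply: contra_neq u0 => /(conj_eq0 st Ou).
by split=> //; apply: (mulfI su0); rewrite -(conj_mul st) // !mulfV // (conj1 st).
Qed.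

Lemma zunitV u : zunit u -> zunit u^-1.
Proof. by case=> Ou Ou' u0; split; rewrite ?invrK ?invr_eq0. Qed.

Lemma zunitM u v : zunit u -> zunit v -> zunit (u * v).
Proof.
move=> [Ou Ou' u0] [Ov Ov' v0]; split; [exact: quad_intM| |exact: mulf_neq0].
by rewrite invfM; exact: quad_intM.
Qed.

Lemma zunitN u : zunit u -> zunit (- u).
Proof.
by case=> Ou Ou' u0; split; rewrite ?invrN ?oppr_eq0 //; exact: (quad_intN st).
Qed.

Lemma zunit_fund : zunit e.
Proof. by case: fe => -[e0 Oe Oe'] _ _. Qed.

Lemma zunitXz l : zunit (e ^ l).
Proof.
have H N : zunit (e ^+ N).
  elim: N => [|N IH]; last by rewrite exprS; apply: zunitM => //; exact: zunit_fund.
  by rewrite expr0; split; rewrite ?invr1 ?oner_neq0 //; exact: quad_int1.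
by case: l => N; [exact: H|rewrite NegzE -exprnN; apply: zunitV; exact: H].
Qed.

Lemma zunit_gt1 u : zunit u -> 1 < `|u| -> e <= `|u|.
Proof.
move=> zu u1; case: fe => _ _; apply=> //.
have : zunit `|u| by case: (ger0P u) => _ //; exact: zunitN.
by case=> Ou Ou' u0; split.
Qed.

Definition upper (a b : R) : 'M[R]_2 := mx2 a b 0 a^-1.

Lemma cusp_groupP g : cusp_group n s g <-> exists a b, [/\ zunit a, O b & g = upper a b].
Proof.
split.
  move=> [[Og dg]]; rewrite /mobius_infty; case: eqP => // g10 _ _.
  move: dg; rewrite det_mx2 g10 mulr0 subr0 => ad.
  have a0 : g ord0 ord0 != 0 by apply: contra_eq_neq ad => ->; rewrite mul0r eq_sym oner_neq0.
  have dE : g ord_max ord_max = (g ord0 ord0)^-1.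
    by apply: (mulfI a0); rewrite ad mulfV.
  exists (g ord0 ord0), (g ord0 ord_max); split=> //.
    by split=> //; rewrite -dE.
  apply/matrixP => i j; rewrite mxE.
  have ordE (i' : 'I_2) : i' = ord0 \/ i' = ord_max.
    by case: i' => -[|[|m]] // Hm; [left|right]; apply: val_inj.
  by case: (ordE i) => ->; case: (ordE j) => ->.
move=> [a [b [[Oa Oa' a0] Ob ->]]]; split.
- split; last by rewrite det_mx2 !mxE /= mulfV // mulr0 subr0.
  by move=> i j; rewrite mxE; case: ifP => _; case: ifP => _ //; exact: quad_int0.
- by rewrite /mobius_infty !mxE /= eqxx.
- by rewrite /mobius_infty !mxE /= (conj0 st) eqxx.
Qed.

Lemma act_upper a b (p : bipoint R) : zunit a -> act s (upper a b) p =
  ((a ^+ 2 * p.1.1 + a * b, a ^+ 2 * p.1.2),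
   (s a ^+ 2 * p.2.1 + s a * s b, s a ^+ 2 * p.2.2)).
Proof.
move=> za; have [sa0 sV] := zunit_conj za; have [_ _ a0] := za.
rewrite /act !mobius_upper ?mxE //= ?(conj0 st) //.
by rewrite sV !invrK; congr ((_, _), (_, _)); ring.
Qed.

Lemma cusp_domainP (p : bipoint R) : cusp_domain n s e p <->
  [/\ H2H2 p, 1 <= level p < e ^+ 4 & vor n s (level p) (leaf_coord p)].
Proof.
split; first by move=> [h h0 /(sectionP st e _ h0) [? _ ? ?]].
move=> [Hp Hl V].
have [y1 y2] := Hp; have yy : 0 < p.1.2 * p.2.2 by rewrite mulr_gt0.
exists (Num.sqrt (p.1.2 * p.2.2)); first by rewrite /= sqrtr_gt0.
have h0 : 0 < Num.sqrt (p.1.2 * p.2.2) by rewrite sqrtr_gt0.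
apply/(sectionP st e _ h0).
by split=> //; rewrite sqr_sqrtr // ltW.
Qed.

(** The norm of a unit is [1] or [-1], so [(s a)^2 = a^-2] and the quotient of the heights is
    multiplied by [a^4]. *)
Lemma level_upper a b p : zunit a -> H2H2 p -> level (act s (upper a b) p) = a ^+ 4 * level p.
Proof.
move=> za [y1 y2]; rewrite act_upper // /level /=.
have [sa0 _] := zunit_conj za; have [_ _ a0] := za.
have N := zunit_norm za; rewrite exprMn in N.
have -> : s a ^+ 2 = (a ^+ 2)^-1.
  by apply: (mulfI (expf_neq0 2 a0)); rewrite N mulfV // expf_neq0.
by field; rewrite gt_eqF.
Qed.

Lemma act_H2H2 a b p : zunit a -> H2H2 p -> H2H2 (act s (upper a b) p).
Proof.
move=> za [y1 y2]; rewrite act_upper //.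
have [sa0 _] := zunit_conj za; have [_ _ a0] := za.
by split; rewrite /= mulr_gt0 // exprn_even_gt0.
Qed.

(** A power of [e] normalises the level and a translation by [z] moves the result into the cell; the
    group element is the inverse of this composite. *)
Lemma cusp_cover p : H2H2 p -> exists2 g, cusp_group n s g &
  exists2 q, cusp_domain n s e q & act s g q = p.
Proof.
move=> Hp; have [y1 y2] := Hp; have e1 : 1 < e by case: fe.
have lp : 0 < level p by rewrite divr_gt0.
have [l hl] := @power_interval R (e ^+ 4) (level p) ltac:(by rewrite exprn_egt1) lp.
pose u := e ^ l; have zu : zunit u by exact: zunitXz.
have uE : u ^+ 4 = (e ^+ 4) ^ l by rewrite /u !exprnP exprzAC.
pose q0 := act s (upper u 0) p.
have Hq0 : H2H2 q0 by exact: act_H2H2.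
have lq0 : 1 <= level q0 < e ^+ 4 by rewrite level_upper // uE mulrC.
have [q01 q02] := Hq0.
have lq00 : 0 < level q0 by rewrite divr_gt0.
have [z Oz V] := vor_cover st (leaf_coord q0) lq00.
have [su0 sV] := zunit_conj zu; have [Ou Ou' u0] := zu.
exists (upper u^-1 (- (u^-1 * z))).
  apply/cusp_groupP; exists u^-1, (- (u^-1 * z)); split=> //; first exact: zunitV.
  by apply: (quad_intN st); exact: quad_intM.
exists (act s (tau z) q0).
  by apply/cusp_domainP; rewrite (act_tau st).
have OO := quad_intM Ou' Oz.
rewrite act_upper; last exact: zunitV.
rewrite (act_tau st) // (conj_opp st) // (conj_mul st) // sV.
rewrite /q0 act_upper // (conj0 st) /=.
case: p {Hp y1 y2 lp hl q0 Hq0 lq0 q01 q02 lq00 V} => -[x1 y1] [x2 y2] /=.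
by congr ((_, _), (_, _)); field.
Qed.

(** If [a'] equals [a] up to sign, points with a common image differ by a translation by a nonzero
    [w]; both lie in cells, so the excesses for [w] and [-w] are opposite and non-negative, hence
    zero. *)
Lemma cusp_overlap g g' : cusp_group n s g -> cusp_group n s g' -> ~ psl_eq g g' ->
  exists w a : R, [/\ O w, w != 0, a != 0 & forall q q', cusp_domain n s e q -> cusp_domain n s e q' ->
    act s g q = act s g' q' ->
    sform s w (leaf_coord q, level q) = 0 /\
    (act s g q).1.1 = a * q.1.1 + (act s g ((0, q.1.2), q.2)).1.1].
Proof.
move=> /cusp_groupP [a [b [za Ob gE]]] /cusp_groupP [a' [b' [za' Ob' gE']]] ngg.
have [Oa Oa' a0] := za; have [Oc Oc' c0] := za'.
have [sa0 sV] := zunit_conj za; have [sc0 scV] := zunit_conj za'.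
have N := zunit_norm za.
have e1 : 1 < e by case: fe.
have [aa|aa] := boolP (`|a| == `|a'|); last first.
  (* Placeholder witnesses: the two translates share no level, because the quotient of the units has
     absolute value at least [e] or at most [e^-1]. *)
  exists 1, 1; rewrite oner_neq0; split=> //; first exact: quad_int1.
  move=> q q' /cusp_domainP [Hq /andP[l1 l2] _] /cusp_domainP [Hq' /andP[l1' l2'] _] E.
  exfalso.
  have LE : a ^+ 4 * level q = a' ^+ 4 * level q'.
    by rewrite -(level_upper b za Hq) -(level_upper b' za' Hq') -gE -gE' E.
  have key (c d : R) (x y : R) : zunit c -> zunit d -> `|c| < `|d| ->
      c ^+ 4 * x = d ^+ 4 * y -> 1 <= y -> x < e ^+ 4 -> False.
    move=> zc zd cd E' y1 x4; have [_ _ cn0] := zc.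
    have r1 : 1 < `|d / c| by rewrite normf_div ltr_pdivlMr ?mul1r // normr_gt0.
    have re := zunit_gt1 (zunitM zd (zunitV zc)) r1.
    have r4 : e ^+ 4 <= (d / c) ^+ 4.
      have -> : (d / c) ^+ 4 = `|d / c| ^+ 4 by rewrite -normrX ger0_norm // (exprM _ 2 2) sqr_ge0.
      by rewrite lerXn2r // nnegrE // ltW // (lt_trans ltr01).
    have xE : x = (d / c) ^+ 4 * y.
      apply: (mulfI (expf_neq0 4 cn0)); rewrite E' mulrA -exprMn mulrC.
      by rewrite [c * _]mulrC divfK // mulrC.
    have : e ^+ 4 <= x.
      by rewrite xE; apply: le_trans r4 _; rewrite ler_peMr // (exprM _ 2 2) sqr_ge0.
    by rewrite leNgt x4.
  have [h|h|h] := ltrgtP `|a| `|a'|.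
  - exact: (key a a' _ _ za za' h LE l1' l2).
  - exact: (key a' a _ _ za' za h (esym LE) l1 l2').
  - by rewrite h eqxx in aa.
(* The translation [b/a - b'/a'] that takes [q] to [q']. *)
pose w := a^-1 * (b - a * a'^-1 * b').
have Oq : O (a * a'^-1) by exact: quad_intM.
have Ob2 : O (a * a'^-1 * b') by exact: quad_intM.
have Ow : O w by apply: quad_intM => //; exact: (quad_intB st).
have sg : a' = a \/ a' = - a.
  by move: aa; rewrite eqr_norm2 => /orP[/eqP ->|/eqP ->]; [left|right; rewrite opprK].
have w0 : w != 0.
  rewrite mulf_neq0 ?invr_eq0 // subr_eq0; apply/eqP => bE; apply: ngg.
  rewrite gE gE'; case: sg bE => ->; rewrite ?invrN ?mulrN mulfV // ?mulNr mul1r => ->.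
    by left.
  right; apply/matrixP => i j; rewrite !mxE.
  by case: ifP => _; case: ifP => _; rewrite ?opprK ?oppr0 // ?invrN ?opprK.
exists w, (a ^+ 2); split=> //; first by rewrite expf_neq0.
move=> q q' /cusp_domainP [Hq lq V] /cusp_domainP [Hq' lq' V'] E.
split; last by rewrite gE !act_upper //= mulr0 add0r.
have sw : s w = (s a)^-1 * (s b - s a * (s a')^-1 * s b').
  rewrite /w (conj_mul st) ?(conj_sub st) // ?sV; last exact: (quad_intB st).
  by rewrite !(conj_mul st) // scV.
have a2 : a' ^+ 2 = a ^+ 2 by case: sg => ->; rewrite ?sqrrN.
have sa2 : s a' ^+ 2 = s a ^+ 2.
  by case: sg => ->; rewrite ?(conj_opp st) // sqrrN.
have q'E : q' = ((q.1.1 + w, q.1.2), (q.2.1 + s w, q.2.2)).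
  move: E; rewrite gE gE' !act_upper //.
  case: q {Hq lq V} => -[x1 y1] [x2 y2]; case: q' {Hq' lq' V'} => -[x1' y1'] [x2' y2'] /= [E1 E2 E3 E4].
  have nz (c d d' : R) : c != 0 -> c * (d - d') = 0 -> d = d'.
    by move=> cn /eqP; rewrite mulf_eq0 (negbTE cn) subr_eq0 => /eqP.
  have a20 : a ^+ 2 != 0 by rewrite expf_neq0.
  have sa20 : s a ^+ 2 != 0 by rewrite expf_neq0.
  rewrite a2 in E1 E2; rewrite sa2 in E3 E4.
  have [w1 w2] : a ^+ 2 * w = a * b - a' * b' /\ s a ^+ 2 * s w = s a * s b - s a' * s b'.
    rewrite sw /w; split; case: sg => ->; rewrite ?(conj_opp st) //; field; rewrite ?oppr_eq0 ?a0 ?sa0 //.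
  congr ((_, _), (_, _)); [apply: (nz _ _ _ a20)|apply: (nz _ _ _ a20)|apply: (nz _ _ _ sa20)|apply: (nz _ _ _ sa20)].
  - by rewrite mulrBr mulrDr w1; lra.
  - by rewrite mulrBr; lra.
  - by rewrite mulrBr mulrDr w2; lra.
  - by rewrite mulrBr; lra.
have Fq : sform s (- w) (leaf_coord q', level q') = - sform s w (leaf_coord q, level q).
  by rewrite q'E /sform /leaf_coord /level /= (conj_opp st Ow); ring.
have h1 := V w Ow; have := V' (- w) (quad_intN st Ow).
by rewrite Fq oppr_ge0 => h2; apply/eqP; rewrite eq_le h1 h2.
Qed.

Lemma cusp_fundamental : fundamental_domain (@H2H2 R) (cusp_group n s) (@psl_eq R) (act s)
  (cusp_domain n s e).
Proof.
split.
- by move=> p /cusp_domainP [].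
- apply/seteqP; split=> p.
    move=> [g /cusp_groupP [a [b [za _ ->]]] [q /cusp_domainP [Hq _ _] <-]].
    exact: act_H2H2.
  by move=> /cusp_cover [g Gg [q Dq E]]; exists g => //; exists q.
- move=> g g' Gg Gg' ngg; apply/seteqP; split=> // p [Hp Np].
  have [w [a [Ow w0 a0 H]]] := cusp_overlap Gg Gg' ngg.
  (* An open overlap would contain a segment along [x1]. The preimages of its points differ in [x1]
     only, where [sform w] is affine with slope [2w], so it cannot vanish at both. *)
  pose d : bipoint R := ((1, 0), (0, 0)).
  have [r r0 Hr] := @nbhs_line R (bipoint R) p d _ Np.
  have key t : `|t| < r -> exists q, [/\ sform s w (leaf_coord q, level q) = 0,
      act s g q = p + t *: d & (act s g q).1.1 = a * q.1.1 + (act s g ((0, q.1.2), q.2)).1.1].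
    move=> /Hr h; have : H2H2 (p + t *: d).
      by case: Hp => y1 y2; split; rewrite /= scaler0 addr0.
    move=> /h [[q Dq Eq] [q' Dq' Eq']]; exists q.
    by have [h1 h2] := H q q' Dq Dq' (etrans Eq (esym Eq')).
  have [q [F E A]] := key 0 ltac:(by rewrite normr0).
  have r2 : 0 < r / 2 by rewrite divr_gt0.
  have [q' [F' E' A']] := key (r / 2) ltac:(by rewrite gtr0_norm //; lra).
  have {Gg} /cusp_groupP [c [b [zc Ob gE]]] := Gg.
  have [sc0 _] := zunit_conj zc; have [_ _ c0] := zc.
  rewrite gE !act_upper //= in E E' A A'.
  rewrite scale0r addr0 in E.
  have ca : c ^+ 2 * q.1.1 = a * q.1.1 by move: A; rewrite mulr0 add0r => /addIr.
  have pE := E; rewrite -E in E'.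
  have nz (x d1 d2 : R) : x != 0 -> x * d1 = x * d2 -> d1 = d2 by move=> x0 /(mulfI x0).
  have c20 : c ^+ 2 != 0 by rewrite expf_neq0.
  have sc20 : s c ^+ 2 != 0 by rewrite expf_neq0.
  have E1 := congr1 (fun p : bipoint R => p.1.1) E'.
  have E2 := congr1 (fun p : bipoint R => p.1.2) E'.
  have E3 := congr1 (fun p : bipoint R => p.2.1) E'.
  have E4 := congr1 (fun p : bipoint R => p.2.2) E'.
  rewrite /= !scale_reg ?mulr1 ?mulr0 ?addr0 in E1 E2 E3 E4.
  have {}E2 := nz _ _ _ c20 E2; have {}E4 := nz _ _ _ sc20 E4.
  have {}E3 := nz _ _ _ sc20 (addIr _ E3).
  have {}E1 : c ^+ 2 * (q'.1.1 - q.1.1) = r / 2 by rewrite mulrBr; lra.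
  have x1 : q'.1.1 - q.1.1 != 0.
    by apply: contraTneq r2 => x0; rewrite -E1 x0 mulr0 ltxx.
  have : 2 * w * (q'.1.1 - q.1.1) = 0.
    rewrite -[RHS](subrr 0) -{1}F' -F /sform /leaf_coord /level /= E2 E3 E4; ring.
  by move/eqP; rewrite !mulf_eq0 (negbTE w0) (negbTE x1) pnatr_eq0.
Qed.

Lemma trivIset_section : trivIset [set h : R | 0 < h] (cusp_section n s e).
Proof.
move=> h h' h0 h0' [p [/(sectionP st e _ h0) [_ E _ _] /(sectionP st e _ h0') [_ E' _ _]]].
apply/eqP; rewrite -(@eqrXn2 _ 2) // ?(ltW h0) ?(ltW h0') //.
by rewrite -E -E'.
Qed.

Lemma vor_tau k x z : O z -> vor n s k x -> sform s z (x, k) = 0 ->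
  vor n s k (x.1 + z, x.2 + s z).
Proof.
move=> Oz V F w' Ow'; have := V _ (quad_intD st Ow' Oz).
have -> : sform s w' ((x.1 + z, x.2 + s z), k) = sform s (w' + z) (x, k) - sform s z (x, k).
  by rewrite /sform (conj_add st) //=; ring.
by rewrite F subr0.
Qed.

Lemma tau_side h z : 0 < h -> O z ->
  act s (tau z) @` side n s e h z = side n s e h (- z).
Proof.
move=> h0 Oz; have Oz' := quad_intN st Oz.
have half w p : O w -> side n s e h w p -> side n s e h (- w) (act s (tau w) p).
  move=> Ow [/(sectionP st e _ h0) [Hp yy lp V] F]; rewrite (act_tau st) //.
  have {}F : sform s w (leaf_coord p, level p) = 0 := F.
  split.
    apply/(sectionP st e _ h0); split=> //.
    exact: (vor_tau Ow V F).
  have E : sform s (- w) (Psi ((p.1.1 + w, p.1.2), (p.2.1 + s w, p.2.2))) =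
    - sform s w (leaf_coord p, level p).
    by rewrite /sform (conj_opp st Ow) /=; ring.
  by have : sform s (- w) (Psi ((p.1.1 + w, p.1.2), (p.2.1 + s w, p.2.2))) = 0 by rewrite E F oppr0.
apply/seteqP; split=> [_ [p Hp <-]|p Hp]; first exact: half.
(* The reverse inclusion is the same statement for [-z]. *)
exists (act s (tau (- z)) p); first by have := half (- z) p Oz' Hp; rewrite opprK.
rewrite !(act_tau st) // (conj_opp st Oz) /= !subrK.
by case: p {Hp} => -[? ?] [? ?].
Qed.

(** Multiplication by [u^-2] permutes the lattice, and [sform z] at the image point is [u^4] times
    [sform] of [u^-2 z] at the original one. *)
Lemma vor_scale u k x : zunit u -> vor n s k x ->
  vor n s (u ^+ 4 * k) (u ^+ 2 * x.1, s u ^+ 2 * x.2).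
Proof.
move=> zu V z Oz; have [su0 sV] := zunit_conj zu; have [Ou Ou' u0] := zu.
have N := zunit_norm zu; rewrite exprMn in N.
have Ou2 : O (u^-1 * u^-1) by exact: quad_intM.
have := V _ (quad_intM Ou2 Oz); set z' := u^-1 * u^-1 * z.
have sz' : s z' = (s u)^-1 * (s u)^-1 * s z by rewrite /z' !(conj_mul st) // sV.
have su2 : (s u)^-1 * (s u)^-1 = u ^+ 2.
  by apply: (mulIf (expf_neq0 2 su0)); rewrite N -invfM -expr2 mulVf // expf_neq0.
have suE : s u ^+ 2 = (u ^+ 2)^-1.
  by apply: (mulfI (expf_neq0 2 u0)); rewrite N mulfV // expf_neq0.
have -> : sform s z ((u ^+ 2 * x.1, s u ^+ 2 * x.2), u ^+ 4 * k) = u ^+ 4 * sform s z' (x, k).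
  by rewrite /sform sz' su2 suE /z' /=; field.
by move=> h; rewrite mulr_ge0 // (exprM _ 2 2) sqr_ge0.
Qed.

Lemma eta_gluing h : 0 < h ->
  act s (eta e 1) @` (cusp_section_bar n s e h `&` [set p | level p = 1])
    = cusp_section_bar n s e h `&` [set p | level p = e ^+ 4].
Proof.
move=> h0; have e1 : 1 < e by case: fe.
have e41 : 1 < e ^+ 4 by rewrite exprn_egt1.
have etaE : eta e 1 = upper e 0 by rewrite /eta /upper.
have bar a p : zunit a -> H2H2 p -> p.1.2 * p.2.2 = h ^+ 2 -> vor n s (level p) (leaf_coord p) ->
  1 <= a ^+ 4 * level p <= e ^+ 4 -> cusp_section_bar n s e h (act s (upper a 0) p).
  move=> za Hp yy V lv; apply/(section_barP st e _ h0); split.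
  - exact: act_H2H2.
  - rewrite act_upper //=; have N := zunit_norm za; rewrite exprMn in N.
    by rewrite mulrACA N mul1r.
  - by rewrite level_upper.
  - rewrite level_upper // act_upper // (conj0 st) /leaf_coord /= !mulr0 !addr0.
    exact: (vor_scale za V).
have ze := zunit_fund.
rewrite etaE; apply/seteqP; split=> [_ [p [/(section_barP st e _ h0) [Hp yy lp V] /= l1] <-]|p].
  split; last by rewrite /= level_upper // l1 mulr1.
  by apply: bar => //; rewrite l1 mulr1 lexx ltW.
move=> [/(section_barP st e _ h0) [Hp yy lp V] /= l1].
have [_ _ e0] := ze; have ze' := zunitV ze.
have l1' : e^-1 ^+ 4 * level p = 1 by rewrite l1 -exprMn mulVf // expr1n.
exists (act s (upper e^-1 0) p).
  split; last by rewrite /= level_upper.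
  by apply: bar => //; rewrite l1' lexx ltW.
have [se0 sV] := zunit_conj ze.
rewrite !act_upper // (conj0 st) sV; case: p {Hp yy lp V l1 l1'} => -[x1 y1] [x2 y2] /=.
by congr ((_, _), (_, _)); field.
Qed.

End Cusp.

(** * Exceptional levels and the assembled description of a section *)

Section Assembly.
Variables (R : realType) (n : nat) (s : R -> R) (e : R).
Hypothesis st : [/\ (2 <= n)%N, squarefree n & galois_conj n s].
Hypothesis fe : fundamental_unit n e.
Local Notation O := (@quad_int R n).
Local Notation Q := (pairseq n s).

Lemma pair_levelE (p : R * R) : good n s p ->
  [/\ 0 < pair_level s p.1 p.2, pair_level s p.1 p.2 ^+ 2 = sqlevel s p
    & orthogonal_basis n s (pair_level s p.1 p.2) p.1 p.2].
Proof.
move=> gp; have l0 := sqlevel_gt0 gp; have [Z p1 p2 sp] := gp; have [Op Op' _ _] := Z.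
have E : pair_level s p.1 p.2 = Num.sqrt (sqlevel s p).
  by rewrite /pair_level /sqlevel (conj_mul st) // invrN mulrN mulNr.
have E2 : pair_level s p.1 p.2 ^+ 2 = sqlevel s p by rewrite E sqr_sqrtr // ltW.
split=> //; first by rewrite E sqrtr_gt0.
split=> //; rewrite /bil E2 /sqlevel.
have : s p.1 * s p.2 != 0 by rewrite lt_eqF.
by rewrite mulf_eq0 negb_or => /andP[h1 h2]; field; rewrite h1 h2.
Qed.

Variables (M m : nat).
Local Notation L := (listL n s m).
Local Notation kk := (fun i => pair_level s (zseq n s i) (zseq' n s i)).
Hypotheses (M0 : (0 < M)%N) (mE : m = (M + offset n)%N) (hM1 : sqlevel s (Q M.-1) < e ^+ 8)
  (hcase : if (n %% 4 == 1)%N then sqlevel s (Q 0) < 1 /\ e ^+ 8 < sqlevel s (Q M)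
      else sqlevel s (Q 0) = 1 /\ sqlevel s (Q M) = e ^+ 8)
  (HL : forall z, L z <-> exists2 j, (j <= M)%N & in_pair z (Q j)).

Let e1 : 1 < e. Proof. by case: fe. Qed.

Let hM : e ^+ 8 <= sqlevel s (Q M).
Proof. by move: hcase; case: ifP => _ [_]; [exact: ltW|move=> ->]. Qed.

Lemma kkE i : (0 < i)%N -> [/\ 0 < kk i, kk i ^+ 2 = sqlevel s (Q (i - offset n))
    & orthogonal_basis n s (kk i) (zseq n s i) (zseq' n s i)].
Proof.
move=> i0; have P := pairs_pairseq st i0.
have gp := same_pair_good P (good_pairseq st _).
have [h1 h2 h3] := pair_levelE gp.
by split=> //; rewrite h2; exact: same_pair_sqlevel P.
Qed.

Let k2e8 (k : R) : 0 <= k -> (k <= e ^+ 4) = (k ^+ 2 <= e ^+ 8).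
Proof.
by move=> k0; rewrite -expr8 ler_sqr // nnegrE exprn_ge0 // ltW // (lt_trans ltr01).
Qed.

Let k21 (k : R) : 0 <= k -> (1 <= k) = (1 <= k ^+ 2).
Proof. by move=> k0; rewrite -[in RHS](expr1n _ 2) ler_sqr // nnegrE. Qed.

Lemma sqlevel_le i j : (i <= j)%N -> sqlevel s (Q i) <= sqlevel s (Q j).
Proof. by rewrite leq_eqVlt => /orP[/eqP ->//|/(pairseq_mono st)/ltW]. Qed.

Lemma exceptional_pos i : exceptional_index n m i -> (0 < i)%N.
Proof.
by case=> [/andP[]//|[_ ->]]; rewrite mE addn_gt0 M0.
Qed.

Lemma kk_bounds i : exceptional_index n m i -> 1 <= kk i <= e ^+ 4.
Proof.
move=> ex; have i0 := exceptional_pos ex; have [k0 k2 _] := kkE i0.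
have k0' := ltW k0; rewrite (k21 k0') (k2e8 k0') k2.
move: hcase ex; rewrite mE /offset; case: ifP => n1 [h0 hM'] [] /=.
- move=> /andP[_]; rewrite addn0 subn0 => iM; apply/andP; split.
    have [_ l1] := andP (sqlevel_start st).
    by apply: le_trans (ltW l1) _; exact: (@sqlevel_le 1 i).
  apply: le_trans (ltW hM1); apply: sqlevel_le.
  by rewrite -ltnS prednK.
- by case=> /eqP; rewrite n1.
- move=> /andP[_]; rewrite addn1 ltnS subn1 => iM.
  rewrite -h0 -hM' !sqlevel_le //.
  exact: leq_trans (leq_pred _) iM.
- move=> [_ ->]; rewrite addn1 subn1 /=.
  by rewrite -h0 -hM' !sqlevel_le.
Qed.

Lemma kk_last : ((n %% 4 <> 1)%N -> kk m = e ^+ 4) /\ ((n %% 4 = 1)%N -> e ^+ 4 < kk m).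
Proof.
have m0 : (0 < m)%N by rewrite mE addn_gt0 M0.
have [k0 k2 _] := kkE m0.
have -> : (kk m = e ^+ 4) <-> (kk m ^+ 2 = e ^+ 8).
  split=> [->|E]; first by rewrite expr8.
  have e40 : 0 <= e ^+ 4 by rewrite exprn_ge0 // ltW // (lt_trans ltr01).
  by apply/eqP; rewrite -(@eqrXn2 _ 2) ?(ltW k0) ?e40 // E expr8.
have -> : (e ^+ 4 < kk m) = (e ^+ 8 < kk m ^+ 2).
  by rewrite !ltNge (k2e8 (ltW k0)).
rewrite k2 mE addnK; move: hcase; case: ifP => n1 [h0 hM'].
  by split=> [/eqP|//]; rewrite n1.
by split=> // /eqP; rewrite n1.
Qed.

Lemma slice_region k : 1 <= k <= e ^+ 4 -> slice (region_bar n s e) k = vor n s k.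
Proof. by move=> hk; apply/seteqP; split=> [x [_]|x V]. Qed.

(** The reduced pair at level [k] is either strictly obtuse, giving a hexagon, or orthogonal, in
    which case [k] is the level of a pair of the sequence. *)
Lemma hexagon_slice k : 1 <= k <= e ^+ 4 ->
  (hexagon (vor n s k) <-> forall i, exceptional_index n m i -> k <> kk i).
Proof.
move=> hk; have k0 : 0 < k by case/andP: hk => k1 _; exact: lt_le_trans ltr01 k1.
have k0' : k != 0 by rewrite gt_eqF.
split=> [hex i ex kE|H].
  have [_ _ ob] := kkE (exceptional_pos ex); rewrite -kE in ob.
  exact: para_not_hexagon (parallelogram_vor st k0' ob) hex.
have [j [jM red jM']] := level_pair st fe hM hk; have gj := good_pairseq st j.
have [g1|g1] := ltP (bil s k (Q j).1 (Q j).2) 0; first exact: (hexagon_vor st k0' red g1).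
exfalso; have g0 : bil s k (Q j).1 (Q j).2 <= 0 by case: red.
have lj : sqlevel s (Q j) = k ^+ 2.
  apply/eqP; rewrite eq_le -(bil_le0 _ gj) g0 /= leNgt -(bil_lt0 _ gj) -leNgt //.
have /andP[k1 k4] := hk; rewrite (k21 (ltW k0)) in k1; rewrite (k2e8 (ltW k0)) in k4.
(* For [n = 1 mod 4] the first and last pairs have levels outside the section and drop out;
   otherwise their levels are exactly [1] and [e^4] and both count. *)
have ex : exceptional_index n m (j + offset n).
  rewrite mE; move: hcase; rewrite /offset /exceptional_index; case: ifP => n1 [h0 hM'] /=.
    rewrite !addn0; left; rewrite lt0n; apply/andP; split.
      by apply: contraTneq k1 => j0; rewrite -lj j0 -ltNge.
    rewrite ltn_neqAle jM andbT; apply: contraTneq k4 => jE.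
    by rewrite -lj jE -ltNge.
  rewrite !addn1 ltnS; move: jM; rewrite leq_eqVlt => /orP[/eqP ->|jM]; last by left.
  by right; split=> //; apply/eqP; rewrite n1.
apply: (H _ ex); have [h1 h2 _] := kkE (exceptional_pos ex).
apply/eqP; rewrite -(@eqrXn2 _ 2) ?(ltW k0) ?(ltW h1) //.
by rewrite h2 addnK lj.
Qed.

Lemma sides_of_section h : 0 < h -> sides_description n s e m h.
Proof.
move=> h0; rewrite /sides_description (Psi_section st e h0); split.
- by move=> q [/andP[k1 k4] _]; rewrite k1 ltW.
- exact: (region_planes st fe hM HL).
- move=> z; rewrite /contributes_face (Psi_section st e h0).
  exact: (contributes_region st fe M0 hM1 hM HL).
- exact: (frontier_region st fe hM HL).
Qed.

Lemma shapes_of_slices h : 0 < h -> torus_shapes n s e m h.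
Proof.
move=> h0; rewrite /torus_shapes (Psi_section st e h0) (Psi_section_bar st e h0).
have bounded i : (0 < i)%N -> parallelogram_bounded_by n s h (kk i) (zseq n s i) (zseq' n s i).
  by move=> i0; have [k0 _ ob] := kkE i0; exact: orth_bounded.
split.
- exact: (closure_region st fe hM HL).
- move=> k hk; rewrite slice_region //; apply: flat_torus_vor => //.
  by case/andP: hk => k1 _; exact: lt_le_trans ltr01 k1.
- by move=> k hk; rewrite slice_region //; exact: hexagon_slice.
- move=> i ex; have i0 := exceptional_pos ex; have hk := kk_bounds ex.
  split=> //; first exact: bounded.
  have [k0 _ _] := kkE i0; have [y10 y20] := sqrt_pos h0 k0.
  by rewrite slice_region // leaf_coord_dirichlet // level_sqrt.
- have [h1 h2] := kk_last; split=> // n1; split; first exact: h2.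
  by apply: bounded; rewrite mE addn_gt0 M0.
Qed.

Lemma gluing_of_sides h : 0 < h -> gluing_maps n s e m h.
Proof.
move=> h0; split; last exact: (eta_gluing st fe h0).
move=> z /(listL_int st HL) [Oz _]; exact: tau_side.
Qed.

End Assembly.

Theorem theorem4p3 (R : realType) (n : nat) (s : R -> R) (e : R)
  (n_ge2 : (2 <= n)%N) (n_sqfree : squarefree n)
  (s_conj : galois_conj n s) (e_fund : fundamental_unit n e) :
  [/\ fundamental_domain (@H2H2 R) (cusp_group n s) (@psl_eq R) (act s)
        (cusp_domain n s e),
      trivIset [set h : R | 0 < h] (cusp_section n s e),
      forall h h' : R, 0 < h -> 0 < h' ->
        @Psi R @` cusp_section n s e h = @Psi R @` cusp_section n s e h'
    & exists2 m : nat, stopping_index n s e m &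
        forall h : R, 0 < h ->
          [/\ sides_description n s e m h,
              torus_shapes n s e m h
            & gluing_maps n s e m h]].
Proof.
have st : [/\ (2 <= n)%N, squarefree n & galois_conj n s] by [].
split.
- exact: cusp_fundamental st e_fund.
- exact: trivIset_section st.
- by move=> h h' h0 h0'; rewrite !(Psi_section st).
- have [M [m [[M0 mE stop] hM1 hcase HL]]] := listL_pairseq st e_fund.
  exists m => // h h0; split.
  + exact: (sides_of_section st e_fund M0 hM1 hcase HL).
  + exact: (shapes_of_slices st e_fund M0 mE hM1 hcase HL).
  + exact: (gluing_of_sides st e_fund HL).
Qed.
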